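(* The space $$\mathcal T_1=\Big\{\mathcal J=\sum_{1\le\alpha<\beta\le9}x_{\alpha\beta}I_\alpha I_\beta:\ x_{\alpha\beta}\in\mathbb R,\ \mathcal J^2=-\mathrm{Id}\Big\}=Spin(9)/(Spin(2)\times_{\mathbb Z_2}Spin(7))$$ is a complex manifold isomorphic to the quadric $Q=\{[z_0:\dots:z_8]\in\mathbb P^8(\mathbb C):\ z_0^2+\dots+z_8^2=0\}$.
   Context: $I_1,\dots,I_9$ are symmetric endomorphisms of Euclidean $\mathbb R^{16}$ with $I_\alpha^2=\mathrm{Id}$ and $I_\alpha I_\beta=-I_\beta I_\alpha$ for $\alpha\ne\beta$. $\mathbb R^9\subset\mathrm{End}(\mathbb R^{16})$ is their span, with the $I_\alpha$ orthonormal, and $Spin(9)\subset SO(16)$ is the group of all products of an even number of unit vectors of this $\mathbb R^9$; it acts on $\mathcal T_1$ by conjugation. $Spin(2)\times_{\mathbb Z_2}Spin(7)\subset Spin(9)$ is the preimage of $SO(2)\times SO(7)\subset SO(9)$; it is the isotropy group of $I_1I_2$. The complex structure of $\mathcal T_1$ at $\mathcal J$ is $\frac12\mathrm{ad}(\mathcal J):a\mapsto\frac12[\mathcal J,a]$ on the tangent space $T_{\mathcal J}\mathcal T_1=\{a\in\mathrm{Lin}(I_\alpha I_\beta:\alpha<\beta):\ [\mathcal J,[\mathcal J,a]]=-4a\}$. *)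

(* Defs.v *)
From HB Require Import structures.
From mathcomp Require Import all_boot all_order all_algebra.
From mathcomp Require Import complex.
From mathcomp Require Import all_classical all_reals all_analysis.

Set Implicit Arguments.
Unset Strict Implicit.
Unset Printing Implicit Defensive.

Import Order.TTheory GRing.Theory Num.Theory.
Import numFieldNormedType.Exports.

Local Open Scope classical_set_scope.
Local Open Scope ring_scope.
Local Open Scope quotient_scope.

(* Bundled, so that matrices over C carry the topology and the norm that every
   [numFieldType] has. *)
Definition Cplx (R : realType) : numClosedFieldType := R[i].

Section ComplexManifolds.
Context (R : realType).
Local Notation C := (Cplx R).

(* A chart [cmap : cdom -> C^n] together with a total function [cinv] whose
   values matter only on the image of [cdom]. *)
Record chart (X : topologicalType) (n : nat) := Chart {
  cdom : set X;
  cmap : X -> 'rV[C]_n;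
  cinv : 'rV[C]_n -> X }.

Definition cimg (X : topologicalType) n (c : chart X n) : set 'rV[C]_n :=
  cmap c @` cdom c.

Definition is_chart (X : topologicalType) n (c : chart X n) : Prop :=
  [/\ open (cdom c), open (cimg c),
      forall x, cdom c x -> cinv c (cmap c x) = x,
      {within cdom c, continuous (cmap c)} &
      {within cimg c, continuous (cinv c)}].

(* [differentiable] is taken over the field C: the maps below are complex
   differentiable at every point of an open set, i.e. holomorphic. *)
Definition holomorphic_change (X : topologicalType) n (c d : chart X n) : Prop :=
  forall x, cdom c x -> cdom d x ->
    differentiable (cmap d \o cinv c) (cmap c x).

Definition complex_atlas (X : topologicalType) n (A : set (chart X n)) : Prop :=
  [/\ forall c, A c -> is_chart c,
      forall x, exists2 c, A c & cdom c x &
      forall c d, A c -> A d -> holomorphic_change c d].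

Definition complex_manifold (X : topologicalType) n (A : set (chart X n)) : Prop :=
  [/\ hausdorff_space X, @second_countable X & complex_atlas A].

Definition holomorphic (X Y : topologicalType) n m
    (A : set (chart X n)) (B : set (chart Y m)) (f : X -> Y) : Prop :=
  continuous f /\
  forall c d x, A c -> B d -> cdom c x -> cdom d (f x) ->
    differentiable (cmap d \o f \o cinv c) (cmap c x).

Definition biholomorphic (X Y : topologicalType) n m
    (A : set (chart X n)) (B : set (chart Y m)) (f : X -> Y) : Prop :=
  holomorphic A B f /\
  exists g : Y -> X, [/\ cancel f g, cancel g f & holomorphic B A g].

Definition maximal_atlas (X : topologicalType) n (A : set (chart X n))
    : set (chart X n) :=
  [set c | is_chart c /\
    forall d, A d -> holomorphic_change c d /\ holomorphic_change d c].

Definition adapted_chart (X : topologicalType) n k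
    (A : set (chart X (n + k))) (S : set X) (d : chart X (n + k)) : Prop :=
  maximal_atlas A d /\ forall x, cdom d x -> (S x <-> rsubmx (cmap d x) = 0).

Definition complex_submanifold (X : topologicalType) n k
    (A : set (chart X (n + k))) (S : set X) : Prop :=
  forall x, S x -> exists2 d, adapted_chart A S d & cdom d x.

Definition submanifold_atlas (X : topologicalType) n k
    (A : set (chart X (n + k))) (S : set X) : set (chart S n) :=
  [set c | exists2 d, adapted_chart A S d &
    [/\ cdom c = set_val @^-1` cdom d,
        forall x, cdom c x -> cmap c x = lsubmx (cmap d (set_val x)) &
        forall x, cdom c x -> cinv c (cmap c x) = x]].

End ComplexManifolds.

Arguments complex_submanifold {R X} n k A S.
Arguments submanifold_atlas {R X} n k A S.


Definition homeomorphism (X Y : topologicalType) (f : X -> Y) : Prop :=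
  continuous f /\
  exists g : Y -> X, [/\ cancel f g, cancel g f & continuous g].

Section ProjectiveSpace.
Context (R : realType) (n : nat).
Local Notation C := (Cplx R).

Definition nzvec : set 'rV[C]_n.+1 := [set v | v != 0].

Definition proportional (u v : nzvec) : bool :=
  `[< exists2 c : C, c != 0 & set_val v = c *: set_val u >].

Lemma proportional_refl : reflexive proportional.
Proof. by move=> u; apply/asboolP; exists 1; rewrite ?oner_neq0 ?scale1r. Qed.

Lemma proportional_sym : symmetric proportional.
Proof.
suff H u v : proportional u v -> proportional v u.
  by move=> u v; apply/idP/idP; exact: H.
move=> /asboolP[c c0 e]; apply/asboolP; exists c^-1; first by rewrite invr_eq0.
by rewrite e scalerA mulVf// scale1r.
Qed.

Lemma proportional_trans : transitive proportional.
Proof.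
move=> v u w /asboolP[c c0 e] /asboolP[d d0 f]; apply/asboolP.
by exists (d * c); [rewrite mulf_neq0|rewrite f e scalerA].
Qed.

Definition proportional_equiv :=
  EquivRel proportional proportional_refl proportional_sym proportional_trans.
Canonical proportional_equiv.

Definition Proj : Type := quotient_topology {eq_quot proportional}.
HB.instance Definition _ :=
  Topological.copy Proj (quotient_topology {eq_quot proportional}).
HB.instance Definition _ :=
  Quotient.copy Proj (quotient_topology {eq_quot proportional}).

Definition hcoord (p : Proj) : 'rV[C]_n.+1 := set_val (repr p : nzvec).

Definition insert1 (j : 'I_n.+1) (w : 'rV[C]_n) : 'rV[C]_n.+1 :=
  \row_i (if unlift j i is Some k then w 0 k else 1).

Lemma insert1_neq0 j w : insert1 j w \in nzvec.
Proof.
rewrite inE /nzvec /=; apply/eqP => /matrixP/(_ 0 j).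
by rewrite !mxE unlift_none => /eqP; rewrite oner_eq0.
Qed.

Definition affine_chart (j : 'I_n.+1) : chart R Proj n :=
  Chart (fun p => hcoord p 0 j != 0)
        (fun p => \row_i (hcoord p 0 (lift j i) / hcoord p 0 j))
        (fun w => \pi_Proj (exist _ (insert1 j w) (insert1_neq0 j w) : nzvec)).

Definition proj_atlas : set (chart R Proj n) := range affine_chart.

Definition quadric : set Proj := [set p | \sum_i hcoord p 0 i ^+ 2 = 0].

End ProjectiveSpace.

Arguments proj_atlas R n : clear implicits.
Arguments quadric R n : clear implicits.

Section Clifford.
Context (R : realType) (I : 'I_9 -> 'M[R]_16).
Local Notation C := (Cplx R).

Definition clif (x : 'rV[R]_9) : 'M[R]_16 := \sum_a x 0 a *: I a.

Definition unit_vector (x : 'rV[R]_9) : Prop := \sum_a x 0 a ^+ 2 = 1.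

Definition Spin9 : set 'M[R]_16 :=
  [set g | exists s : seq 'rV[R]_9,
    [/\ ~~ odd (size s), forall v, v \in s -> unit_vector v &
        g = \prod_(v <- s) clif v]].

Definition SO (n : nat) : set 'M[R]_n := [set A | A *m A^T = 1%:M /\ \det A = 1].

Arguments SO n : clear implicits.

(* The covering Spin(9) -> SO(9) sends [g] to the map [v |-> g v g^-1] of the
   span of the [I a]. *)
Definition Spin2Spin7 : set 'M[R]_16 :=
  [set g | Spin9 g /\
    exists A B, [/\ SO 2 A, SO 7 B &
      forall v : 'rV[R]_(2 + 7),
        g * clif v * g^-1 = clif (v *m block_mx A 0 0 B)]].

Definition lcoset_Spin (g : 'M[R]_16) : set 'M[R]_16 :=
  [set g * h | h in Spin2Spin7].

Definition same_lcoset (g h : Spin9) : bool :=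
  `[< lcoset_Spin (set_val g) = lcoset_Spin (set_val h) >].

Lemma same_lcoset_refl : reflexive same_lcoset.
Proof. by move=> g; apply/asboolP. Qed.

Lemma same_lcoset_sym : symmetric same_lcoset.
Proof. by move=> g h; apply/asboolP/asboolP. Qed.

Lemma same_lcoset_trans : transitive same_lcoset.
Proof. by move=> h g k /asboolP gh /asboolP hk; apply/asboolP; rewrite gh. Qed.

Definition same_lcoset_equiv :=
  EquivRel same_lcoset same_lcoset_refl same_lcoset_sym same_lcoset_trans.
Canonical same_lcoset_equiv.

Definition SpinQuotient : Type := quotient_topology {eq_quot same_lcoset}.
HB.instance Definition _ :=
  Topological.copy SpinQuotient (quotient_topology {eq_quot same_lcoset}).
HB.instance Definition _ :=
  Quotient.copy SpinQuotient (quotient_topology {eq_quot same_lcoset}).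

Definition Lin2 : set 'M[R]_16 :=
  [set a | exists x : 'I_9 -> 'I_9 -> R,
    a = \sum_(i < 9) \sum_(j < 9 | (i < j)%N) x i j *: (I i * I j)].

Definition T1 : set 'M[R]_16 := [set J | Lin2 J /\ J * J = - 1].

Definition lie (a b : 'M[R]_16) : 'M[R]_16 := a * b - b * a.

Definition tangentT1 (J : 'M[R]_16) : set 'M[R]_16 :=
  [set a | Lin2 a /\ lie J (lie J a) = - (4 *: a)].

(* The base point I_1 I_2. *)
Definition J12 : 'M[R]_16 := I 0 * I 1.

Definition orbit12 (g : 'M[R]_16) : 'M[R]_16 := g * J12 * g^-1.

(* The orbit map Spin(9) -> T1 is a submersion: each tangent vector of T1 at
   [orbit12 g] is the velocity of the image of a curve of Spin(9) through [g].
   The smooth structure of Spin(9)/H is the one for which the projection from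
   Spin(9) is a submersion, so that with the bijectivity of Spin(9)/H -> T1 this
   makes the latter a diffeomorphism. *)
Definition orbit12_submersion : Prop :=
  forall g a, Spin9 g -> tangentT1 (orbit12 g) a ->
    exists c : R -> 'M[R]_16,
      [/\ c 0 = g, forall t, Spin9 (c t), derivable c 0 1 &
          is_derive (0 : R) (1 : R) (orbit12 \o c) a].

(* C^n as a real vector space, and the multiplication by i on it. *)
Definition of_real_pair n (p : 'rV[R]_n * 'rV[R]_n) : 'rV[C]_n :=
  \row_j (p.1 0 j +i* p.2 0 j)%C.

Definition imul_pair n (p : 'rV[R]_n * 'rV[R]_n) : 'rV[R]_n * 'rV[R]_n :=
  (- p.2, p.1).

Definition parametrization n (c : chart R T1 n) (p : 'rV[R]_n * 'rV[R]_n)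
    : 'M[R]_16 :=
  set_val (cinv c (of_real_pair p)).

(* The holomorphic charts of T1 with its complex structure ad(J)/2: those whose
   inverse is, as a map into the Euclidean space 'M[R]_16, an immersion onto T1
   (its differential is an isomorphism onto the tangent space) intertwining the
   multiplication by i with ad(J)/2.  As for holomorphic functions, asking for
   differentiability is enough: such maps are smooth. *)
Definition T1_atlas : set (chart R T1 7) :=
  [set c | is_chart c /\
    forall p, cimg c (of_real_pair p) ->
      let psi := parametrization c in
      [/\ differentiable psi p,
          injective ('d psi p),
          range ('d psi p) = tangentT1 (psi p) &
          forall v, 'd psi p (imul_pair v) = 2^-1 *: lie (psi p) ('d psi p v)]].

End Clifford.

Arguments T1_atlas {R} I.
Arguments SpinQuotient {R} I.

(* Main.v *)
(* For J in T_1 and a vector x of R^9 the commutator u = [J, x] is a vector, not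
   zero for all x, and then v = J u is a vector orthogonal to u, of the same
   length, with J = v u / |u|^2.  Thus J is an oriented 2-plane of R^9,
   and z = u + i v is an isotropic vector of C^9, unique up to a complex factor.
   Where z_j + i z_k <> 0 the quadric is a graph over C^7; the resulting
   parametrizations J(w) of T_1 are studied by differentiating J u = v, which
   shows that multiplication by i on z becomes ad(J)/2 and that the differential
   is onto the tangent space.  A continuous lift of a differentiable map through
   an injective differential is differentiable, so the charts of T_1 are mutually
   holomorphic.  On the other side, an even product of vectors acts on R^9 by a
   product of half-turns; two half-turns carry any orthonormal pair to any other,
   by a formula continuous in the pair, which gives transitivity and continuous
   local sections of Spin(9) -> T_1, while the stabilizer of I_1 I_2 consists of
   the elements acting on R^9 by SO(2) x SO(7). *)

Require Import Defs.
From HB Require Import structures.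
From mathcomp Require Import all_boot all_order all_algebra.
From mathcomp Require Import complex ring lra.
From mathcomp Require Import all_classical all_reals all_analysis.

Set Implicit Arguments.
Unset Strict Implicit.
Unset Printing Implicit Defensive.

Import Order.TTheory GRing.Theory Num.Theory.
Import numFieldNormedType.Exports.

Local Open Scope classical_set_scope.
Local Open Scope ring_scope.
Local Open Scope quotient_scope.

(** Two difficulties shape the proof. An element of [T1] is given only as a square root of -1 of
    degree 2, not as a product of two vectors. Its decomposability is extracted from [J * J = -1]
    alone: this relation makes every commutator u = [J, x] anticommute with J, so that J u = [J, u]
    / 2 is again a vector. From then on the relation J u = v ([frame]), linear in the pair (u, v),
    replaces explicit formulas for J; products such as [cl v * cl u] are recovered from it. The
    second difficulty is that the atlas of [T1] is intrinsic: it contains every chart whose inverse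
    has the prescribed differential, so its members cannot be listed. Their compatibility has to
    follow from first-order data over R at each point, and holomorphy is obtained as real
    differentiability plus complex linearity of the differential. Explicit charts enter only as a
    covering subfamily through which [T1] and the quadric are compared. No frame of J can be
    selected continuously on all of [T1]. The global maps are therefore defined by an arbitrary
    choice, shown to be independent of it, and proved continuous with a choice that is good near a
    given point. *)

Section Dot.
Context (R : realType).
Implicit Types (x y z : 'rV[R]_9) (k : R).

Definition dot x y : R := \sum_a x 0 a * y 0 a.

Lemma dotC x y : dot x y = dot y x.
Proof. by apply: eq_bigr => a _; rewrite mulrC. Qed.

Lemma dotDl x y z : dot (x + y) z = dot x z + dot y z.
Proof. by rewrite -big_split; apply: eq_bigr => a _; rewrite !mxE mulrDl. Qed.

Lemma dotZl k x y : dot (k *: x) y = k * dot x y.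
Proof. by rewrite mulr_sumr; apply: eq_bigr => a _; rewrite !mxE mulrA. Qed.

Lemma dotDr x y z : dot x (y + z) = dot x y + dot x z.
Proof. by rewrite dotC dotDl !(dotC x). Qed.

Lemma dotZr k x y : dot x (k *: y) = k * dot x y.
Proof. by rewrite dotC dotZl dotC. Qed.

Lemma dotNl x y : dot (- x) y = - dot x y.
Proof. by rewrite -scaleN1r dotZl mulN1r. Qed.

Lemma dotNr x y : dot x (- y) = - dot x y.
Proof. by rewrite dotC dotNl dotC. Qed.

Lemma dot_ge0 x : 0 <= dot x x.
Proof. by apply: sumr_ge0 => a _; rewrite -expr2 sqr_ge0. Qed.

Lemma dot_eq0 x : (dot x x == 0) = (x == 0).
Proof.
apply/eqP/eqP => [/eqP|->]; last by apply: big1 => a _; rewrite !mxE mul0r.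
rewrite psumr_eq0; last by move=> a _; rewrite -expr2 sqr_ge0.
move=> /allP x0; apply/rowP => a; rewrite mxE.
by have /= := x0 a (mem_index_enum _); rewrite mulf_eq0 orbb => /eqP.
Qed.

Lemma dot_gt0 x : x != 0 -> 0 < dot x x.
Proof. by move=> x0; rewrite lt_def dot_ge0 dot_eq0 x0. Qed.

Lemma unit_vectorE x : unit_vector x = (dot x x = 1).
Proof. by rewrite /unit_vector /dot; under eq_bigr do rewrite expr2. Qed.

Lemma dot_delta x a : dot x (delta_mx 0 a) = x 0 a.
Proof.
rewrite /dot (bigD1 a)//= mxE !eqxx mulr1 big1 ?addr0// => b ba.
by rewrite mxE eqxx (negbTE ba) mulr0.
Qed.

End Dot.

Lemma scale_halfK (R : realType) (A : lmodType R) (x : A) : 2^-1 *: (x + x) = x.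
Proof.
rewrite scalerDr -scalerDl (_ : 2^-1 + 2^-1 = 1) ?scale1r//.
by rewrite -[RHS](@mulfV _ 2) ?pnatr_eq0// mulrDl mul1r.
Qed.

(** * Clifford algebra *)

(* [J = V U / r] in the Clifford algebra, with [U ^ 2 = r] and [V = J U]. *)
Section FrameAlgebra.
Context (R : realType) (A : algType R).
Implicit Types (J U V a W : A) (r : R).

(** An endomorphism is determined by its product with a single nonzero vector; this is how
    velocities of J are identified below. *)
Lemma unit_of_sqr U r : r != 0 -> U * U = r%:A -> forall a, a * U = 0 -> a = 0.
Proof.
move=> r0 UU a aU; have : a * U * U = 0 by rewrite aU mul0r.
rewrite -mulrA UU mulr_algr => /eqP; rewrite scaler_eq0 (negbTE r0) /=.
by move/eqP.
Qed.

Section Frame.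
Context (J U V : A) (r : R).
Hypotheses (r0 : r != 0) (JJ : J * J = -1) (JU : J * U = V) (UJ : U * J = - V).
Hypothesis (UU : U * U = r%:A).

Lemma frame_JV : J * V = - U.
Proof. by rewrite -JU mulrA JJ mulN1r. Qed.

Lemma frame_VJ : V * J = U.
Proof. by rewrite -[V]opprK -UJ mulNr -mulrA JJ mulrN1 opprK. Qed.

Lemma frame_VV : V * V = r%:A.
Proof. by rewrite -{2}JU mulrA frame_VJ. Qed.

Lemma frame_VU : V * U = r *: J.
Proof. by rewrite -JU -mulrA UU mulr_algr. Qed.

Lemma frame_UV : U * V = - (r *: J).
Proof. by rewrite -JU mulrA UJ mulNr frame_VU. Qed.

(* The velocity [(U', V')] of a frame determines that of [J] by
   differentiating [J U = V]. *)
Lemma frame_tangent_imul U' V' a b :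
  a * U + J * U' = V' -> b * U - J * V' = U' -> b = J * a.
Proof.
move=> aU bU; apply/eqP; rewrite -subr_eq0; apply/eqP.
apply: (unit_of_sqr r0 UU); rewrite mulrBl.
have -> : b * U = U' + J * V' by rewrite -bU subrK.
rewrite -mulrA -(addrK (J * U') (a * U)) aU mulrBr (mulrA J J) JJ mulN1r opprK.
by rewrite (addrC U') subrr.
Qed.

(** For b = J a / 2 one has [b, J] = a, and [U'], [V'] are [b, U] and [b, V], written without b. As
    ad b is a derivation, differentiating J U = V gives the first identity. The other four say that
    [U'] and [V'] are orthogonal to both U and V: this is the lift of [a] to frames that does not
    turn the frame inside its own plane. *)
Lemma frame_tangent_lift a : J * a = - (a * J) ->
  let U' := - (2^-1 *: (a * V - V * a)) in
  let V' := 2^-1 *: (a * U - U * a) in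
  [/\ a * U + J * U' = V', U' * U + U * U' = 0, V' * V + V * V' = 0,
      V' * U + U * V' = 0 & U' * V + V * U' = 0].
Proof.
move=> Ja U' V'.
have UaV : U * a * V = V * a * U.
  have -> : U * a * V = U * (a * J) * U by rewrite -JU !mulrA.
  have -> : a * J = - (J * a) by rewrite Ja opprK.
  by rewrite mulrN mulrA UJ !mulNr opprK.
split.
- rewrite /U' /V' mulrN -scalerAr.
  have -> : J * (a * V - V * a) = a * U + U * a.
    rewrite mulrBr mulrA Ja mulNr -(mulrA a) frame_JV mulrA frame_JV.
    by rewrite mulrN mulNr !opprK.
  rewrite -{1}(scale_halfK (a * U)) -scalerBr; congr (_ *: _).
  by rewrite opprD addrA addrK.
- rewrite /U' mulNr mulrN -opprD -scalerAl -scalerAr -scalerDr.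
  rewrite mulrBl mulrBr !mulrA UaV -(mulrA a) frame_VU frame_UV.
  by rewrite addrA subrK mulNr opprK -scalerAr -scalerAl -scalerDr Ja subrr
             !scaler0 oppr0.
- rewrite /V' -scalerAl -scalerAr -scalerDr.
  rewrite mulrBl mulrBr !mulrA -(mulrA a) frame_VU frame_UV UaV.
  rewrite addrA subrK mulrN -scalerAr -scalerAl Ja.
  by rewrite scalerN opprK addNr scaler0.
- rewrite /V' -scalerAl -scalerAr -scalerDr mulrBl mulrBr !mulrA -(mulrA a) UU.
  by rewrite addrA subrK mulr_algr mulr_algl subrr scaler0.
- rewrite /U' mulNr mulrN -opprD -scalerAl -scalerAr -scalerDr mulrBl mulrBr.
  rewrite !mulrA -(mulrA a) frame_VV.
  by rewrite addrA subrK mulr_algr mulr_algl subrr scaler0 oppr0.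
Qed.

End Frame.
End FrameAlgebra.

Section Clifford.
Context (R : realType) (I : 'I_9 -> 'M[R]_16).
Hypothesis I_sym : forall a, (I a)^T = I a.
Hypothesis I_sqr : forall a, I a * I a = 1.
Hypothesis I_anti : forall a b, a != b -> I a * I b = - (I b * I a).
Local Notation M := 'M[R]_16.
Local Notation V9 := 'rV[R]_9.
Local Notation cl := (clif I).
Local Notation e a := (delta_mx 0 a : V9).
Implicit Types (x y z u v w n : V9) (k : R) (J a b : M).

Lemma clifD x y : cl (x + y) = cl x + cl y.
Proof. by rewrite -big_split; apply: eq_bigr => a _; rewrite !mxE scalerDl. Qed.

Lemma clifZ k x : cl (k *: x) = k *: cl x.
Proof. by rewrite scaler_sumr; apply: eq_bigr => a _; rewrite !mxE scalerA. Qed.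

Lemma clifN x : cl (- x) = - cl x.
Proof. by rewrite -scaleN1r clifZ scaleN1r. Qed.

Lemma clifB x y : cl (x - y) = cl x - cl y.
Proof. by rewrite clifD clifN. Qed.

Lemma clif0 : cl 0 = 0.
Proof. by rewrite -(scale0r 0) clifZ scale0r. Qed.

Lemma clif_delta i : cl (e i) = I i.
Proof.
rewrite /clif (bigD1 i)//= mxE !eqxx scale1r big1 ?addr0// => j ji.
by rewrite mxE eqxx (negbTE ji) scale0r.
Qed.

Lemma tr_clif x : (cl x)^T = cl x.
Proof.
rewrite /clif raddf_sum; apply: eq_bigr => i _; apply/matrixP => k l.
by rewrite !mxE -[in LHS]I_sym mxE.
Qed.

Lemma clifC x y : cl x * cl y + cl y * cl x = (2 * dot x y)%:A.
Proof.
have E u v : cl u * cl v = \sum_a \sum_b (u 0 a * v 0 b) *: (I a * I b).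
  rewrite /clif mulr_suml; apply: eq_bigr => a _; rewrite mulr_sumr.
  by apply: eq_bigr => b _; rewrite -scalerAl -scalerAr scalerA.
rewrite !E [X in _ + X]exchange_big /= -big_split /= /dot mulr_sumr scaler_suml.
apply: eq_bigr => a _; rewrite -big_split /= (bigD1 a)//= I_sqr big1 ?addr0.
  by rewrite (mulrC (y 0 a)) -scalerDl mulr_natl mulr2n.
by move=> b ba; rewrite (I_anti ba) scalerN (mulrC (y 0 b)) subrr.
Qed.

Lemma clif_sqr x : cl x * cl x = (dot x x)%:A.
Proof.
have := clifC x x; rewrite -mulr2n -scaler_nat -scalerA => /scalerI; apply.
by rewrite pnatr_eq0.
Qed.

Lemma alg_inj k l : k%:A = l%:A :> M -> k = l.
Proof. by move=> /matrixP/(_ 0 0); rewrite !mxE eqxx !mulr1. Qed.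

Lemma clif_inj : injective cl.
Proof.
move=> x y xy; apply/eqP; rewrite -subr_eq0 -dot_eq0; apply/eqP/alg_inj.
by rewrite -clif_sqr clifB xy subrr mul0r scale0r.
Qed.

Lemma dot_of_clif x y k : cl x * cl y + cl y * cl x = k%:A -> dot x y = k / 2.
Proof.
by rewrite clifC => /alg_inj <-; rewrite mulrAC mulfV ?mul1r// pnatr_eq0.
Qed.

Lemma dot_of_sqr x k : cl x * cl x = k%:A -> dot x x = k.
Proof. by rewrite clif_sqr => /alg_inj. Qed.

Lemma clif_orthC x y : dot x y = 0 -> cl x * cl y = - (cl y * cl x).
Proof. by move=> xy; apply/eqP; rewrite -addr_eq0 clifC xy mulr0 scale0r. Qed.

(* The coordinates of a Clifford vector, by orthogonality for the trace form. *)
Definition unclif (m : M) : V9 := \row_b (\tr (m * I b) / 16%:R).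

Lemma clifK : cancel cl unclif.
Proof.
move=> x; apply/rowP => b; rewrite mxE.
have trI (a : 'I_9) : \tr (I a * I b) = if a == b then 16%:R else 0.
  case: eqVneq => [->|ab]; first by rewrite I_sqr mxtrace1.
  have : \tr (I a * I b) = - \tr (I a * I b).
    by rewrite {1}I_anti// raddfN [in RHS]mxtrace_mulC.
  by move=> /eqP; rewrite -addr_eq0 -mulr2n mulrn_eq0 => /eqP.
have -> : cl x * I b = \sum_i x 0 i *: I i * I b by rewrite mulr_suml.
rewrite (big_morph _ (@mxtraceD _ _) (mxtrace0 _ _)) (bigD1 b)//= -scalerAl mxtraceZ trI eqxx.
rewrite big1 ?addr0 ?mulfK ?pnatr_eq0// => a ab.
by rewrite -scalerAl mxtraceZ trI (negbTE ab) mulr0.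
Qed.

Lemma Lin2_0 : Lin2 I 0.
Proof.
exists (fun _ _ => 0); apply/esym/big1 => i _; apply: big1 => j _.
by rewrite scale0r.
Qed.

Lemma Lin2_D a b : Lin2 I a -> Lin2 I b -> Lin2 I (a + b).
Proof.
move=> [x ->] [y ->]; exists (fun i j => x i j + y i j).
rewrite -big_split; apply: eq_bigr => i _; rewrite -big_split.
by apply: eq_bigr => j _; rewrite scalerDl.
Qed.

Lemma Lin2_Z k a : Lin2 I a -> Lin2 I (k *: a).
Proof.
move=> [x ->]; exists (fun i j => k * x i j).
rewrite scaler_sumr; apply: eq_bigr => i _; rewrite scaler_sumr.
by apply: eq_bigr => j _; rewrite scalerA.
Qed.

Lemma Lin2_N a : Lin2 I a -> Lin2 I (- a).
Proof. by rewrite -scaleN1r; apply: Lin2_Z. Qed.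

Lemma Lin2_sum (T : finType) (F : T -> M) :
  (forall t, Lin2 I (F t)) -> Lin2 I (\sum_t F t).
Proof. by move=> LF; elim/big_ind: _ => //; [exact: Lin2_0|exact: Lin2_D]. Qed.

(** Stated for arbitrary orthogonal vectors rather than for pairs of basis vectors, so that the
    generating case can be treated by coordinate-free identities such as [clif_orthC]. *)
Lemma Lin2_ind (P : M -> Prop) :
  P 0 -> (forall a b, P a -> P b -> P (a + b)) ->
  (forall k a, P a -> P (k *: a)) ->
  (forall x y, dot x y = 0 -> P (cl x * cl y)) -> forall a, Lin2 I a -> P a.
Proof.
move=> P0 PD PZ Pe a [x ->]; elim/big_ind: _ => // i _.
elim/big_ind: _ => // j ij; apply: PZ; rewrite -!clif_delta; apply: Pe.
by rewrite dot_delta mxE eqxx; case: eqP ij => // ->; rewrite ltnn.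
Qed.

Lemma Lin2_gen i j : i != j -> Lin2 I (I i * I j).
Proof.
suff H (k l : 'I_9) : (k < l)%N -> Lin2 I (I k * I l).
  move=> ij; case: (ltngtP i j) => [|ji|/val_inj/eqP]; first exact: H.
    by rewrite I_anti//; apply: Lin2_N; apply: H.
  by rewrite (negbTE ij).
move=> kl; exists (fun a b : 'I_9 => ((a == k) && (b == l))%:R).
rewrite (bigD1 k)//= (bigD1 l)//= !eqxx scale1r big1 ?addr0.
  rewrite big1 ?addr0// => a ak; apply: big1 => b _.
  by rewrite (negbTE ak) scale0r.
by move=> b /andP[_ bl]; rewrite (negbTE bl) andbF scale0r.
Qed.

(** In the double expansion the diagonal terms cancel, which removes the scalar part; what remains
    are products of distinct generators. *)
Lemma Lin2_comm x y : Lin2 I (cl x * cl y - cl y * cl x).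
Proof.
have E u v : cl u * cl v = \sum_a \sum_b (u 0 a * v 0 b) *: (I a * I b).
  rewrite /clif mulr_suml; apply: eq_bigr => a _; rewrite mulr_sumr.
  by apply: eq_bigr => b _; rewrite -scalerAl -scalerAr scalerA.
rewrite !E [X in _ - X]exchange_big /= -sumrB; apply: Lin2_sum => i.
rewrite -sumrB; apply: Lin2_sum => j; rewrite (mulrC (y 0 j)) -scalerBr.
apply: Lin2_Z; have [->|ij] := eqVneq i j; first by rewrite subrr; apply: Lin2_0.
by apply: Lin2_D; [|apply: Lin2_N]; apply: Lin2_gen => //; rewrite eq_sym.
Qed.

Lemma Lin2_orth x y : dot x y = 0 -> Lin2 I (cl x * cl y).
Proof.
move=> xy; have -> : cl x * cl y = 2^-1 *: (cl x * cl y - cl y * cl x).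
  by rewrite (clif_orthC (x := y)) 1?dotC// opprK scale_halfK.
exact/Lin2_Z/Lin2_comm.
Qed.

(** A product of two vectors acts by commutator as an infinitesimal rotation of R^9: moving [cl w]
    across each factor with [clifC] leaves only the two contraction terms. *)
Lemma comm_clif2 x y w : cl x * cl y * cl w - cl w * (cl x * cl y) =
  cl ((2 * dot y w) *: x - (2 * dot x w) *: y).
Proof.
have -> : cl x * cl y * cl w = (2 * dot y w) *: cl x - cl x * cl w * cl y.
  have -> : (2 * dot y w) *: cl x = cl x * (cl y * cl w + cl w * cl y).
    by rewrite clifC mulr_algr.
  by rewrite mulrDr !mulrA addrK.
have -> : cl w * (cl x * cl y) = (2 * dot x w) *: cl y - cl x * cl w * cl y.
  have -> : (2 * dot x w) *: cl y = (cl x * cl w + cl w * cl x) * cl y.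
    by rewrite clifC mulr_algl.
  by rewrite mulrDl mulrA addrAC subrr add0r.
by rewrite clifB !clifZ opprB addrA subrK.
Qed.

Lemma comm_Lin2 a : Lin2 I a -> forall w, exists x, a * cl w - cl w * a = cl x.
Proof.
move: a; apply: Lin2_ind.
- by move=> w; exists 0; rewrite mul0r mulr0 subr0 clif0.
- move=> a b Ha Hb w; have [x xE] := Ha w; have [y yE] := Hb w.
  exists (x + y); rewrite clifD -xE -yE mulrDl mulrDr opprD.
  by rewrite -!addrA; congr (_ + _); rewrite !addrA; congr (_ + _); rewrite addrC.
- move=> k a Ha w; have [x xE] := Ha w; exists (k *: x).
  by rewrite clifZ -xE -scalerAl -scalerAr scalerBr.
- by move=> x y _ w; rewrite comm_clif2; eexists.
Qed.

Lemma tr_Lin2 a : Lin2 I a -> a^T = - a.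
Proof.
move: a; apply: Lin2_ind.
- by rewrite linear0 oppr0.
- by move=> a b Ha Hb; rewrite linearD /= Ha Hb opprD.
- by move=> k a Ha; rewrite linearZ /= Ha scalerN.
- move=> x y xy; rewrite [cl x * cl y]clif_orthC// opprK.
  by rewrite linearN /= trmx_mul !tr_clif -[_ *m _]/(cl x * cl y) (clif_orthC xy) opprK.
Qed.

(** Each summand is 2 x_i [I i] - x; over the nine indices this adds up to 2x - 9x. *)
Lemma sum_conj_clif x : \sum_i I i * cl x * I i = - (7%:R *: cl x).
Proof.
have E i : I i * cl x * I i = (2 * x 0 i) *: I i - cl x.
  have := clifC x (e i); rewrite clif_delta dot_delta => H.
  rewrite -(addKr (cl x * I i) (I i * cl x)) H mulrDl mulNr -mulrA I_sqr mulr1.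
  by rewrite mulr_algl addrC.
rewrite (eq_bigr _ (fun i _ => E i)) sumrB sumr_const card_ord.
have -> : \sum_i (2 * x 0 i) *: I i = 2%:R *: cl x.
  by rewrite /clif scaler_sumr; apply: eq_bigr => i _; rewrite scalerA.
rewrite -(scaler_nat 9) -scalerBl -scaleNr; congr (_ *: _); lra.
Qed.

(* The sum is [9 a] if [a] commutes with the [I i], so no nonzero [a] of degree 2
   commutes with all of them. *)
Lemma sum_conj_Lin2 a : Lin2 I a -> \sum_i I i * a * I i = 5%:R *: a.
Proof.
move: a; apply: Lin2_ind.
- by rewrite scaler0; apply: big1 => i _; rewrite mulr0 mul0r.
- move=> a b Ha Hb; rewrite scalerDr -Ha -Hb -big_split; apply: eq_bigr => i _.
  by rewrite mulrDr mulrDl.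
- move=> k a Ha; rewrite scalerA mulrC -scalerA -Ha scaler_sumr.
  by apply: eq_bigr => i _; rewrite -scalerAr -scalerAl.
- move=> x y xy.
  have E i : I i * (cl x * cl y) * I i =
      2%:R *: (y 0 i *: (I i * cl x)) - I i * cl x * I i * cl y.
    have := clifC y (e i); rewrite clif_delta dot_delta => H.
    rewrite -!mulrA -(addrK (I i * cl y) (cl y * I i)) H !mulrBr mulr_algr.
    by rewrite -!scalerAr !scalerA.
  rewrite (eq_bigr _ (fun i _ => E i)) sumrB -mulr_suml sum_conj_clif.
  rewrite mulNr opprK -scaler_sumr.
  have -> : \sum_i y 0 i *: (I i * cl x) = cl y * cl x.
    by rewrite /clif mulr_suml; apply: eq_bigr => i _; rewrite -scalerAl.
  (* Reordering turns 2 y x into -2 x y, and [sum_conj_clif] has contributed 7 x y: hence the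
     constant 5. *)
  rewrite (clif_orthC (x := y)) 1?dotC// -scalerAl scalerN -scaleNr -scalerDl.
  by congr (_ *: _); lra.
Qed.

Lemma Lin2_neq0_comm a : Lin2 I a -> a != 0 -> exists i, a * I i - I i * a != 0.
Proof.
move=> La; apply: contra_neqP => /forallNP comm0.
have comm i : I i * a * I i = a.
  have /negP/negPn/eqP/subr0_eq H := comm0 i.
  by rewrite -H -mulrA I_sqr mulr1.
have := sum_conj_Lin2 La; rewrite (eq_bigr _ (fun i _ => comm i)) sumr_const.
rewrite card_ord -scaler_nat => /eqP; rewrite -subr_eq0 -scalerBl scaler_eq0.
by case/orP => /eqP // h; exfalso; move: h; lra.
Qed.

Lemma T1_neq0 J : T1 I J -> J != 0.
Proof.
move=> [_ JJ]; apply/eqP => J0; move: JJ; rewrite J0 mul0r => /esym/eqP.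
by rewrite oppr_eq0 oner_eq0.
Qed.

(* Oriented orthogonal frames [(u, v)], [|u| = |v|], of the plane of [J]. *)
Definition frame J u v := J * cl u = cl v.

Section FrameT1.
Context (J : M) (T1J : T1 I J).

Lemma T1_Lin2 : Lin2 I J. Proof. by case: T1J. Qed.
Lemma T1_sqr : J * J = -1. Proof. by case: T1J. Qed.

(** Transpose of the frame relation: vectors are symmetric matrices, while J, being of degree 2, is
    skew. *)
Lemma frame_mulr u v : frame J u v -> cl u * J = - cl v.
Proof.
move=> /(congr1 trmx); rewrite trmx_mul !tr_clif tr_Lin2 ?mulmxN; last exact: T1_Lin2.
by move/(canRL opprK).
Qed.

(** In terms of z = u + i v this is multiplication by -i. *)
Lemma frame_rot u v : frame J u v -> frame J v (- u).
Proof. by rewrite /frame clifN => <-; rewrite mulrA T1_sqr mulN1r. Qed.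

Lemma frame_norm u v : frame J u v -> dot v v = dot u u.
Proof.
move=> F; apply: dot_of_sqr; rewrite -clif_sqr -{2}F mulrA.
by rewrite (frame_VJ T1_sqr (frame_mulr F)).
Qed.

Lemma frame_orth u v : frame J u v -> dot u v = 0.
Proof.
move=> F; rewrite (@dot_of_clif _ _ 0) ?mul0r// scale0r.
have -> : cl u * cl v = - (cl v * cl u) by rewrite -{1}F mulrA (frame_mulr F) mulNr.
by rewrite addNr.
Qed.

Lemma frame_lin u v u' v' : frame J u v -> frame J u' v' ->
  frame J (u + u') (v + v').
Proof. by rewrite /frame !clifD mulrDr => -> ->. Qed.

Lemma frame_scale k u v : frame J u v -> frame J (k *: u) (k *: v).
Proof. by rewrite /frame !clifZ -scalerAr => ->. Qed.

Lemma frame_T1E u v : frame J u v -> cl v * cl u = dot u u *: J.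
Proof. by move=> F; rewrite -F -mulrA clif_sqr mulr_algr. Qed.

(** Because J squares to -1, the commutator u = [J, x] anticommutes with J. Hence J u = [J, u / 2] +
    u J / 2 + J u / 2 reduces to a commutator of J with a vector, which [comm_Lin2] shows to be a
    vector. *)
Lemma comm_frame x : exists u v, J * cl x - cl x * J = cl u /\ frame J u v.
Proof.
have [u uE] := comm_Lin2 T1_Lin2 x; have [v vE] := comm_Lin2 T1_Lin2 (2^-1 *: u).
exists u, v; split=> //.
have uJ : cl u * J = - (J * cl u).
  rewrite -uE mulrBl mulrBr !mulrA T1_sqr -(mulrA _ J J) T1_sqr mulN1r mulrN1.
  by rewrite opprB !opprK addrC.
by rewrite /frame -vE clifZ -scalerAr -scalerAl -scalerBr uJ opprK scale_halfK.
Qed.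

Lemma frame_exists : exists i u v,
  [/\ J * I i - I i * J = cl u, frame J u v & u != 0].
Proof.
have [i Ji] := Lin2_neq0_comm T1_Lin2 (T1_neq0 T1J).
have [u [v [uE F]]] := comm_frame (e i); rewrite clif_delta in uE.
exists i, u, v; split => //.
by apply: contraNneq Ji => u0; rewrite uE u0 clif0.
Qed.

(** If (w, w') is a frame of J, then w' = J w = [J, w] / 2, and J is a multiple of v u; so
    [comm_clif2] places w' in the plane of u and v. Applied to (u', v') and to its quarter turn,
    this expresses both vectors, and comparing dot products shows that the two pairs of coefficients
    form one complex number p + i q. *)
Lemma frame_unique u v u' v' : u != 0 -> frame J u v -> frame J u' v' ->
  exists p q, u' = p *: u - q *: v /\ v' = q *: u + p *: v.
Proof.
move=> u0 F F'; have r0 : dot u u != 0 by rewrite dot_eq0.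
have E w w' : frame J w w' ->
    w' = (dot u w / dot u u) *: v - (dot v w / dot u u) *: u.
  move=> Fw; apply: clif_inj.
  have := comm_clif2 v u w.
  rewrite (frame_T1E F) -scalerAl -scalerAr -scalerBr Fw (frame_mulr Fw) opprK.
  rewrite -mulr2n -scaler_nat scalerA => H.
  have k0 : dot u u * 2%:R != 0 by rewrite mulf_neq0// pnatr_eq0.
  apply: (scalerI k0); rewrite H !clifB !clifZ scalerBr !scalerA.
  by congr (_ *: _ - _ *: _); field.
have H1 := E _ _ F'; have H2 := E _ _ (frame_rot F').
have uv := frame_orth F; have vv := frame_norm F.
have D1 : dot u v' = - dot v u'.
  by rewrite {1}H1 dotDr dotNr !dotZr uv mulr0 add0r divfK.
have D2 : dot v v' = dot u u'.
  by rewrite {1}H1 dotDr dotNr !dotZr vv (dotC v u) uv mulr0 subr0 divfK.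
exists (dot u u' / dot u u), (dot u v' / dot u u); split.
  by rewrite -[LHS]opprK H2 opprB D2.
by rewrite {1}H1 D1 mulNr scaleNr addrC.
Qed.

End FrameT1.

Lemma frame_T1 u v : u != 0 -> dot v v = dot u u -> dot u v = 0 ->
  let J := (dot u u)^-1 *: (cl v * cl u) in T1 I J /\ frame J u v.
Proof.
move=> u0 vv uv J; have r0 : dot u u != 0 by rewrite dot_eq0.
have F : frame J u v.
  by rewrite /frame -scalerAl -mulrA clif_sqr mulr_algr scalerA mulVf ?scale1r.
split=> //; split; first by apply/Lin2_Z/Lin2_orth; rewrite dotC.
rewrite {2}/J -scalerAr mulrA {1}/J -scalerAl -mulrA (clif_orthC uv) mulrN.
rewrite mulrA clif_sqr vv mulr_algl -scalerAl mulNr -scalerAl clif_sqr.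
rewrite !scalerN !scalerA; congr (- _); rewrite -[RHS]scale1r.
by congr (_ *: _); field.
Qed.

(** With J squared equal to -1, the double commutator is -2a - 2 J a J, so it equals -4a exactly
    when J a J = a, that is, when [a] anticommutes with J. *)
Lemma lie_tangent J a : T1 I J -> tangentT1 I J a <-> Lin2 I a /\ J * a = - (a * J).
Proof.
move=> T1J; have JJ := T1_sqr T1J.
have E : lie J (lie J a) = - (2%:R *: a) - 2%:R *: (J * a * J).
  rewrite /lie mulrBr mulrBl !mulrA JJ -(mulrA a) JJ mulN1r mulrN1 opprB.
  rewrite -!mulrA !scaler_nat !mulr2n !opprD -!addrA; congr (_ + _).
  by rewrite addrC -!addrA addrC -!addrA.
split=> -[La Ja]; split=> //.
  have H : J * a * J = a.
    have h : (2 : R) != 0 by rewrite pnatr_eq0.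
    apply: (scalerI h); apply: (addrI (2%:R *: a)); apply: oppr_inj.
    by rewrite [LHS]opprD -E Ja -scalerDl; congr (- (_ *: _)); lra.
  by rewrite -{2}H -!mulrA JJ mulrN1 mulrN opprK.
rewrite E Ja mulNr -mulrA JJ mulrN1 opprK -opprD -scalerDl.
by congr (- (_ *: _)); lra.
Qed.

End Clifford.

(** * Differentials and topology *)

Section Differentials.
Context (K : numFieldType).

(** The little-o of the definition is tied to the base field, whereas explicit estimates can be
    carried between R and C. This form and its converse [is_diff_epsP] are used for that passage. *)
Lemma is_diff_eps (V W : normedModType K) (f : V -> W) (L : {linear V -> W}) x :
  continuous L ->
  (forall e : K, 0 < e ->
     \forall h \near (0 : V), `|f (h + x) - f x - L h| <= e * `|h|) ->
  is_diff x f L.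
Proof.
move=> cL H.
have E : f \o shift x = cst (f x) + L +o_ 0 id.
  apply/eqaddoP => e e0; apply: filterS (H e e0) => h.
  by rewrite !fctE /= opprD addrA.
have D := diff_unique cL E.
by apply: DiffDef => //; apply/diff_locallyP; rewrite D.
Qed.

Lemma is_diff_epsP (V W : normedModType K) (f df : V -> W) x :
  is_diff x f df ->
  forall e : K, 0 < e ->
     \forall h \near (0 : V), `|f (h + x) - f x - df h| <= e * `|h|.
Proof.
case=> Df <- e e0; have [_ /eqaddoP/(_ e e0)] := (diff_locallyP _ _).1 Df.
by apply: filterS => h; rewrite !fctE /= opprD addrA.
Qed.

Context (V : normedModType K).

Lemma is_diff_fsum (W : normedModType K) (T : finType) (F dF : T -> V -> W) x :
  (forall t, is_diff x (F t) (dF t)) ->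
  is_diff x (fun v => \sum_t F t v) (fun v => \sum_t dF t v).
Proof.
move=> DF; elim: (index_enum T) => [|t r IH].
  rewrite (_ : (fun v => _) = cst 0); last by apply/funext => v; rewrite big_nil.
  rewrite (_ : (fun v => _) = 0); last by apply/funext => v; rewrite big_nil.
  exact: is_diff_cst.
rewrite (_ : (fun v => _) = F t + (fun v => \sum_(i <- r) F i v)); last first.
  by apply/funext => v; rewrite big_cons.
rewrite (_ : (fun v => \sum_(i <- _) dF i v) =
             dF t + (fun v => \sum_(i <- r) dF i v)); last first.
  by apply/funext => v; rewrite big_cons.
exact: is_diffD.
Qed.

Lemma is_diff_scalel_cst (W : normedModType K) (k dk : V -> K) (w : W) x :
  is_diff x k dk -> is_diff x (fun v => k v *: w) (fun v => dk v *: w).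
Proof.
case=> Dk <-; apply: DiffDef; first exact: differentiableZl.
by rewrite diffZl.
Qed.

Lemma is_diff_mx m n (f df : V -> 'M[K]_(m, n)) x :
  (forall i j, is_diff x (fun v => f v i j) (fun v => df v i j)) ->
  is_diff x f df.
Proof.
move=> Df.
have E (g : V -> 'M[K]_(m, n)) : g =
    (fun v => \sum_i \sum_j g v i j *: (delta_mx i j : 'M[K]_(m, n))).
  by apply/funext => v; rewrite -matrix_sum_delta.
rewrite (E f) (E df).
by apply: is_diff_fsum => i; apply: is_diff_fsum => j; apply: is_diff_scalel_cst.
Qed.

Lemma is_diff_entry m n (f df : V -> 'M[K]_(m, n)) x i j :
  is_diff x f df -> is_diff x (fun v => f v i j) (fun v => df v i j).
Proof.
pose c (M : 'M[K]_(m, n)) : K := M i j.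
have lc : linear c by move=> k A B; rewrite /c !mxE.
pose cM := GRing.isLinear.Build _ _ _ _ _ lc.
pose cL : {linear 'M[K]_(m, n) -> K} := HB.pack c cM.
have cc : continuous cL by exact: coord_continuous.
move=> Df; have Dc y : is_diff y cL cL.
  by apply: DiffDef; [apply: linear_differentiable|rewrite diff_lin].
exact: (@is_diff_comp _ _ _ _ f df cL cL x Df (Dc _)).
Qed.

Lemma is_diff_mulf (f g df dg : V -> K) x : is_diff x f df -> is_diff x g dg ->
  is_diff x (fun v => f v * g v) (fun v => df v * g x + f x * dg v).
Proof.
move=> Df Dg; have := @is_diffM _ _ _ _ _ _ _ Df Dg.
rewrite (_ : f x *: dg + g x *: df = fun v => df v * g x + f x * dg v)//.
by apply/funext => v; rewrite !fctE addrC [g x *: _]mulrC.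
Qed.

Lemma is_diff_mulmx m n p (f df : V -> 'M[K]_(m, n)) (g dg : V -> 'M[K]_(n, p)) x :
  is_diff x f df -> is_diff x g dg ->
  is_diff x (fun v => f v *m g v) (fun v => df v *m g x + f x *m dg v).
Proof.
move=> Df Dg; apply: is_diff_mx => i j.
rewrite (_ : (fun v => (f v *m g v) i j) = fun v => \sum_k f v i k * g v k j);
  last by apply/funext => v; rewrite mxE.
rewrite (_ : (fun v => (df v *m g x + f x *m dg v) i j) =
    fun v => \sum_k (df v i k * g x k j + f x i k * dg v k j)); last first.
  by apply/funext => v; rewrite !mxE big_split.
apply: is_diff_fsum => k; apply: is_diff_mulf.
  exact: is_diff_entry Df.
exact: is_diff_entry Dg.
Qed.

Lemma is_diff_scale m n (k dk : V -> K) (f df : V -> 'M[K]_(m, n)) x :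
  is_diff x k dk -> is_diff x f df ->
  is_diff x (fun v => k v *: f v) (fun v => dk v *: f x + k x *: df v).
Proof.
move=> Dk Df; apply: is_diff_mx => i j.
rewrite (_ : (fun v => (k v *: f v) i j) = fun v => k v * f v i j); last first.
  by apply/funext => v; rewrite mxE.
rewrite (_ : (fun v => (dk v *: f x + k x *: df v) i j) =
    fun v => dk v * f x i j + k x * df v i j); last first.
  by apply/funext => v; rewrite !mxE.
by apply: is_diff_mulf => //; exact: is_diff_entry Df.
Qed.

Lemma is_diff_inv (k dk : V -> K) x : is_diff x k dk -> k x != 0 ->
  is_diff x (fun v => (k v)^-1) (fun v => - (k x) ^- 2 * dk v).
Proof.
case=> Dk <- k0; apply: DiffDef; first exact: differentiableV.
by rewrite diffV.
Qed.

Lemma differentiable_mx m n (f : V -> 'M[K]_(m, n)) x :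
  (forall i j, differentiable (fun v => f v i j) x) -> differentiable f x.
Proof.
move=> Df; pose df v : 'M[K]_(m, n) := \matrix_(i, j) 'd (fun v => f v i j) x v.
suff : is_diff x f df by case.
apply: is_diff_mx => i j.
rewrite (_ : (fun v => df v i j) = 'd (fun v => f v i j) x).
  exact: differentiableP.
by apply/funext => v; rewrite mxE.
Qed.

Lemma differentiable_fsum (W : normedModType K) (T : finType) (F : T -> V -> W) x :
  (forall t, differentiable (F t) x) -> differentiable (fun v => \sum_t F t v) x.
Proof.
move=> DF; suff : is_diff x (fun v => \sum_t F t v) (fun v => \sum_t 'd (F t) x v).
  by case.
by apply: is_diff_fsum => t; apply: differentiableP.
Qed.

Lemma differentiable_near (W : normedModType K) (f g : V -> W) x :
  (\near x, f x = g x) -> differentiable f x -> differentiable g x.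
Proof.
move=> fg Df; have fgx : f x = g x by exact: nbhs_singleton fg.
suff : is_diff x g ('d f x) by case.
apply: is_diff_eps; first exact: diff_continuous.
move=> e e0; have := is_diff_epsP (differentiableP Df) e0.
have : \forall h \near (0 : V), f (h + x) = g (h + x).
  by rewrite (near_shift x); apply: filterS fg => y; rewrite /= sub0r subrK.
by apply: filterS2 => h <-; rewrite fgx.
Qed.

End Differentials.

Lemma linear_mx_continuous (K : numFieldType) m n (W : normedModType K)
    (L : {linear 'M[K]_(m, n) -> W}) :
  continuous L.
Proof.
have E : (L : 'M[K]_(m, n) -> W) =
    fun M => \sum_i \sum_j M i j *: L (delta_mx i j).
  apply/funext => M; rewrite {1}(matrix_sum_delta M) linear_sum.
  apply: eq_bigr => i _; rewrite linear_sum; apply: eq_bigr => j _.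
  by rewrite linearZ.
move=> x; apply: differentiable_continuous; rewrite E.
apply: differentiable_fsum => i; apply: differentiable_fsum => j.
by apply: differentiableZl; exact: differentiable_coord.
Qed.

Section Topology.

Lemma open_set_val (X : topologicalType) (S : set X) (U : set X) :
  open U -> open (set_val @^-1` U : set S).
Proof.
by move=> oU; have /continuousP := @initial_continuous S X set_val; apply.
Qed.

Lemma open_set_valP (X : topologicalType) (S : set X) (U : set S) :
  open U -> exists2 W, open W & set_val @^-1` W = U.
Proof. by case=> W oW <-; exists W. Qed.

Lemma set_val_continuous (X : topologicalType) (S : set X) :
  continuous (set_val : S -> X).
Proof. exact: initial_continuous. Qed.

Lemma continuous_at_set_val (X Y : topologicalType) (S : set X) (f : Y -> S) y :
  {for y, continuous (set_val \o f)} -> {for y, continuous f}.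
Proof.
move=> cf U [/= _ [[W oW <-]]] /= Wy /filterS; apply.
by apply: cf; exact: open_nbhs_nbhs.
Qed.

Lemma hausdorff_inj (X Y : topologicalType) (f : X -> Y) :
  continuous f -> injective f -> hausdorff_space Y -> hausdorff_space X.
Proof.
move=> cf fI hY p q clpq; apply: fI; apply: hY => A B nA nB.
by have [x []] := clpq _ _ (cf _ _ nA) (cf _ _ nB); exists (f x).
Qed.

Lemma second_countable_homeo (X Y : topologicalType) (f : X -> Y) (g : Y -> X) :
  continuous f -> continuous g -> cancel g f ->
  @second_countable X -> @second_countable Y.
Proof.
move=> cf cg gK [B cB [oB bB]].
exists ((fun U => g @^-1` U) @` B); first exact: (card_le_trans (card_image_le _ _) cB).
split=> [_ [U BU <-]|y U nU].
  by have /continuousP := cg; apply; exact: oB.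
have nfU : nbhs (g y) (f @^-1` U) by apply: cf; rewrite gK.
have [W [BW Wy] WU] := bB _ _ nfU.
exists (g @^-1` W); first by split=> //; exists W.
by move=> z /= Wz; have := WU _ Wz; rewrite /= gK.
Qed.

Lemma second_countable_set (X : topologicalType) (S : set X) :
  @second_countable X -> @second_countable S.
Proof.
move=> [B cB [oB bB]].
exists ((fun U => set_val @^-1` U) @` B); first exact: (card_le_trans (card_image_le _ _) cB).
split=> [_ [U BU <-]|y U].
  by apply: open_set_val; exact: oB.
case=> _ [[W oW <-] /= Wy WU].
have [Z [BZ Zy] ZW] := bB _ _ (open_nbhs_nbhs (conj oW Wy)).
exists (set_val @^-1` Z); first by split=> //; exists Z.
by move=> z /= Zz; apply: WU; exact: ZW.
Qed.

(** The base consists of balls of radius 1/(k+1) around rational matrices: with 1/(k+1) below e/2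
    and a centre closer than 1/(k+1) to [M], such a ball contains [M] and stays within distance e of
    it. *)
Lemma second_countable_mx (R : realType) m n : @second_countable 'M[R]_(m, n).
Proof.
pose b (qk : 'M[rat]_(m, n) * nat) : set 'M[R]_(m, n) :=
  ball (map_mx ratr qk.1 : 'M[R]_(m, n)) (qk.2.+1%:R^-1).
exists (range b); first exact: (card_le_trans (card_image_le _ _) (countableP _)).
split=> [_ [qk _ <-]|M U].
  exact: ball_open.
move=> /nbhs_ballP[e /= e0 eU].
have e20 : 0 < e / 2 by rewrite divr_gt0.
have [k _ /(_ k (leqnn k)) /= ke] := near_infty_natSinv_lt (PosNum e20).
have k0 : 0 < k.+1%:R^-1 :> R by rewrite invr_gt0.
have Hq i j : exists q : rat, `|M i j - ratr q| < k.+1%:R^-1.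
  have [q] := @rat_in_itvoo R (M i j) (M i j + k.+1%:R^-1) (ltr_pwDr k0 (lexx _)).
  rewrite in_itv /= => /andP[q1 q2]; exists q.
  by rewrite distrC ger0_norm ?subr_ge0 ?ltW// ltrBlDl.
pose q : 'M[rat]_(m, n) := \matrix_(i, j) sval (cid (Hq i j)).
have qM : ball (map_mx ratr q : 'M[R]_(m, n)) k.+1%:R^-1 M.
  by split=> // i j; rewrite !mxE /ball /= distrC; exact: svalP (cid (Hq i j)).
exists (b (q, k)); first by split=> //; exists (q, k).
move=> N bN; apply: eU; rewrite (splitr e).
apply: (@ball_triangle _ _ (map_mx ratr q : 'M[R]_(m, n))).
  by apply: ball_sym; apply: le_ball qM; exact: ltW.
by apply: le_ball bN; exact: ltW.
Qed.

Lemma within_open_continuous (X Y : topologicalType) (A : set X) (f : X -> Y) :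
  (forall x, A x -> {for x, continuous f}) -> {within A, continuous f}.
Proof. by move=> H; apply: continuous_in_subspaceT => x /set_mem; exact: H. Qed.

Lemma within_open_continuousP (X Y : topologicalType) (A : set X) (f : X -> Y) x :
  open A -> {within A, continuous f} -> A x -> {for x, continuous f}.
Proof.
move=> oA cf Ax; have := continuous_open_subspace f oA.
by move=> E; rewrite E in cf; apply: cf; rewrite inE.
Qed.

Lemma near_eq_continuous (X Y : topologicalType) (f g : X -> Y) x :
  (\near x, f x = g x) -> {for x, continuous f} -> {for x, continuous g}.
Proof.
move=> fg cf U; rewrite -(nbhs_singleton fg) => nU.
by apply: filterS2 fg (cf _ nU) => t /= <-.
Qed.

End Topology.

(** * Charts and submanifolds *)

Section Charts.
Context (R : realType).
Local Notation C := (Cplx R).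

Section MaximalAtlas.
Context (X : topologicalType) (n : nat) (A : set (chart R X n)).
Hypothesis A_chart : forall c, A c -> is_chart c.
Hypothesis A_cover : forall x, exists2 c, A c & cdom c x.

Lemma chart_cinv_continuous (c : chart R X n) w : is_chart c -> cimg c w ->
  {for w, continuous (cinv c)}.
Proof. by case=> _ oi _ _ ci; exact: within_open_continuousP oi ci. Qed.

Lemma chart_cmap_continuous (c : chart R X n) x : is_chart c -> cdom c x ->
  {for x, continuous (cmap c)}.
Proof. by case=> od _ _ cm _; exact: within_open_continuousP od cm. Qed.

Lemma near_cinv (c : chart R X n) x (U : set X) : is_chart c -> cdom c x ->
  open U -> U x -> \forall w \near cmap c x, cimg c w /\ U (cinv c w).
Proof.
move=> Hc dx oU Ux; have ix : cimg c (cmap c x) by exists x.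
have [od oi K _ _] := Hc.
apply: filterI; first by apply: open_nbhs_nbhs.
apply: (chart_cinv_continuous Hc ix); rewrite K//.
exact: open_nbhs_nbhs.
Qed.

Lemma change_comp (c a d : chart R X n) x : is_chart c -> is_chart a ->
  cdom c x -> cdom a x ->
  differentiable (cmap a \o cinv c) (cmap c x) ->
  differentiable (cmap d \o cinv a) (cmap a x) ->
  differentiable (cmap d \o cinv c) (cmap c x).
Proof.
move=> Hc Ha cx ax D1 D2; have [oa _ Ka _ _] := Ha; have [_ _ Kc _ _] := Hc.
apply: (@differentiable_near _ _ _ ((cmap d \o cinv a) \o (cmap a \o cinv c))).
  have := near_cinv Hc cx oa ax; apply: filterS => w [_ aw] /=.
  by rewrite Ka.
apply: (differentiable_comp D1).
have -> : (cmap a \o cinv c) (cmap c x) = cmap a x by congr (cmap a _); exact: Kc.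
exact: D2.
Qed.

(** Near each point the change factors through a chart of [A], against which both [c] and [d] are
    holomorphic. *)
Lemma maximal_atlas_change c d : maximal_atlas A c -> maximal_atlas A d ->
  holomorphic_change c d.
Proof.
move=> [Hc ca] [Hd da] x cx dx; have [a Aa ax] := A_cover x.
have Ha := A_chart Aa.
apply: (change_comp Hc Ha cx ax); first by have [H _] := ca _ Aa; apply: H.
by have [_ H] := da _ Aa; apply: H.
Qed.

End MaximalAtlas.

Section Submanifold.
Context (X : topologicalType) (n k : nat) (A : set (chart R X (n + k))) (S : set X).
Hypothesis A_chart : forall c, A c -> is_chart c.
Hypothesis A_cover : forall x, exists2 c, A c & cdom c x.

Lemma row_mx0_continuous : continuous (fun w : 'rV[C]_n => row_mx w (0 : 'rV[C]_k)).
Proof.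
pose f (w : 'rV[C]_n) := row_mx w (0 : 'rV[C]_k).
have lf : linear f.
  by move=> a u v; rewrite /f scale_row_mx add_row_mx scaler0 addr0.
pose fM := GRing.isLinear.Build _ _ _ _ _ lf.
pose fL : {linear 'rV[C]_n -> 'rV[C]_(n + k)} := HB.pack f fM.
exact: (@linear_mx_continuous _ _ _ _ fL).
Qed.

Lemma row_mx0_differentiable w :
  differentiable (fun w : 'rV[C]_n => row_mx w (0 : 'rV[C]_k)) w.
Proof.
pose f (w : 'rV[C]_n) := row_mx w (0 : 'rV[C]_k).
have lf : linear f.
  by move=> a u v; rewrite /f scale_row_mx add_row_mx scaler0 addr0.
pose fM := GRing.isLinear.Build _ _ _ _ _ lf.
pose fL : {linear 'rV[C]_n -> 'rV[C]_(n + k)} := HB.pack f fM.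
by apply: (@linear_differentiable _ _ _ fL); exact: (@linear_mx_continuous _ _ _ _ fL).
Qed.

Section OneChart.
Context (c : chart R S n) (d : chart R X (n + k)).
Hypothesis Ad : adapted_chart A S d.
Hypothesis dom_c : cdom c = set_val @^-1` cdom d.
Hypothesis map_c : forall x, cdom c x -> cmap c x = lsubmx (cmap d (set_val x)).
Hypothesis c_K : forall x, cdom c x -> cinv c (cmap c x) = x.

Lemma adapted_is_chart : is_chart d.
Proof. by case: Ad => -[]. Qed.

Lemma adapted_row x : cdom c x -> row_mx (cmap c x) 0 = cmap d (set_val x).
Proof.
move=> cx; have dx : cdom d (set_val x) by move: cx; rewrite dom_c.
by rewrite map_c// -((Ad.2 _ dx).1 (set_valP x)) hsubmxK.
Qed.

(** [submanifold_atlas] constrains [cinv c] only by [c_K]; on the image this already forces it to be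
    [cinv d] on the slice where the last k coordinates vanish. *)
Lemma sub_cinvE w : cimg c w -> set_val (cinv c w) = cinv d (row_mx w 0).
Proof.
move=> [x cx <-]; rewrite c_K// adapted_row//.
by have [_ _ -> //] := adapted_is_chart; move: cx; rewrite dom_c.
Qed.

(** Every point of [cimg d] on the slice comes from [S], because [d] is adapted. The image of [c] is
    thus a continuous preimage of an open set. *)
Lemma sub_cimgE : cimg c = (fun w => row_mx w 0) @^-1` cimg d.
Proof.
apply/seteqP; split=> [w [x cx <-]|w [x dx Ex]].
  by exists (set_val x); [move: cx; rewrite dom_c|rewrite adapted_row].
have Sx : S x by apply/(Ad.2 _ dx); rewrite Ex row_mxKr.
have cx : cdom c (SigSub (mem_set Sx) : S) by rewrite dom_c.
exists (SigSub (mem_set Sx) : S) => //.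
by rewrite map_c//= Ex row_mxKl.
Qed.

Lemma sub_is_chart : is_chart c.
Proof.
have [od oi Kd cm ci] := adapted_is_chart.
have oc : open (cdom c) by rewrite dom_c; exact: open_set_val.
have oic : open (cimg c).
  by rewrite sub_cimgE; have /continuousP := row_mx0_continuous; apply.
split=> //.
- apply: within_open_continuous => x cx.
  have dx : cdom d (set_val x) by move: cx; rewrite dom_c.
  apply: (@near_eq_continuous _ _ (lsubmx \o (cmap d \o set_val))).
    by near=> y; rewrite map_c//; near: y; exact: open_nbhs_nbhs.
  apply: continuous_comp; last exact: continuous_lsubmx.
  apply: continuous_comp; first exact: set_val_continuous.
  exact: chart_cmap_continuous adapted_is_chart dx.
- apply: within_open_continuous => w cw; apply: continuous_at_set_val.
  apply: (@near_eq_continuous _ _ (cinv d \o (fun w => row_mx w 0))).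
    by near=> y; rewrite /= sub_cinvE//; near: y; exact: open_nbhs_nbhs.
  apply: continuous_comp; first exact: row_mx0_continuous.
  apply: chart_cinv_continuous; first exact: adapted_is_chart.
  by move: cw; rewrite sub_cimgE.
Unshelve. all: by end_near. Qed.

End OneChart.

Lemma submanifold_is_chart c : submanifold_atlas n k A S c -> is_chart c.
Proof. by move=> [d Ad [? ? ?]]; exact: (@sub_is_chart c d). Qed.

(** The change is inclusion of the slice, then the ambient change from [d] to [d'], then projection
    to the first n coordinates. *)
Lemma submanifold_change c c' : submanifold_atlas n k A S c ->
  submanifold_atlas n k A S c' -> holomorphic_change c c'.
Proof.
move=> Sc Sc' x cx c'x.
have Hc := submanifold_is_chart Sc; have Hc' := submanifold_is_chart Sc'.
have [oc' _ _ _ _] := Hc'.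
move: Sc Sc' => [d Ad [dc mc kc]] [d' Ad' [dc' mc' kc']].
have dx : cdom d (set_val x) by move: cx; rewrite dc.
have d'x : cdom d' (set_val x) by move: c'x; rewrite dc'.
apply: (@differentiable_near _ _ _
  (lsubmx \o ((cmap d' \o cinv d) \o (fun w => row_mx w 0)))).
  have := near_cinv Hc cx oc' c'x; apply: filterS => w [cw c'w] /=.
  by rewrite mc'// (sub_cinvE Ad).
apply: differentiable_comp; last exact: differentiable_lsubmx.
apply: differentiable_comp; first exact: row_mx0_differentiable.
rewrite (adapted_row Ad dc mc cx).
by apply: (maximal_atlas_change A_chart A_cover) => //; [case: Ad|case: Ad'].
Qed.

Lemma submanifold_chart_exists (d : chart R X (n + k)) (x0 : S) :
  adapted_chart A S d -> exists2 c, submanifold_atlas n k A S c &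
    cdom c = set_val @^-1` cdom d.
Proof.
move=> Ad; have [_ _ Kd _ _] := adapted_is_chart Ad.
(* The point [x0] is a default where the ambient inverse leaves [S]; it is never reached from the
   image of the chart. *)
pose g w : S := if pselect (S (cinv d (row_mx w 0))) is left h
  then SigSub (mem_set h) else x0.
pose c := Chart (set_val @^-1` cdom d) (fun x : S => lsubmx (cmap d (set_val x))) g.
exists c => //; exists d => //; split=> // x cx.
have E : row_mx (cmap c x) 0 = cmap d (set_val x).
  by rewrite (@adapted_row c d).
apply: val_inj => /=; rewrite /g; case: pselect => h /=.
  by rewrite E Kd.
by case: h; rewrite E Kd//; exact: set_valP.
Qed.

Lemma submanifold_complex_atlas : complex_submanifold n k A S ->
  complex_atlas (submanifold_atlas n k A S).
Proof.
move=> HS; split.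
- exact: submanifold_is_chart.
- move=> x; have [d Ad dx] := HS _ (set_valP x).
  have [c Sc dc] := submanifold_chart_exists x Ad.
  by exists c => //; rewrite dc.
- exact: submanifold_change.
Qed.

End Submanifold.
End Charts.

(** * The quadric *)

Section Projective.
Context (R : realType) (n : nat).
Local Notation C := (Cplx R).
Local Notation P := (Proj R n).
Implicit Types (z w : 'rV[C]_n.+1) (p : P) (l : C).

(** Total on all vectors, so that continuity can be stated on the ambient vector space; the zero
    vector is sent to the arbitrary point [1:0:...:0]. *)
Definition proj_pt z : P :=
  if pselect (nzvec z) is left h then \pi_P (SigSub (mem_set h) : @nzvec R n)
  else \pi_P (SigSub (insert1_neq0 (ord0 : 'I_n.+1) (0 : 'rV[C]_n)) : @nzvec R n).

Definition nz_vector z (z0 : z != 0) : @nzvec R n :=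
  SigSub (mem_set (z0 : @nzvec R n z)).

Lemma hcoord_neq0 p : hcoord p != 0.
Proof. exact: set_valP (repr p). Qed.

Lemma proj_ptE (v : @nzvec R n) : proj_pt (set_val v) = \pi_P v.
Proof.
rewrite /proj_pt; case: pselect => h; last by case: h; exact: set_valP v.
by congr (\pi_P _); exact: val_inj.
Qed.

Lemma hcoordK p : proj_pt (hcoord p) = p.
Proof. by rewrite /hcoord proj_ptE reprK. Qed.

Lemma hcoord_pt z : z != 0 -> exists2 l, l != 0 & hcoord (proj_pt z) = l *: z.
Proof.
move=> z0; pose v : @nzvec R n := nz_vector z0.
rewrite -[z]/(set_val v) proj_ptE /hcoord.
have : \pi_P (repr (\pi_P v : P)) = \pi_P v :> P by rewrite reprK.
move=> /eqmodP; rewrite /= /proportional => /asboolP[l l0 E].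
exists l^-1; first by rewrite invr_eq0.
by rewrite E scalerA mulVf// scale1r.
Qed.

Lemma proj_ptZ l z : l != 0 -> z != 0 -> proj_pt (l *: z) = proj_pt z.
Proof.
move=> l0 z0; have lz0 : l *: z != 0 by rewrite scaler_eq0 negb_or l0.
pose v : @nzvec R n := nz_vector z0.
pose w : @nzvec R n := nz_vector lz0.
rewrite -[l *: z]/(set_val w) -[z]/(set_val v) !proj_ptE.
apply/esym/eqmodP; rewrite /= /proportional; apply/asboolP.
by exists l.
Qed.

Lemma open_scalar_neq0 : open [set x : C | x != 0].
Proof.
rewrite openE => x /= x0; apply/nbhs_ballP; exists `|x|; first by rewrite /= normr_gt0.
move=> y; rewrite -ball_normE /= => xy; apply/eqP => y0.
by move: xy; rewrite y0 subr0 ltxx.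
Qed.

Lemma open_coord_neq0 i : open [set z : 'rV[C]_n.+1 | z 0 i != 0].
Proof.
have /continuousP := @coord_continuous C 1 n.+1 0 i.
by move=> /(_ [set x | x != 0]); apply; exact: open_scalar_neq0.
Qed.

Lemma open_neq0 : open [set z : 'rV[C]_n.+1 | z != 0].
Proof.
rewrite (_ : [set z | _] = \bigcup_i [set z : 'rV[C]_n.+1 | z 0 i != 0]).
  by apply: bigcup_open => i _; exact: open_coord_neq0.
apply/seteqP; split=> z /=; last first.
  by case=> i _; apply: contraNneq => ->; rewrite mxE.
move=> z0; have /existsP[i zi] : [exists i, z 0 i != 0].
  apply: contraNT z0 => /existsPn H; apply/eqP/rowP => i; rewrite mxE.
  exact/eqP/negPn/(H i).
by exists i.
Qed.

Lemma proj_pt_continuous z : z != 0 -> {for z, continuous proj_pt}.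
Proof.
move=> z0 U; rewrite nbhsE => -[W [oW Wz] WU].
have oV : open ((\pi_P : @nzvec R n -> P) @^-1` W) by exact: oW.
have [B oB BE] := open_set_valP oV.
have Bz : B z.
  have : ((\pi_P : @nzvec R n -> P) @^-1` W) (nz_vector z0).
    by rewrite /= -proj_ptE.
  by rewrite -BE.
apply: (filterS (P := B `&` [set z : 'rV[C]_n.+1 | z != 0])).
  move=> w [Bw w0] /=; apply: WU.
  have : (set_val @^-1` B) (nz_vector w0) by [].
  by rewrite BE /= -proj_ptE.
apply: filterI; first exact: open_nbhs_nbhs.
by apply: open_nbhs_nbhs; split=> //; exact: open_neq0.
Qed.

(** Reduces the quotient topology to the cone: a set is open as soon as the nonzero vectors above it
    are the trace of an open set. *)
Lemma open_proj (D : set P) (O : set 'rV[C]_n.+1) : open O ->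
  (forall z, z != 0 -> D (proj_pt z) <-> O z) -> open D.
Proof.
move=> oO H; rewrite /open /= /quotient_open; exists O => //.
apply/seteqP; split=> v /=.
  by move=> Ov; rewrite -proj_ptE; apply/H => //; exact: set_valP v.
by rewrite -proj_ptE => /H; apply; exact: set_valP v.
Qed.

Lemma proj_continuous (Y : topologicalType) (D : set P) (f : P -> Y)
    (g : 'rV[C]_n.+1 -> Y) : open D ->
  (forall z, z != 0 -> D (proj_pt z) -> f (proj_pt z) = g z) ->
  (forall z, z != 0 -> D (proj_pt z) -> {for z, continuous g}) ->
  forall p, D p -> {for p, continuous f}.
Proof.
move=> oD fg cg p Dp U; rewrite nbhsE => -[W [oW Wp] WU].
apply: (filterS (P := D `&` f @^-1` W)).
  by move=> q [_ /= Wq]; exact: WU.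
apply: open_nbhs_nbhs; split=> //.
pose O := [set z : 'rV[C]_n.+1 | z != 0 /\ D (proj_pt z) /\ W (g z)].
apply: (@open_proj _ O).
  rewrite openE => z [z0 [Dz Wz]].
  have h1 : \forall w \near z, w != 0.
    by apply: open_nbhs_nbhs; split=> //; exact: open_neq0.
  have h2 : \forall w \near z, D (proj_pt w).
    by apply: (proj_pt_continuous z0); exact: open_nbhs_nbhs.
  have h3 : \forall w \near z, W (g w).
    by apply: (cg z z0 Dz); exact: open_nbhs_nbhs.
  by apply: filterS3 h1 h2 h3 => w.
move=> z z0; split=> [[Dz /= Wz]|[_ [Dz Wz]]].
  by split=> //; split=> //; rewrite -fg.
by split=> //=; rewrite fg.
Qed.

(* A chart of the projective space given by homogeneous coordinates: [f] has
   degree 0 on the homogeneous open set [D], and [g] is a section of it. *)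
Definition proj_chart (c : chart R P n) (D : set 'rV[C]_n.+1)
    (f : 'rV[C]_n.+1 -> 'rV[C]_n) (g : 'rV[C]_n -> 'rV[C]_n.+1) : Prop :=
  [/\ (forall p, cdom c p <-> D (hcoord p)) /\ cmap c = f \o @hcoord R n /\
        cinv c = proj_pt \o g,
      open D /\ (forall l z, l != 0 -> D z -> D (l *: z)),
      (forall l z, l != 0 -> z != 0 -> f (l *: z) = f z) /\
        (forall z, D z -> differentiable f z),
      forall w : 'rV[C]_n, [/\ g w != 0, D (g w), f (g w) = w & differentiable g w] &
      forall z, D z -> exists2 l, l != 0 & z = l *: g (f z)].

Section ProjChart.
Context c D f g (H : @proj_chart c D f g).

Lemma proj_chart_dom z : z != 0 -> cdom c (proj_pt z) <-> D z.
Proof.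
move=> z0; have [[dc _] [_ DZ] _ _ _] := H; rewrite dc.
have [l l0 ->] := hcoord_pt z0; split; last exact: DZ.
by move=> /(DZ l^-1); rewrite invr_eq0 scalerA mulVf// scale1r; apply.
Qed.

Lemma proj_chart_map z : z != 0 -> cmap c (proj_pt z) = f z.
Proof.
move=> z0; have [[_ [-> _]] _ [fZ _] _ _] := H => /=.
by have [l l0 ->] := hcoord_pt z0; rewrite fZ.
Qed.

Lemma proj_chart_mapK (w : 'rV[C]_n) : cmap c (cinv c w) = w.
Proof.
have [[_ [_ ->]] _ _ gP _] := H => /=.
by have [g0 _ fg _] := gP w; rewrite proj_chart_map.
Qed.

Lemma proj_chart_invK p : cdom c p -> cinv c (cmap c p) = p.
Proof.
have [[dc [-> ->]] _ _ gP fP] := H => /dc /fP [l l0 E] /=.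
have [g0 _ _ _] := gP (f (hcoord p)).
by rewrite -[RHS]hcoordK [in RHS]E proj_ptZ.
Qed.

Lemma proj_chart_cimg : cimg c = setT.
Proof.
apply/seteqP; split=> // w _; exists (cinv c w); last exact: proj_chart_mapK.
have [[_ [_ ->]] _ _ gP _] := H; have [g0 Dg _ _] := gP w.
by apply/proj_chart_dom.
Qed.

Lemma proj_chart_is_chart : is_chart c.
Proof.
have [[dc [mc ic]] [oD DZ] [fZ fd] gP fP] := H.
have odc : open (cdom c).
  by apply: (open_proj oD) => z z0; exact: proj_chart_dom.
split=> //; first by rewrite proj_chart_cimg; exact: openT.
- exact: proj_chart_invK.
- apply: within_open_continuous; apply: (@proj_continuous _ _ _ f odc).
    by move=> z z0 _; exact: proj_chart_map.
  move=> z z0 /(proj_chart_dom z0) Dz.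
  exact/differentiable_continuous/fd.
- apply: within_open_continuous => w _; rewrite ic.
  have [g0 _ _ dg] := gP w.
  apply: continuous_comp; first exact: differentiable_continuous.
  exact: proj_pt_continuous.
Qed.

End ProjChart.

(** Since f' has degree 0, the arbitrary representative chosen by [hcoord] drops out and the change
    is f' after g, a map between vector spaces. *)
Lemma proj_chart_change c D f g c' D' f' g' :
  @proj_chart c D f g -> @proj_chart c' D' f' g' -> holomorphic_change c c'.
Proof.
move=> H H' p cp c'p.
have [[dc [mc ic]] [_ DZ] [fZ fd] gP fP] := H.
have [[dc' [mc' ic']] [_ DZ'] [fZ' fd'] _ _] := H'.
have -> : cmap c' \o cinv c = f' \o g.
  apply/funext => w /=; rewrite ic /=.
  by have [g0 _ _ _] := gP w; rewrite (proj_chart_map H').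
have [g0 _ _ dg] := gP (cmap c p).
apply: (differentiable_comp dg); apply: fd'.
have [l l0 E] := fP _ ((dc p).1 cp); rewrite mc /=.
have := (dc' p).1 c'p; rewrite {1}E => /(DZ' l^-1).
by rewrite invr_eq0 scalerA mulVf// scale1r; apply.
Qed.

Lemma affine_proj_chart j : proj_chart (affine_chart R j) [set z : 'rV[C]_n.+1 | z 0 j != 0]
  (fun z => \row_i (z 0 (lift j i) / z 0 j)) (insert1 j).
Proof.
have coordj z : differentiable (fun z : 'rV[C]_n.+1 => z 0 j) z.
  exact: differentiable_coord.
split.
- split=> //; split=> //; apply/funext => w /=.
  by rewrite -proj_ptE.
- split; last by move=> l z l0 /= zj; rewrite mxE mulf_neq0.
  exact: open_coord_neq0.
- split.
    move=> l z l0 z0; apply/rowP => i; rewrite !mxE.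
    by rewrite -mulf_div divff// mul1r.
  move=> z zj; apply: differentiable_mx => i k.
  rewrite (_ : (fun v => _) = fun v : 'rV[C]_n.+1 => v 0 (lift j k) * (v 0 j)^-1);
    last by apply/funext => v; rewrite mxE.
  apply: differentiableM; first exact: differentiable_coord.
  exact: differentiableV.
- move=> w; split.
  + by have := insert1_neq0 j w; rewrite inE.
  + by rewrite /= mxE unlift_none oner_neq0.
  + by apply/rowP => i; rewrite !mxE liftK unlift_none divr1.
  + apply: differentiable_mx => i k.
    rewrite (_ : (fun v => _) = fun v : 'rV[C]_n =>
      if unlift j k is Some m then v 0 m else 1); last first.
      by apply/funext => v; rewrite mxE.
    case: unlift => [m|]; first exact: differentiable_coord.
    exact: differentiable_cst.
- move=> z /= zj; exists (z 0 j) => //; apply/rowP => i; rewrite !mxE.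
  case: unliftP => [m ->|->]; last by rewrite mulr1.
  by rewrite mxE mulrC divfK.
Qed.

Lemma proj_atlas_chart c : proj_atlas R n c -> is_chart c.
Proof. by move=> [j _ <-]; exact: proj_chart_is_chart (affine_proj_chart j). Qed.

Lemma proj_atlas_cover p : exists2 c, proj_atlas R n c & cdom c p.
Proof.
have [j pj] : exists j, hcoord p 0 j != 0.
  apply/existsP; apply: contraNT (hcoord_neq0 p) => /existsPn H.
  by apply/eqP/rowP => j; rewrite mxE; exact/eqP/negPn/(H j).
by exists (affine_chart R j) => //; exists j.
Qed.

Lemma proj_chart_maximal c D f g :
  @proj_chart c D f g -> maximal_atlas (proj_atlas R n) c.
Proof.
move=> H; split; first exact: proj_chart_is_chart H.
move=> _ [j _ <-]; have Hj := affine_proj_chart j; split.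
  exact: proj_chart_change H Hj.
exact: proj_chart_change Hj H.
Qed.

End Projective.

Section QuadricCharts.
Context (R : realType).
Local Notation C := (Cplx R).
Local Notation V := ('rV[C]_9).

Definition ii : C := (0 +i* 1)%C.

Lemma ii_sqr : ii * ii = -1.
Proof. by apply/eqP; rewrite eq_complex /= !mul0r !mulr0 !mul1r sub0r addr0 oppr0 !eqxx. Qed.

Definition qform (z : V) : C := \sum_i z 0 i ^+ 2.

Lemma qformZ (l : C) (z : V) : qform (l *: z) = l ^+ 2 * qform z.
Proof. by rewrite mulr_sumr; apply: eq_bigr => i _; rewrite mxE exprMn. Qed.

Lemma differentiable_coord0 m (i : 'I_m) (z : 'rV[C]_m) :
  differentiable (fun z : 'rV[C]_m => z 0 i) z.
Proof. exact: differentiable_coord. Qed.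

Lemma differentiable_coord_sqr m (i : 'I_m) (z : 'rV[C]_m) :
  differentiable (fun z : 'rV[C]_m => z 0 i ^+ 2) z.
Proof.
rewrite (_ : (fun z : 'rV[C]_m => _) = fun z : 'rV[C]_m => z 0 i * z 0 i).
  by apply: differentiableM; exact: differentiable_coord0.
by apply/funext => v; rewrite expr2.
Qed.

Lemma qform_differentiable z : differentiable qform z.
Proof. by apply: differentiable_fsum => i; exact: differentiable_coord_sqr. Qed.

(* On [z_j + i z_k <> 0] the quadric is a graph: with [a = z_j + i z_k = 1] and
   [b = z_j - i z_k], its equation reads [b = - \sum z_l ^ 2] over the seven
   other coordinates.  The index [k] is [lift j k]. *)
Section OneChart.
Context (j : 'I_9) (k : 'I_8).

Definition qrest (m : 'I_7) : 'I_9 := lift j (lift k m).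

Definition qa (z : V) : C := z 0 j + ii * z 0 (lift j k).

(** The last coordinate is the equation of the quadric, divided by [qa z ^+ 2] to have degree 0. The
    quadric is its zero set, which makes the chart adapted. *)
Definition qmap (z : V) : 'rV[C]_(7 + 1) :=
  row_mx (\row_m (z 0 (qrest m) / qa z)) (const_mx (qform z / qa z ^+ 2)).

Definition qb (w : 'rV[C]_(7 + 1)) : C :=
  w 0 (rshift 7 ord0) - \sum_m w 0 (lshift 1 m) ^+ 2.

(** Solves a = 1 and b = [qb w] for the two special coordinates: z_j = (a + b) / 2 and z_k = (a - b)
    / (2i) = i (b - a) / 2. *)
Definition qvec (w : 'rV[C]_(7 + 1)) : V :=
  \row_i if unlift j i is Some i' then
           if unlift k i' is Some m then w 0 (lshift 1 m)
           else ii * (qb w - 1) / 2%:R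
         else (1 + qb w) / 2%:R.

Definition quadric_chart : chart R (Proj R 8) (7 + 1) :=
  Chart (fun p => qa (hcoord p) != 0) (qmap \o @hcoord R 8) (@proj_pt R 8 \o qvec).

Lemma qvec_j w : qvec w 0 j = (1 + qb w) / 2%:R.
Proof. by rewrite mxE unlift_none. Qed.

Lemma qvec_k w : qvec w 0 (lift j k) = ii * (qb w - 1) / 2%:R.
Proof. by rewrite mxE liftK unlift_none. Qed.

Lemma qvec_rest w m : qvec w 0 (qrest m) = w 0 (lshift 1 m).
Proof. by rewrite mxE !liftK. Qed.

Lemma two_neq0 : 2%:R != 0 :> C.
Proof. by rewrite pnatr_eq0. Qed.

Lemma qa_vec w : qa (qvec w) = 1.
Proof.
rewrite /qa qvec_j qvec_k !mulrA ii_sqr mulN1r opprB -mulrDl.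
by rewrite addrACA subrr addr0 -(natrD _ 1 1) divff// two_neq0.
Qed.

Lemma qform_split z :
  qform z = z 0 j ^+ 2 + z 0 (lift j k) ^+ 2 + \sum_m z 0 (qrest m) ^+ 2.
Proof. by rewrite /qform (bigD1_ord j)//= (bigD1_ord k)//= addrA. Qed.

Lemma qform_ab (z : V) : z 0 j ^+ 2 + z 0 (lift j k) ^+ 2 =
  qa z * (z 0 j - ii * z 0 (lift j k)).
Proof. by rewrite /qa [RHS]mulrC -subr_sqr exprMn (expr2 ii) ii_sqr mulN1r opprK. Qed.

Lemma qform_vec w : qform (qvec w) = w 0 (rshift 7 ord0).
Proof.
rewrite qform_split qform_ab qa_vec mul1r qvec_j qvec_k.
rewrite (eq_bigr (fun m => w 0 (lshift 1 m) ^+ 2)); last first.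
  by move=> m _; rewrite qvec_rest.
rewrite !mulrA ii_sqr mulN1r mulNr opprK -mulrDl.
rewrite [1 + _]addrC addrACA subrr addr0 -mulr2n -(mulr_natr (qb w)) mulfK ?two_neq0//.
by rewrite /qb subrK.
Qed.

Lemma qaZ (l : C) z : qa (l *: z) = l * qa z.
Proof. by rewrite /qa !mxE mulrDr mulrCA. Qed.

Lemma qa_differentiable z : differentiable qa z.
Proof.
apply: differentiableD; first exact: differentiable_coord0.
by apply: differentiableM; [exact: differentiable_cst|exact: differentiable_coord0].
Qed.

Lemma qb_differentiable w : differentiable qb w.
Proof.
apply: differentiableB; first exact: differentiable_coord0.
by apply: differentiable_fsum => m; exact: differentiable_coord_sqr.
Qed.

Lemma qvec_differentiable w : differentiable qvec w.
Proof.
apply: differentiable_mx => i0 i.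
rewrite (_ : (fun v => _) = fun w : 'rV[C]_(7 + 1) =>
  if unlift j i is Some i' then
    if unlift k i' is Some m then w 0 (lshift 1 m) else ii * (qb w - 1) / 2%:R
  else (1 + qb w) / 2%:R); last by apply/funext => v; rewrite mxE.
case: unlift => [i'|]; last first.
  apply: differentiableM; last exact: differentiable_cst.
  by apply: differentiableD; [exact: differentiable_cst|exact: qb_differentiable].
case: unlift => [m|]; first exact: differentiable_coord0.
apply: differentiableM; last exact: differentiable_cst.
apply: differentiableM; first exact: differentiable_cst.
by apply: differentiableB; [exact: qb_differentiable|exact: differentiable_cst].
Qed.

Lemma qmap_differentiable z : qa z != 0 -> differentiable qmap z.
Proof.
move=> az; apply: differentiable_mx => i0 i.
rewrite (_ : (fun v => _) = fun z : V => match fintype.split i with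
    | inl m => z 0 (qrest m) * (qa z)^-1
    | inr _ => qform z * ((qa z)^-1 * (qa z)^-1) end); last first.
  apply/funext => v; rewrite mxE; case: fintype.split => m; rewrite mxE//.
  by rewrite expr2 invfM.
have da := differentiableV (qa_differentiable z) az.
case: fintype.split => m.
  by apply: differentiableM; [exact: differentiable_coord0|].
by apply: differentiableM; [exact: qform_differentiable|exact: differentiableM].
Qed.

Lemma qmap_vec w : qmap (qvec w) = w.
Proof.
rewrite /qmap qa_vec expr1n qform_vec divr1 -[RHS]hsubmxK; congr row_mx.
  by apply/rowP => m; rewrite mxE qvec_rest divr1 mxE.
by apply/rowP => m; rewrite !mxE [m]ord1.
Qed.

Lemma qvec_map z : qa z != 0 -> qvec (qmap z) = (qa z)^-1 *: z.
Proof.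
move=> az; have bE : qb (qmap z) = (z 0 j - ii * z 0 (lift j k)) / qa z.
  rewrite /qb /qmap row_mxEr mxE.
  rewrite (eq_bigr (fun m => z 0 (qrest m) ^+ 2 / qa z ^+ 2)); last first.
    by move=> m _; rewrite row_mxEl mxE expr_div_n.
  rewrite -mulr_suml -mulrBl qform_split addrK qform_ab.
  by rewrite expr2 invfM mulrACA divff// mul1r.
have two : z 0 j + z 0 j = z 0 j * 2%:R by rewrite mulr_natr mulr2n.
apply/rowP => i; rewrite [RHS]mxE.
case: (unliftP j i) => [i' ->|->]; last first.
  rewrite qvec_j bE -{1}(divff az) -mulrDl /qa addrACA subrr addr0 two.
  by rewrite mulrAC mulfK ?two_neq0// mulrC.
case: (unliftP k i') => [m ->|->].
  by rewrite -/(qrest m) qvec_rest row_mxEl mxE mulrC.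
rewrite qvec_k bE -[X in _ - X](divff az) -mulrBl /qa opprD addrACA subrr add0r -opprD.
rewrite mulrA mulrN mulrDr !mulrA ii_sqr mulN1r opprD opprK -mulr2n.
by rewrite -(mulr_natr (z 0 (lift j k))) mulrAC mulfK ?two_neq0// mulrC.
Qed.

Lemma quadric_proj_chart :
  proj_chart quadric_chart [set z : V | qa z != 0] qmap qvec.
Proof.
split.
- by [].
- split; last by move=> l z l0 /= az; rewrite qaZ mulf_neq0.
  have /continuousP : continuous qa.
    by move=> z; apply: differentiable_continuous; exact: qa_differentiable.
  by move=> /(_ [set x | x != 0]); apply; exact: open_scalar_neq0.
- split; last exact: qmap_differentiable.
  move=> l z l0 _; rewrite /qmap qaZ qformZ; apply/rowP => i; rewrite !mxE.
  case: fintype.split => m; rewrite !mxE ?exprMn -mulf_div divff ?mul1r//.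
  by rewrite expf_neq0.
- move=> w; have a1 := qa_vec w; split.
  + apply/eqP => v0; move: a1; rewrite v0 /qa !mxE mulr0 addr0 => /esym/eqP.
    by rewrite oner_eq0.
  + by rewrite /= a1 oner_neq0.
  + exact: qmap_vec.
  + exact: qvec_differentiable.
- move=> z /= az; exists (qa z) => //.
  by rewrite qvec_map// scalerA divff// scale1r.
Qed.

Lemma quadric_adapted : @adapted_chart R _ 7 1 (proj_atlas R 8) (quadric R 8) quadric_chart.
Proof.
split; first exact: proj_chart_maximal quadric_proj_chart.
move=> p /= ap; rewrite /quadric /= /qmap row_mxKr -/(qform _); split=> [->|].
  by rewrite mul0r; apply/rowP => m; rewrite !mxE.
move=> /rowP/(_ ord0); rewrite !mxE => /eqP.
by rewrite mulf_eq0 invr_eq0 expf_eq0 /= (negbTE ap) orbF => /eqP.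
Qed.

End OneChart.

(** If z_j = - i z_l for all pairs of distinct indices, then exchanging j and l gives z_j = - z_j,
    so z would vanish. The charts cover all of P^8, not only the quadric. *)
Lemma quadric_chart_cover (p : Proj R 8) : exists j k, cdom (quadric_chart j k) p.
Proof.
have := hcoord_neq0 p; set z := hcoord p => z0.
apply: contrapT => H; move/negP: z0; apply; apply/eqP/rowP => j; rewrite mxE.
have a0 j' k' : z 0 j' = - (ii * z 0 (lift j' k')).
  apply/eqP; rewrite -addr_eq0; apply/negPn/negP => h; apply: H.
  by exists j', k'.
pose l := lift j ord0; have [k lk] : exists k, j = lift l k.
  case: (unliftP l j) => [k ->|jl]; first by exists k.
  by have := neq_lift j ord0; rewrite -/l -jl eqxx.
have E : z 0 j = - z 0 j.
  rewrite {1}(a0 j ord0) -/l (a0 l k) -lk mulrN opprK mulrA ii_sqr.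
  by rewrite mulN1r.
by apply/eqP; move/eqP: E; rewrite -addr_eq0 -mulr2n mulrn_eq0.
Qed.

Lemma quadric_submanifold : complex_submanifold 7 1 (proj_atlas R 8) (quadric R 8).
Proof.
move=> p _; have [j [k jk]] := quadric_chart_cover p.
by exists (quadric_chart j k) => //; exact: quadric_adapted.
Qed.

End QuadricCharts.

(** * The complex structure of T1 *)

Section DiffLift.
Context (R : realType).

(* If [P = Q \o t] near [x], with [t] continuous and ['d Q] injective, then [t]
   is differentiable: no inverse function theorem is needed. *)
Lemma diff_lift (V1 V2 W : normedModType R) (P : V1 -> W) (Q : V2 -> W)
    (t : V1 -> V2) (A : {linear V1 -> W}) (B : {linear V2 -> W})
    (K : {linear W -> V2}) x :
  is_diff x P A -> is_diff (t x) Q B -> continuous A -> continuous K ->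
  cancel B K -> {for x, continuous t} -> (\near x, P x = Q (t x)) ->
  forall e : R, 0 < e ->
    \forall h \near (0 : V1), `|t (h + x) - t x - K (A h)| <= e * `|h|.
Proof.
move=> DP DQ cA cK BK ct PQ e e0.
have [k k0 Kk] := linear_lipschitz cK; have [a a0 Aa] := linear_lipschitz cA.
have ka0 : 0 <= k * a by rewrite mulr_ge0// ltW.
(* The error X = |y - K A h| will satisfy X <= s|h| + s|y|. The bound s <= 1/2 absorbs |y| and
   yields |y| <= (2ka + 1)|h|, whence X <= s (2 + 2ka)|h|; the second bound on s makes this at most
   e|h|. *)
pose s := Num.min 2^-1 (e / (2 + 2 * (k * a))).
have d0 : 0 < 2 + 2 * (k * a) by lra.
have s0 : 0 < s by rewrite /s lt_min invr_gt0 ltr0n divr_gt0.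
have s1 : s <= 2^-1 by rewrite /s ge_min lexx.
have s2 : s * (2 + 2 * (k * a)) <= e.
  by rewrite -ler_pdivlMr// /s ge_min lexx orbT.
have sk0 : 0 < s / k by rewrite divr_gt0.
have ksk w1 : k * (s / k * w1) = s * w1 by rewrite mulrA mulrCA divff ?mulr1// gt_eqF.
have PQx := nbhs_singleton PQ.
have E1 := is_diff_epsP DP sk0.
have E2 : \forall h \near (0 : V1),
    `|Q (t (h + x)) - Q (t x) - B (t (h + x) - t x)| <=
    s / k * `|t (h + x) - t x|.
  have := is_diff_epsP DQ sk0; rewrite (near_shift (t x)) => F.
  have := ct _ F; rewrite nbhs_simpl /= => F'.
  have : \forall y \near x, `|Q (t y) - Q (t x) - B (t y - t x)| <=
      s / k * `|t y - t x|.
    by apply: filterS F' => y /=; rewrite sub0r subrK.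
  by move=> F2; rewrite (near_shift x); apply: filterS F2 => y; rewrite /= sub0r subrK.
have E3 : \forall h \near (0 : V1), P (h + x) = Q (t (h + x)).
  by rewrite (near_shift x); apply: filterS PQ => y; rewrite /= sub0r subrK.
apply: filterS3 E1 E2 E3 => h H1 H2 H3; rewrite PQx H3 in H1.
set y := t (h + x) - t x in H2 *; set r := Q _ - Q _ in H1 H2.
have n1 : `|K (r - A h)| <= s * `|h|.
  by apply: le_trans (Kk _) _; rewrite -ksk ler_pM2l.
have n2 : `|K (r - B y)| <= s * `|y|.
  by apply: le_trans (Kk _) _; rewrite -ksk ler_pM2l.
(* [r] is the increment of both P and Q o t; applying K to its two expansions and subtracting
   eliminates K r, and K B = id leaves y. *)
have yE : y - K (A h) = K (r - A h) - K (r - B y).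
  have e1 : K (r - A h) = K r - K (A h) by rewrite linearB.
  have e2 : K (r - B y) = K r - y by rewrite linearB /= BK.
  by rewrite e1 e2 opprB [RHS]addrC addrA subrK.
have n3 : `|y - K (A h)| <= s * `|h| + s * `|y|.
  by rewrite yE; apply: le_trans (ler_normB _ _) _; exact: lerD.
have n4 : `|K (A h)| <= k * a * `|h|.
  by apply: le_trans (Kk _) _; rewrite -mulrA ler_pM2l.
have n5 : `|y| <= `|y - K (A h)| + `|K (A h)|.
  by rewrite -{1}(subrK (K (A h)) y) ler_normD.
have h0 : 0 <= `|h| by []. have y0 : 0 <= `|y| by [].
set X := `|y - K (A h)| in n3 n5 *; set Y := `|y| in n3 n5 y0 *.
set Z := `|K (A h)| in n4 n5; set N := `|h| in n3 n4 h0 *.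
have m1 : s * Y <= 2^-1 * Y by rewrite ler_wpM2r.
have m2 : s * N <= 2^-1 * N by rewrite ler_wpM2r.
have Yb : Y <= (2 * (k * a) + 1) * N by lra.
have m3 : s * Y <= s * ((2 * (k * a) + 1) * N) by rewrite ler_wpM2l// ltW.
have m4 : s * (2 + 2 * (k * a)) * N <= e * N by rewrite ler_wpM2r.
lra.
Qed.

(** Injectivity of [B] becomes row-freeness of its matrix, and the pseudo-inverse of that matrix
    gives K. *)
Lemma linear_left_inverse (n m : nat)
    (B : {linear ('rV[R]_n * 'rV[R]_n)%type -> 'M[R]_m}) :
  injective B -> exists K : {linear 'M[R]_m -> ('rV[R]_n * 'rV[R]_n)%type}, cancel B K.
Proof.
move=> BI.
pose g (v : 'rV[R]_(n + n)) := mxvec (B (lsubmx v, rsubmx v)).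
have lg : linear g.
  move=> a u v; rewrite /g -linearP /=; congr mxvec; rewrite -linearP.
  by congr (B _); rewrite !linearP.
pose gM := GRing.isLinear.Build _ _ _ _ _ lg.
pose gL : {linear 'rV[R]_(n + n) -> 'rV[R]_(m * m)} := HB.pack g gM.
pose G := lin1_mx gL.
have fG : row_free G.
  apply/inj_row_free => v; rewrite mul_rV_lin1 /= /g => /(canRL mxvecK).
  rewrite linear0 -(linear0 B) => /BI [l0 r0].
  by rewrite -[v]hsubmxK l0 r0 row_mx0.
pose K (w : 'M[R]_m) : 'rV[R]_n * 'rV[R]_n :=
  (lsubmx (mxvec w *m pinvmx G), rsubmx (mxvec w *m pinvmx G)).
have lK : linear K.
  by move=> a u v; rewrite /K !linearP /= mulmxDl -scalemxAl !linearP.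
pose KM := GRing.isLinear.Build _ _ _ _ _ lK.
pose KL : {linear 'M[R]_m -> ('rV[R]_n * 'rV[R]_n)%type} := HB.pack K KM.
exists KL => -[u v]; rewrite /= /K.
have -> : mxvec (B (u, v)) = row_mx u v *m G.
  by rewrite mul_rV_lin1 /= /g row_mxKl row_mxKr.
by rewrite mulmxKp// row_mxKl row_mxKr.
Qed.

End DiffLift.

Section RealPairs.
Context (R : realType).
Local Notation C := (Cplx R).
Local Notation RP n := ('rV[R]_n * 'rV[R]_n)%type.

Definition to_real_pair n (z : 'rV[C]_n) : RP n :=
  (\row_j complex.Re (z 0 j), \row_j complex.Im (z 0 j)).

Lemma of_real_pairK n : cancel (@of_real_pair R n) (@to_real_pair n).
Proof. by move=> [u v]; congr pair; apply/rowP => j; rewrite !mxE. Qed.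

Lemma to_real_pairK n : cancel (@to_real_pair n) (@of_real_pair R n).
Proof. by move=> z; apply/rowP => j; rewrite !mxE; case: (z 0 j). Qed.

Lemma of_real_pairD n (p q : RP n) :
  of_real_pair (p + q) = of_real_pair p + of_real_pair q.
Proof. by apply/rowP => j; rewrite !mxE. Qed.

Lemma of_real_pairN n (p : RP n) : of_real_pair (- p) = - of_real_pair p.
Proof. by apply/rowP => j; rewrite !mxE. Qed.

Lemma of_real_pairB n (p q : RP n) :
  of_real_pair (p - q) = of_real_pair p - of_real_pair q.
Proof. by rewrite of_real_pairD of_real_pairN. Qed.

Lemma to_real_pairD n (z w : 'rV[C]_n) :
  to_real_pair (z + w) = to_real_pair z + to_real_pair w.
Proof. by apply: (can_inj (@of_real_pairK n)); rewrite of_real_pairD !to_real_pairK. Qed.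

Lemma to_real_pairB n (z w : 'rV[C]_n) :
  to_real_pair (z - w) = to_real_pair z - to_real_pair w.
Proof. by apply: (can_inj (@of_real_pairK n)); rewrite of_real_pairB !to_real_pairK. Qed.

Lemma to_real_pairZ n (k : C) (z : 'rV[C]_n) : to_real_pair (k *: z) =
  complex.Re k *: to_real_pair z + complex.Im k *: imul_pair (to_real_pair z).
Proof.
case: k => a b; congr pair; apply/rowP => j; rewrite !mxE; case: (z 0 j) => x y /=.
  by rewrite mulrN.
by [].
Qed.

Lemma norm_complexE (x : C) :
  `|x| = (Num.sqrt (complex.Re x ^+ 2 + complex.Im x ^+ 2))%:C%C.
Proof. by case: x. Qed.

Lemma mx_norm_bound (K : numDomainType) m n (M : 'M[K]_(m, n)) e : 0 <= e ->
  (forall i j, `|M i j| <= e) -> `|M| <= e.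
Proof.
move=> e0 Me; have [E|] := eqVneq (mx_norm M) 0; first by rewrite [leLHS]E.
by move=> /mx_norm_neq0[[i j] E]; rewrite [leLHS]E.
Qed.

Lemma mx_entry_norm (K : numDomainType) m n (M : 'M[K]_(m, n)) i j :
  `|M i j| <= `|M|.
Proof.
rewrite [leRHS]mx_normE -[leLHS]nngE num_le.
exact: (le_bigmax _ (fun ij => `|M ij.1 ij.2|%:nng) (i, j)).
Qed.

Lemma norm_complex_le (x : C) :
  `|x| <= (`|complex.Re x| + `|complex.Im x|)%:C%C.
Proof.
rewrite norm_complexE lecR.
rewrite -[leRHS]ger0_norm ?addr_ge0// -[leRHS]sqrtr_sqr ler_wsqrtr//.
by rewrite sqrrD !real_normK ?num_real// addrAC lerDl mulrn_wge0// mulr_ge0.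
Qed.

Lemma norm_complex_Re (x : C) : (`|complex.Re x|)%:C%C <= `|x|.
Proof. by rewrite norm_complexE lecR -sqrtr_sqr ler_wsqrtr// lerDl sqr_ge0. Qed.

Lemma norm_complex_Im (x : C) : (`|complex.Im x|)%:C%C <= `|x|.
Proof. by rewrite norm_complexE lecR -sqrtr_sqr ler_wsqrtr// lerDr sqr_ge0. Qed.

(** The factor 2 comes from |x + iy| <= |x| + |y|; only the equivalence of the two norms matters. *)
Lemma norm_of_real_pair n (p : RP n) : `|of_real_pair p| <= (2 * `|p|)%:C%C.
Proof.
apply: mx_norm_bound => [|i j].
  by rewrite -[0]/(0%:C%C) lecR mulr_ge0.
apply: le_trans (norm_complex_le _) _; rewrite lecR mxE /= mulr_natl mulr2n.
rewrite prod_normE; apply: lerD; rewrite le_max.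
  by rewrite mx_entry_norm.
by rewrite mx_entry_norm orbT.
Qed.

(** Norms over C take values in C itself; this brings them back to real numbers. *)
Lemma ge0_complexE (x : C) : 0 <= x -> x = (complex.Re x)%:C%C.
Proof. by rewrite lecE => /andP[/eqP /= x0 _]; case: x x0 => a b /= ->. Qed.

Lemma norm_to_real_pair n (z : 'rV[C]_n) : (`|to_real_pair z|)%:C%C <= `|z|.
Proof.
rewrite (ge0_complexE (normr_ge0 z)) lecR prod_normE ge_max /=.
have z0 : 0 <= complex.Re `|z| by have := normr_ge0 z; rewrite lecE => /andP[].
apply/andP; split; apply: mx_norm_bound => // i j; rewrite mxE -lecR
  -(ge0_complexE (normr_ge0 z)).
  exact: le_trans (norm_complex_Re _) (mx_entry_norm _ _ _).
exact: le_trans (norm_complex_Im _) (mx_entry_norm _ _ _).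
Qed.

Lemma gt0_complexE (x : C) : 0 < x -> x = (complex.Re x)%:C%C /\ 0 < complex.Re x.
Proof.
move=> x0; split; first exact/ge0_complexE/ltW.
by move: x0; rewrite ltcE => /andP[].
Qed.

Lemma of_real_pair_continuous n : continuous (@of_real_pair R n).
Proof.
move=> p U /nbhs_ballP[e /= e0 eU]; have [eE re0] := gt0_complexE e0.
apply/nbhs_ballP; exists (complex.Re e / 3); first by rewrite /= divr_gt0.
move=> q; rewrite -ball_normE /= => pq; apply: eU.
rewrite -ball_normE /= -of_real_pairB; apply: le_lt_trans (norm_of_real_pair _) _.
by rewrite eE ltcR; lra.
Qed.

Lemma to_real_pair_continuous n : continuous (@to_real_pair n).
Proof.
move=> z U /(@nbhs_ballP R (RP n) (to_real_pair z) U)[e /= e0 eU].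
suff : nbhs (z : 'rV[C]_n) (@to_real_pair n @^-1` U) by [].
apply/(@nbhs_ballP C 'rV[C]_n); exists e%:C%C.
  by rewrite /= ltcR.
move=> w; rewrite -ball_normE /= => zw; apply: eU.
rewrite -ball_normE /= -to_real_pairB -ltcR.
exact: le_lt_trans (norm_to_real_pair _) zw.
Qed.

Lemma to_real_pair0 n : @to_real_pair n 0 = 0.
Proof. by congr pair; apply/rowP => j; rewrite !mxE. Qed.

(** A real first-order estimate whose linear part is C-linear is complex differentiability. The
    tolerance is halved in the proof to pay for the factor 2 of [norm_of_real_pair]. *)
Lemma real_diff_complex m n (f : 'rV[C]_m -> 'rV[C]_n)
    (L : {linear 'rV[C]_m -> 'rV[C]_n}) (z : 'rV[C]_m) :
  (forall e : R, 0 < e -> \forall h \near (0 : RP m),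
    `|to_real_pair (f (of_real_pair h + z) - f z - L (of_real_pair h))|
      <= e * `|h|) ->
  is_diff z f L.
Proof.
move=> H; apply: is_diff_eps; first exact: linear_mx_continuous.
move=> e /gt0_complexE[eE e0]; have e20 : 0 < complex.Re e / 2 by rewrite divr_gt0.
have := H _ e20; rewrite -(to_real_pair0 m) => N.
have N' := @to_real_pair_continuous m (0 : 'rV[C]_m) _ N.
have {}N' : \forall h \near (0 : 'rV[C]_m),
    `|to_real_pair (f (of_real_pair (to_real_pair h) + z) - f z -
      L (of_real_pair (to_real_pair h)))| <= complex.Re e / 2 * `|to_real_pair h|.
  exact: N'.
apply: filterS N' => h; rewrite to_real_pairK => Hh.
set X := _ - _ - _ in Hh *; rewrite -[X in `|X|]to_real_pairK.
apply: le_trans (norm_of_real_pair _) _.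
apply: (@le_trans _ _ (complex.Re e * `|to_real_pair h|)%:C%C).
  by rewrite lecR; lra.
rewrite rmorphM /= eE; apply: ler_pM => //; last exact: norm_to_real_pair.
by rewrite lecR ltW.
by rewrite -[0]/(0%:C%C) lecR.
Qed.

(** A real-linear map commuting with multiplication by i is C-linear, because a + ib acts on pairs
    as a plus b times [imul_pair]. *)
Lemma of_real_pair_linear m n (K : {linear RP m -> RP n}) :
  (forall v, K (imul_pair v) = imul_pair (K v)) ->
  linear (fun z => of_real_pair (K (to_real_pair z))).
Proof.
move=> Ki k z w; apply: (can_inj (@to_real_pairK n)).
rewrite to_real_pairD to_real_pairZ !of_real_pairK to_real_pairD to_real_pairZ.
by rewrite !of_real_pairK !linearD !linearZ /= Ki.
Qed.

End RealPairs.

(** K inverts B only on the range of B, so it is known to intertwine the multiplications by i only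
    there; this is why the range of A must lie in that of B. *)
Lemma lift_imul (V1 V2 W : Type) (i1 : V1 -> V1) (i2 : V2 -> V2) (phi : W -> W)
    (A : V1 -> W) (B : V2 -> W) (K : W -> V2) :
  cancel B K -> range A `<=` range B -> (forall v, A (i1 v) = phi (A v)) ->
  (forall v, B (i2 v) = phi (B v)) -> forall v, K (A (i1 v)) = i2 (K (A v)).
Proof.
move=> BK AB Ai Bi v; have [w _ wE] : range B (A v) by apply: AB; exists v.
by rewrite Ai -wE -Bi !BK.
Qed.

Section T1Atlas.
Context (R : realType) (I : 'I_9 -> 'M[R]_16).
Local Notation C := (Cplx R).

Lemma T1_atlas_is_chart c : T1_atlas I c -> is_chart c.
Proof. by case. Qed.

(** The differential of the transition t is K after the differential of P. Both differentials have
    the same range S and intertwine i with the same [phi], so [lift_imul] gives the Cauchy-Riemann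
    equations. *)
Lemma complex_lift (phi : 'M[R]_16 -> 'M[R]_16) (S : set 'M[R]_16) n m
    (P : 'rV[R]_n * 'rV[R]_n -> 'M[R]_16) (Q : 'rV[R]_m * 'rV[R]_m -> 'M[R]_16)
    (t : 'rV[R]_n * 'rV[R]_n -> 'rV[R]_m * 'rV[R]_m) p :
  differentiable P p -> differentiable Q (t p) -> injective ('d Q (t p)) ->
  range ('d P p) = S -> range ('d Q (t p)) = S ->
  (forall v, 'd P p (imul_pair v) = phi ('d P p v)) ->
  (forall v, 'd Q (t p) (imul_pair v) = phi ('d Q (t p) v)) ->
  {for p, continuous t} -> (\near p, P p = Q (t p)) ->
  exists L : {linear ('rV[R]_n * 'rV[R]_n)%type -> ('rV[R]_m * 'rV[R]_m)%type},
    (forall v, L (imul_pair v) = imul_pair (L v)) /\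
    (forall e : R, 0 < e -> \forall h \near (0 : 'rV[R]_n * 'rV[R]_n),
       `|t (h + p) - t p - L h| <= e * `|h|).
Proof.
move=> DP DQ IQ RP RQ iP iQ ct PQ.
have RPQ : range ('d P p) `<=` range ('d Q (t p)) by rewrite RP RQ.
have [K KQ] := linear_left_inverse IQ.
exists (K \o 'd P p); split; first exact: (lift_imul KQ RPQ iP iQ).
exact: (diff_lift (differentiableP DP) (differentiableP DQ) (diff_continuous DP)
  (@linear_mx_continuous _ _ _ _ K) KQ ct PQ).
Qed.

(** In real coordinates the two parametrizations satisfy P = Q o t near the point, where the
    transition t is a priori only continuous; [complex_lift] supplies its complex linear
    differential. *)
Lemma T1_atlas_change c d : T1_atlas I c -> T1_atlas I d -> holomorphic_change c d.
Proof.
move=> [Hc cP] [Hd dP] x cx dx.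
have [odc oic Kc _ _] := Hc; have [odd oid Kd _ _] := Hd.
pose t p := to_real_pair (cmap d (cinv c (of_real_pair p))).
have [p0 p0E] : exists p0, of_real_pair p0 = cmap c x.
  by exists (to_real_pair (cmap c x)); rewrite to_real_pairK.
have tp0 : of_real_pair (t p0) = cmap d x by rewrite to_real_pairK p0E Kc.
have ic : cimg c (of_real_pair p0) by rewrite p0E; exists x.
have id : cimg d (of_real_pair (t p0)) by rewrite tp0; exists x.
have near_p : \forall p \near p0, cimg c (of_real_pair p) /\
    cdom d (cinv c (of_real_pair p)).
  have N := near_cinv Hc cx odd dx.
  have := @of_real_pair_continuous R 7 p0; rewrite /continuous_at p0E.
  by move=> /(_ _ N).
have PQ : \forall p \near p0, parametrization c p = parametrization d (t p).
  apply: filterS near_p => p [_ dp].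
  by rewrite /parametrization /t to_real_pairK Kd.
have PQ0 : parametrization c p0 = parametrization d (t p0).
  exact: nbhs_singleton PQ.
have ct : {for p0, continuous t}.
  apply: continuous_comp; last exact: to_real_pair_continuous.
  apply: (@continuous_comp _ _ _ (fun p => cinv c (of_real_pair p)) (cmap d)).
    apply: continuous_comp; first exact: of_real_pair_continuous.
    by apply: chart_cinv_continuous => //; rewrite p0E; exists x.
  by rewrite p0E Kc//; exact: chart_cmap_continuous.
have [Dc _ Rc Jc] := cP _ ic; have [Dd Id Rd Jd] := dP _ id.
rewrite -PQ0 in Jd Rd.
pose phi a : 'M[R]_16 := 2^-1 *: lie (parametrization c p0) a.
have [L0 [Li LE]] := @complex_lift phi (tangentT1 I (parametrization c p0)) 7 7
  (parametrization c) (parametrization d) t p0 Dc Dd Id Rc Rd Jc Jd ct PQ.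
pose f (z : 'rV[C]_7) : 'rV[C]_7 := of_real_pair (L0 (to_real_pair z)).
have LK : linear f by exact: of_real_pair_linear Li.
pose LM := GRing.isLinear.Build _ _ _ _ _ LK.
pose L : {linear 'rV[C]_7 -> 'rV[C]_7} := HB.pack f LM.
suff : is_diff (cmap c x) (cmap d \o cinv c) L by case.
apply: real_diff_complex => e e0.
apply: filterS (LE _ e0) => h.
by rewrite -p0E -of_real_pairD !to_real_pairB /= of_real_pairK of_real_pairK.
Qed.

End T1Atlas.

Lemma continuous_at_pair (X Y Z : topologicalType) (f : X -> Y) (g : X -> Z) x :
  {for x, continuous f} -> {for x, continuous g} ->
  {for x, continuous (fun y => (f y, g y))}.
Proof.
move=> cf cg U [[A B] /= [nA nB] AB].
have cA : \forall y \near x, A (f y) by exact: cf.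
have cB : \forall y \near x, B (g y) by exact: cg.
have : \forall y \near x, U (f y, g y) by apply: filterS2 cA cB => y Ay By; exact: AB.
exact.
Qed.

Section ComplexVectors.
Context (R : realType).
Local Notation C := (Cplx R).
Local Notation re z := (to_real_pair z).1.
Local Notation im z := (to_real_pair z).2.

Definition bform (z w : 'rV[C]_9) : C := \sum_i z 0 i * w 0 i.

Lemma bformE z w : bform z w =
  ((dot (re z) (re w) - dot (im z) (im w)) +i* (dot (re z) (im w) + dot (im z) (re w)))%C.
Proof.
rewrite /bform /dot -sumrB -big_split /=.
have E (f g : 'I_9 -> R) : ((\sum_i f i) +i* (\sum_i g i))%C = \sum_i (f i +i* g i)%C :> C.
  elim/big_rec3: _ => // i a b c _ <-.
  by apply/eqP; rewrite eq_complex /= !eqxx.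
rewrite E; apply: eq_bigr => i _; rewrite !mxE.
case: (z 0 i) => a b; case: (w 0 i) => c d /=.
exact: erefl.
Qed.

Lemma bform_qform z : bform z z = qform z.
Proof. by apply: eq_bigr => i _; rewrite expr2. Qed.

Lemma bformDr z w w' : bform z (w + w') = bform z w + bform z w'.
Proof. by rewrite /bform -big_split; apply: eq_bigr => i _; rewrite mxE mulrDr. Qed.

Lemma bformZr (l : C) z w : bform z (l *: w) = l * bform z w.
Proof. by rewrite /bform mulr_sumr; apply: eq_bigr => i _; rewrite mxE mulrCA. Qed.

(** The real part of [qform z] is |re z|^2 - |im z|^2 and the imaginary part is twice their dot
    product: isotropic vectors are the same as orthogonal pairs of equal length. *)
Lemma qform0P (z : 'rV[C]_9) : qform z = 0 <->
  dot (im z) (im z) = dot (re z) (re z) /\ dot (re z) (im z) = 0.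
Proof.
rewrite -bform_qform bformE (dotC (im z) (re z)); split.
  move=> /eqP; rewrite eq_complex /= => /andP[/eqP/subr0_eq -> /eqP h].
  by split=> //; lra.
move=> [-> ->]; apply/eqP; rewrite eq_complex /= subrr addr0.
by rewrite !eqxx.
Qed.

Lemma scale_of_real_pair (a b : R) (u v : 'rV[R]_9) :
  (a +i* b)%C *: of_real_pair (u, v) =
  of_real_pair (a *: u - b *: v, b *: u + a *: v) :> 'rV[C]_9.
Proof.
apply/rowP => i; rewrite !mxE /=; apply/eqP; rewrite eq_complex /=.
by rewrite eqxx addrC eqxx.
Qed.

End ComplexVectors.

(** * From T1 to the quadric *)

Section TwistorMap.
Context (R : realType) (I : 'I_9 -> 'M[R]_16).
Hypothesis I_sym : forall a, (I a)^T = I a.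
Hypothesis I_sqr : forall a, I a * I a = 1.
Hypothesis I_anti : forall a b, a != b -> I a * I b = - (I b * I a).
Local Notation C := (Cplx R).
Local Notation M := 'M[R]_16.
Local Notation cl := (clif I).
Local Notation re z := (to_real_pair z).1.
Local Notation im z := (to_real_pair z).2.
Local Notation Q := (quadric R 8).
Implicit Types (z w : 'rV[C]_9) (J a : M).

Definition zframe J z := frame I J (re z) (im z).

Definition twistor z : M := (dot (re z) (re z))^-1 *: (cl (im z) * cl (re z)).

Lemma zframe_scale J (l : C) z : T1 I J -> zframe J z -> zframe J (l *: z).
Proof.
move=> T1J F; rewrite /zframe to_real_pairZ /=.
apply: (frame_lin (frame_scale _ F)); apply: frame_scale.
(* One [frame_rot] is multiplication by -i, so three of them are multiplication by i. *)
by have := frame_rot T1J (frame_rot T1J (frame_rot T1J F)); rewrite opprK.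
Qed.

Lemma zframe_re_neq0 J z : zframe J z -> z != 0 -> re z != 0.
Proof.
move=> F; apply: contra_neq => r0; have v0 : im z = 0.
  apply: (clif_inj I_sqr I_anti); move: F; rewrite /zframe /frame r0 clif0 mulr0.
  by move=> <-.
rewrite -[z]to_real_pairK [to_real_pair z]surjective_pairing r0 v0.
by apply/rowP => i; rewrite !mxE.
Qed.

Lemma zframe_twistor J z : zframe J z -> z != 0 -> J = twistor z.
Proof.
move=> F z0; have u0 := zframe_re_neq0 F z0.
rewrite /twistor (frame_T1E I_sqr I_anti F) scalerA mulVf ?scale1r//.
by rewrite dot_eq0.
Qed.

Lemma zframe_qform J z : T1 I J -> zframe J z -> qform z = 0.
Proof.
move=> T1J F; apply/qform0P; split.
  exact: (frame_norm I_sym I_sqr I_anti T1J F).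
exact: (frame_orth I_sym I_sqr I_anti T1J F).
Qed.

Lemma qform_re_neq0 z : qform z = 0 -> z != 0 -> re z != 0.
Proof.
move=> /qform0P[n0 _]; apply: contra_neq => r0.
have v0 : im z = 0 by apply/eqP; rewrite -dot_eq0 n0 r0 dot_eq0.
rewrite -[z]to_real_pairK [to_real_pair z]surjective_pairing r0 v0.
by apply/rowP => i; rewrite !mxE.
Qed.

Lemma twistorP z : qform z = 0 -> z != 0 -> T1 I (twistor z) /\ zframe (twistor z) z.
Proof.
move=> q0 z0; have u0 := qform_re_neq0 q0 z0; have [nn oo] := (qform0P _).1 q0.
exact: frame_T1.
Qed.

Lemma zframe_unique J z w : T1 I J -> zframe J z -> zframe J w -> z != 0 ->
  exists l : C, w = l *: z.
Proof.
move=> T1J F F' z0; have u0 := zframe_re_neq0 F z0.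
have [p [q [E1 E2]]] := frame_unique I_sym I_sqr I_anti T1J u0 F F'.
exists (p +i* q)%C.
rewrite -[w]to_real_pairK [to_real_pair w]surjective_pairing E1 E2.
by rewrite -[z in RHS]to_real_pairK [to_real_pair z]surjective_pairing
  scale_of_real_pair.
Qed.

Lemma zframe_proj_eq J z w : T1 I J -> zframe J z -> zframe J w ->
  z != 0 -> w != 0 -> proj_pt z = proj_pt w.
Proof.
move=> T1J F F' z0 w0; have [l lE] := zframe_unique T1J F F' z0.
have l0 : l != 0 by apply: contraNneq w0 => l0; rewrite lE l0 scale0r.
by rewrite lE proj_ptZ.
Qed.

(* The commutator [J, I_i] and its image under [J] form a frame, which depends
   continuously on [J]. *)
Definition frame_vec (i : 'I_9) J : 'rV[C]_9 :=
  of_real_pair (unclif I (J * I i - I i * J), unclif I (J * (J * I i - I i * J))).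

Lemma frame_vecP J : T1 I J -> exists i, frame_vec i J != 0.
Proof.
move=> T1J; have [i [u [v [uE F u0]]]] := frame_exists I_sqr I_anti T1J.
exists i; apply: contra_neq u0.
rewrite /frame_vec uE clifK// => /(congr1 (@to_real_pair R 9)).
by rewrite of_real_pairK to_real_pair0 => -[].
Qed.

Lemma frame_vec_zframe i J : T1 I J -> zframe J (frame_vec i J).
Proof.
move=> T1J; have [u [v [uE F]]] := comm_frame I_sqr I_anti T1J (delta_mx 0 i).
rewrite clif_delta in uE.
by rewrite /zframe /frame_vec of_real_pairK /= uE F !clifK.
Qed.

Lemma quadric_qform (p : Proj R 8) : Q p = (qform (hcoord p) = 0).
Proof. by []. Qed.

Lemma quadric_pt z : z != 0 -> Q (proj_pt z) <-> qform z = 0.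
Proof.
move=> z0; rewrite quadric_qform; have [l l0 ->] := hcoord_pt z0.
rewrite qformZ; split=> [/eqP|->]; last by rewrite mulr0.
by rewrite mulf_eq0 expf_eq0 /= (negbTE l0) => /eqP.
Qed.

(** An arbitrary index with no continuity in J; by [to_quadricE] the resulting point of the quadric
    may be computed from any nonzero frame vector. *)
Definition frame_choice (J : T1 I) : {i | frame_vec i (set_val J) != 0} :=
  cid (frame_vecP (set_valP J)).

Lemma frame_choice_quadric (J : T1 I) :
  Q (proj_pt (frame_vec (sval (frame_choice J)) (set_val J))).
Proof.
apply/quadric_pt; first exact: svalP (frame_choice J).
have T1J := set_valP J; exact: zframe_qform T1J (frame_vec_zframe _ T1J).
Qed.

Definition to_quadric (J : T1 I) : Q := SigSub (mem_set (frame_choice_quadric J)).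

Lemma to_quadricE (J : T1 I) z : z != 0 -> zframe (set_val J) z ->
  set_val (to_quadric J) = proj_pt z.
Proof.
move=> z0 F; have T1J := set_valP J.
apply: (zframe_proj_eq T1J) => //; first exact: frame_vec_zframe.
exact: svalP (frame_choice J).
Qed.

Lemma of_quadric_T1 (p : Q) : T1 I (twistor (hcoord (set_val p))).
Proof. by have [] := twistorP (set_valP p) (hcoord_neq0 _). Qed.

Definition of_quadric (p : Q) : T1 I := SigSub (mem_set (of_quadric_T1 p)).

Lemma of_quadricE (p : Q) z : z != 0 -> set_val p = proj_pt z ->
  set_val (of_quadric p) = twistor z.
Proof.
move=> z0 pE; rewrite /of_quadric /=; have Qp := set_valP p.
have [T1J F] := twistorP Qp (hcoord_neq0 (set_val p)).
apply: zframe_twistor => //; have [l l0 E] := hcoord_pt z0.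
have -> : z = l^-1 *: hcoord (set_val p) by rewrite pE E scalerA mulVf ?scale1r.
exact: zframe_scale.
Qed.

Lemma to_quadricK : cancel to_quadric of_quadric.
Proof.
move=> J; have T1J := set_valP J; have [i i0] := frame_vecP T1J.
have F := frame_vec_zframe i T1J; apply: val_inj.
apply: (etrans (of_quadricE i0 (to_quadricE i0 F))).
exact/esym/zframe_twistor.
Qed.

Lemma of_quadricK : cancel of_quadric to_quadric.
Proof.
move=> p; apply: val_inj; have h0 := hcoord_neq0 (set_val p).
have E : set_val p = proj_pt (hcoord (set_val p)) by rewrite hcoordK.
have [T1J F] := twistorP (set_valP p) h0.
by apply: (etrans (to_quadricE (J := of_quadric p) h0 F)); rewrite hcoordK.
Qed.

Lemma unclif_linear : linear (unclif I).
Proof.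
move=> k a b; apply/rowP => i; rewrite !mxE mulrDl -scalerAl mxtraceD mxtraceZ.
by rewrite mulrDl mulrA.
Qed.

Lemma frame_vec_continuous i : continuous (frame_vec i).
Proof.
pose LM := GRing.isLinear.Build _ _ _ _ _ unclif_linear.
pose L : {linear M -> 'rV[R]_9} := HB.pack (unclif I) LM.
have cL : continuous (unclif I) by exact: (@linear_mx_continuous _ _ _ _ L).
have D1 J : differentiable (fun J => J *m I i - I i *m J) J.
  apply: differentiableB.
    by case: (is_diff_mulmx (is_diff_id J) (is_diff_cst (I i) J)).
  by case: (is_diff_mulmx (is_diff_cst (I i) J) (is_diff_id J)).
move=> J; apply: continuous_comp; last exact: of_real_pair_continuous.
apply: continuous_at_pair.
  apply: (@continuous_comp _ _ _ (fun J => J *m I i - I i *m J)); last exact: cL.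
  by apply: differentiable_continuous; exact: D1.
apply: (@continuous_comp _ _ _ (fun J => J *m (J *m I i - I i *m J))); last exact: cL.
apply: differentiable_continuous.
by case: (is_diff_mulmx (is_diff_id J) (differentiableP (D1 J))).
Qed.

(** An index whose [frame_vec] does not vanish at J works in a neighbourhood of J, and there the map
    is [proj_pt] of a continuous vector. *)
Lemma to_quadric_continuous : continuous to_quadric.
Proof.
move=> J; apply: continuous_at_set_val; have [i i0] := frame_vecP (set_valP J).
have ci : {for J, continuous (frame_vec i \o set_val)}.
  apply: continuous_comp; first exact: set_val_continuous.
  exact: frame_vec_continuous.
apply: (@near_eq_continuous _ _ (@proj_pt R 8 \o (frame_vec i \o set_val))).
  have N : \forall z \near frame_vec i (set_val J), z != 0.
    by apply: open_nbhs_nbhs; split=> //; exact: open_neq0.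
  have N' : \forall J' \near J, frame_vec i (set_val J') != 0 by exact: (ci _ N).
  apply: filterS N' => J' J'0; symmetry.
  exact: (to_quadricE J'0 (frame_vec_zframe i (set_valP J'))).
by apply: continuous_comp => //; exact: proj_pt_continuous.
Qed.

End TwistorMap.

(** * Differential of the parametrization of T1 by the quadric *)

Section NumFieldDifferential.
Context (K : numFieldType).

Lemma is_diff_ext (V W : normedModType K) (f g df dg : V -> W) x :
  is_diff x f df -> f =1 g -> df =1 dg -> is_diff x g dg.
Proof. by move=> D /funext <- /funext <-. Qed.

Lemma is_diff_affine (V : normedModType K) (c d : K) (g dg : V -> K) x :
  is_diff x g dg -> is_diff x (fun v => c + d * g v) (fun h => d * dg h).
Proof.
move=> Dg; have D1 : is_diff x (fun v => d * g v) (fun h => d * dg h).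
  apply: (is_diff_ext (is_diff_mulf (is_diff_cst d x) Dg)) => // h.
  by rewrite mul0r add0r.
apply: (is_diff_ext (is_diffD (is_diff_cst c x) D1)) => // h.
by rewrite !fctE add0r.
Qed.

Lemma is_diff_coord n (i : 'I_n) (w : 'rV[K]_n) :
  is_diff w (fun w : 'rV[K]_n => w 0 i) (fun h : 'rV[K]_n => h 0 i).
Proof. by apply: is_diff_entry; exact: is_diff_id. Qed.

(** On the slice b is minus the sum of the squares, so this function is b / 2, the varying part of
    the coordinate (1 + b) / 2 of [qvec]. *)
Lemma is_diff_half_sqr n (w : 'rV[K]_n) :
  is_diff w (fun w : 'rV[K]_n => - (2%:R^-1 * \sum_m w 0 m ^+ 2))
            (fun h => - \sum_m w 0 m * h 0 m).
Proof.
have two : 2%:R != 0 :> K by rewrite pnatr_eq0.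
have D : is_diff w (fun w : 'rV[K]_n => \sum_m w 0 m * w 0 m)
    (fun h => \sum_m (h 0 m * w 0 m + w 0 m * h 0 m)).
  by apply: is_diff_fsum => m; apply: is_diff_mulf; exact: is_diff_coord.
apply: (is_diff_ext (is_diff_affine 0 (- 2%:R^-1) D)) => h.
  by rewrite add0r mulNr; congr (- (_ * _)).
rewrite (eq_bigr (fun m => 2%:R * (w 0 m * h 0 m))); last first.
  by move=> m _; rewrite mulrC mulr_natl mulr2n.
by rewrite -mulr_sumr mulNr mulrA mulVf// mul1r.
Qed.

End NumFieldDifferential.

Section RealDifferential.
Context (R : realType).
Local Notation C := (Cplx R).
Local Notation RP n := ('rV[R]_n * 'rV[R]_n)%type.

(** Restriction of scalars from C to R; again the tolerance e / 2 absorbs the factor lost in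
    [norm_of_real_pair]. *)
Lemma complex_diff_real m n (f : 'rV[C]_m -> 'rV[C]_n)
    (L : {linear 'rV[C]_m -> 'rV[C]_n}) (p : RP m) :
  is_diff (of_real_pair p) f L ->
  is_diff p (fun q => to_real_pair (f (of_real_pair q)))
            (fun h => to_real_pair (L (of_real_pair h))).
Proof.
move=> Df; pose g (h : RP m) : RP n := to_real_pair (L (of_real_pair h)).
have lg : linear g.
  move=> k u v; rewrite /g of_real_pairD linearD to_real_pairD; congr (_ + _).
  have -> : of_real_pair (k *: u) = k%:C%C *: of_real_pair u.
    apply/rowP => j; rewrite !mxE; apply/eqP; rewrite eq_complex /=.
    by rewrite !mul0r subr0 addr0 !eqxx.
  by rewrite linearZ /= to_real_pairZ /= scale0r addr0.
pose gM := GRing.isLinear.Build _ _ _ _ _ lg.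
pose gL : {linear RP m -> RP n} := HB.pack g gM.
have cg : continuous gL.
  move=> h; apply: continuous_comp; last exact: to_real_pair_continuous.
  apply: continuous_comp; first exact: of_real_pair_continuous.
  exact: (@linear_mx_continuous _ _ _ _ L).
apply: (@is_diff_eps _ _ _ _ gL) => // e e0.
have e20 : 0 < (e / 2)%:C%C :> C by rewrite -[0]/(0%:C%C) ltcR divr_gt0.
have H := is_diff_epsP Df e20.
have N := @of_real_pair_continuous R m 0; rewrite /continuous_at in N.
have z0 : of_real_pair (0 : RP m) = 0 by apply/rowP => j; rewrite !mxE.
rewrite z0 in N.
have {N} N : \forall h \near (0 : RP m),
    `|f (of_real_pair h + of_real_pair p) - f (of_real_pair p) - L (of_real_pair h)|
      <= (e / 2)%:C%C * `|of_real_pair h| by exact: N _ H.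
apply: filterS N => h; rewrite -of_real_pairD => Hh.
rewrite /= /g -!to_real_pairB -lecR; apply: le_trans (norm_to_real_pair _) _.
apply: le_trans Hh _; apply: (@le_trans _ _ ((e / 2)%:C%C * (2 * `|h|)%:C%C)).
  by rewrite ler_pM2l//; exact: norm_of_real_pair.
by rewrite -rmorphM lecR /= mulrA divfK// pnatr_eq0.
Qed.

End RealDifferential.

Section QuadricParametrization.
Context (R : realType) (j : 'I_9) (k : 'I_8).
Local Notation C := (Cplx R).
Local Notation RP n := ('rV[R]_n * 'rV[R]_n)%type.
Local Notation re z := (to_real_pair z).1.
Local Notation im z := (to_real_pair z).2.

(* The chart of the quadric inverse to [qmap], and its differential. *)
Definition qpar (w : 'rV[C]_7) : 'rV[C]_9 := qvec j k (row_mx w (0 : 'rV[C]_1)).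

Definition dqb (w h : 'rV[C]_7) : C := \sum_m w 0 m * h 0 m.

Definition dqpar (w h : 'rV[C]_7) : 'rV[C]_9 :=
  \row_i if unlift j i is Some i' then
           if unlift k i' is Some m then h 0 m else - (@ii R * dqb w h)
         else - dqb w h.

Lemma qpar_rest w m : qpar w 0 (qrest j k m) = w 0 m.
Proof. by rewrite qvec_rest row_mxEl. Qed.

Lemma dqpar_rest w h m : dqpar w h 0 (qrest j k m) = h 0 m.
Proof. by rewrite mxE !liftK. Qed.

Lemma dqpar_j w h : dqpar w h 0 j = - dqb w h.
Proof. by rewrite mxE unlift_none. Qed.

Lemma dqpar_k w h : dqpar w h 0 (lift j k) = - (@ii R * dqb w h).
Proof. by rewrite mxE liftK unlift_none. Qed.

Lemma qa_qpar w : qa j k (qpar w) = 1.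
Proof. exact: qa_vec. Qed.

Lemma qpar_neq0 w : qpar w != 0.
Proof.
apply/eqP => E; have := qa_qpar w; rewrite E /qa !mxE mulr0 addr0 => /esym/eqP.
by rewrite oner_eq0.
Qed.

Lemma qform_qpar w : qform (qpar w) = 0.
Proof. by rewrite qform_vec row_mxEr mxE. Qed.

Lemma qa_dqpar w h : qa j k (dqpar w h) = 0.
Proof. by rewrite /qa dqpar_j dqpar_k mulrN mulrA ii_sqr mulN1r opprK addNr. Qed.

Lemma bform_split (z z' : 'rV[C]_9) : bform z z' = z 0 j * z' 0 j +
  z 0 (lift j k) * z' 0 (lift j k) + \sum_m z 0 (qrest j k m) * z' 0 (qrest j k m).
Proof. by rewrite /bform (bigD1_ord j)//= (bigD1_ord k)//= addrA. Qed.

Lemma bform_dqpar w h : bform (qpar w) (dqpar w h) = 0.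
Proof.
rewrite bform_split dqpar_j dqpar_k (eq_bigr (fun m => w 0 m * h 0 m)); last first.
  by move=> m _; rewrite qpar_rest dqpar_rest.
rewrite -/(dqb w h) !mulrN mulrA [_ * ii _]mulrC -opprD -mulrDl -/(qa j k _) qa_qpar.
by rewrite mul1r addNr.
Qed.

(** The two conditions are the derivatives of the normalization [qa = 1] and of the equation of the
    quadric. They determine the two special coordinates from the seven others, which are free. *)
Lemma dqpar_surj w z : qa j k z = 0 -> bform (qpar w) z = 0 ->
  exists h, dqpar w h = z.
Proof.
move=> az bz; pose h : 'rV[C]_7 := \row_m z 0 (qrest j k m).
have zk : z 0 (lift j k) = @ii R * z 0 j.
  move/eqP: az; rewrite /qa addr_eq0 => /eqP ->.
  by rewrite mulrN mulrA ii_sqr mulN1r opprK.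
have bh : dqb w h = - z 0 j.
  apply/eqP; rewrite -addr_eq0 addrC -bz bform_split zk.
  rewrite mulrA [_ * ii _]mulrC -mulrDl -/(qa j k _) qa_qpar mul1r.
  by apply/eqP; congr (_ + _); apply: eq_bigr => m _; rewrite qpar_rest !mxE.
exists h; apply/rowP => i; case: (unliftP j i) => [i' ->|->]; last first.
  by rewrite dqpar_j bh opprK.
case: (unliftP k i') => [m ->|->].
  by rewrite -/(qrest j k m) dqpar_rest mxE.
by rewrite dqpar_k bh mulrN opprK zk.
Qed.

Lemma is_diff_qpar w : is_diff w qpar (dqpar w).
Proof.
apply: is_diff_mx => i0 i; rewrite {i0}ord1.
have qbE v : qb (row_mx v (0 : 'rV[C]_1)) = - \sum_m v 0 m ^+ 2.
  rewrite /qb row_mxEr mxE sub0r; congr (- _); apply: eq_bigr => m _.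
  by rewrite row_mxEl.
have D : is_diff w _ _ := is_diff_half_sqr w.
case: (unliftP j i) => [i' ->|->]; last first.
  apply: (is_diff_ext (is_diff_affine 2%:R^-1 1 D)) => v; last first.
    by rewrite dqpar_j mul1r.
  by rewrite /qpar qvec_j qbE mul1r mulrDl mul1r mulNr mulrC.
case: (unliftP k i') => [m ->|->].
  apply: (is_diff_ext (is_diff_coord m w)) => v; rewrite -/(qrest j k m).
    by rewrite qpar_rest.
  by rewrite dqpar_rest.
apply: (is_diff_ext (is_diff_affine (- (@ii R / 2%:R)) (@ii R) D)) => v; last first.
  by rewrite dqpar_k mulrN.
rewrite /qpar qvec_k qbE -[RHS]mulrA mulrBl mul1r mulrBr [RHS]addrC.
by congr (_ + _ * _); rewrite mulNr mulrC.
Qed.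

Lemma dqpar_linear w : linear (dqpar w).
Proof.
have lb : forall (a : C) u v, dqb w (a *: u + v) = a * dqb w u + dqb w v.
  move=> a u v; rewrite /dqb mulr_sumr -big_split; apply: eq_bigr => m _.
  by rewrite !mxE mulrDr mulrCA.
move=> a u v; apply/rowP => i; rewrite !mxE.
case: unlift => [i'|]; last by rewrite lb opprD mulrN.
case: unlift => [m|]; first by rewrite !mxE.
by rewrite lb mulrDr opprD mulrCA mulrN.
Qed.

End QuadricParametrization.

Lemma is_diff_uniq (K : numFieldType) (V W : normedModType K) (f df dg : V -> W) x :
  is_diff x f df -> is_diff x f dg -> df = dg.
Proof. by move=> [_ <-] [_ <-]. Qed.

Lemma is_diff_linear (K : numFieldType) (V W : normedModType K) (L : {linear V -> W}) x :
  continuous L -> is_diff x L L.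
Proof. by move=> cL; apply: DiffDef; [exact: linear_differentiable|rewrite diff_lin]. Qed.

Section PairProjections.
Context (K : numFieldType) (V U W : normedModType K).
Implicit Types (f df : V -> U * W).

Lemma is_diff_fst f df x : is_diff x f df -> is_diff x (fun v => (f v).1) (fun v => (df v).1).
Proof.
move=> Df; pose L : {linear (U * W)%type -> U} := fst.
have cL : continuous L by move=> y; exact: cvg_fst.
exact: (is_diff_comp Df (is_diff_linear (f x) cL)).
Qed.

Lemma is_diff_snd f df x : is_diff x f df -> is_diff x (fun v => (f v).2) (fun v => (df v).2).
Proof.
move=> Df; pose L : {linear (U * W)%type -> W} := snd.
have cL : continuous L by move=> y; exact: cvg_snd.
exact: (is_diff_comp Df (is_diff_linear (f x) cL)).
Qed.

End PairProjections.

Section TwistorDifferential.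
Context (R : realType) (I : 'I_9 -> 'M[R]_16).
Hypothesis I_sym : forall a, (I a)^T = I a.
Hypothesis I_sqr : forall a, I a * I a = 1.
Hypothesis I_anti : forall a b, a != b -> I a * I b = - (I b * I a).
Local Notation C := (Cplx R).
Local Notation M := 'M[R]_16.
Local Notation cl := (clif I).
Local Notation re z := (to_real_pair z).1.
Local Notation im z := (to_real_pair z).2.
Local Notation RP n := ('rV[R]_n * 'rV[R]_n)%type.

Lemma is_diff_clif (V : normedModType R) (f df : V -> 'rV[R]_9) x :
  is_diff x f df -> is_diff x (fun v => cl (f v)) (fun v => cl (df v)).
Proof.
move=> Df; have lc : linear cl by move=> k u v; rewrite clifD clifZ.
pose LM := GRing.isLinear.Build _ _ _ _ _ lc.
pose L : {linear 'rV[R]_9 -> M} := HB.pack cl LM.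
have cL : continuous L by exact: linear_mx_continuous.
exact: (is_diff_comp Df (is_diff_linear (f x) cL)).
Qed.

Lemma is_diff_dot (V : normedModType R) (f df g dg : V -> 'rV[R]_9) x :
  is_diff x f df -> is_diff x g dg ->
  is_diff x (fun v => dot (f v) (g v)) (fun v => dot (df v) (g x) + dot (f x) (dg v)).
Proof.
move=> Df Dg; have D i := is_diff_mulf (is_diff_entry 0 i Df) (is_diff_entry 0 i Dg).
by apply: (is_diff_ext (is_diff_fsum D)) => v //; rewrite big_split.
Qed.

(** The relation for [a] amounts to the derivative of |u|^2 J = v u, namely |u|^2 a = v' u + v u' -
    2 (u', u) J. The condition on dot products cancels the scalar part of v' u + v u', which is then
    half a sum of commutators. *)
Lemma Lin2_frame_tangent J u v u' v' a : T1 I J -> u != 0 -> frame I J u v ->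
  a * cl u + J * cl u' = cl v' -> dot u v' + dot v u' = 0 -> Lin2 I a.
Proof.
move=> T1J u0 F aU uv; have r0 : dot u u != 0 by rewrite dot_eq0.
have E : dot u u *: a = cl v' * cl u + cl v * cl u' - (2 * dot u' u) *: J.
  have -> : dot u u *: a = (cl v' - J * cl u') * cl u.
    by rewrite -aU addrK -mulrA clif_sqr// mulr_algr.
  have -> : cl v = J * cl u by rewrite F.
  rewrite mulrBl -!mulrA -addrA; congr (_ + _).
  have -> : cl u' * cl u = (2 * dot u' u)%:A - cl u * cl u'.
    by rewrite -(clifC I_sqr I_anti) addrK.
  by rewrite mulrBr mulr_algr opprB.
have -> : a = (dot u u)^-1 *: (dot u u *: a) by rewrite scalerA mulVf// scale1r.
apply: Lin2_Z; rewrite E; apply: Lin2_D; last exact/Lin2_N/Lin2_Z/(T1_Lin2 T1J).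
have -> : cl v' * cl u + cl v * cl u' =
    2^-1 *: ((cl v' * cl u - cl u * cl v') + (cl v * cl u' - cl u' * cl v)).
  rewrite -[LHS]scale_halfK; congr (_ *: _).
  have -> : cl u * cl v' = (2 * dot u v')%:A - cl v' * cl u.
    by rewrite -(clifC I_sqr I_anti) addrK.
  have -> : cl u' * cl v = (2 * dot v u')%:A - cl v * cl u'.
    by rewrite -(clifC I_sqr I_anti) [_ + cl u' * _]addrC addrK.
  have aux (X Y A B : M) : B = - A ->
      X + Y + (X + Y) = X - (A - X) + (Y - (B - Y)).
    by move=> ->; apply/matrixP => s t; rewrite !mxE; ring.
  apply: aux; rewrite -scaleNr; congr (_ *: _); lra.
by apply/Lin2_Z/Lin2_D; exact: Lin2_comm.
Qed.

Section AtPoint.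
Context (j : 'I_9) (k : 'I_8) (p : RP 7).

Definition twistor_par (q : RP 7) : M := twistor I (qpar j k (of_real_pair q)).

Local Notation u q := (re (qpar j k (of_real_pair q))).
Local Notation v q := (im (qpar j k (of_real_pair q))).
Local Notation dz h := (dqpar j k (of_real_pair p) (of_real_pair h)).
Local Notation J := (twistor_par p).

Lemma twistor_parP (q : RP 7) : T1 I (twistor_par q) /\ zframe I (twistor_par q) (qpar j k (of_real_pair q)).
Proof. by apply: twistorP => //; [exact: qform_qpar|exact: qpar_neq0]. Qed.

Lemma is_diff_par : is_diff p (fun q => to_real_pair (qpar j k (of_real_pair q)))
  (fun h => to_real_pair (dz h)).
Proof.
pose LM := GRing.isLinear.Build _ _ _ _ _ (dqpar_linear j k (of_real_pair p)).
pose L : {linear 'rV[C]_7 -> 'rV[C]_9} := HB.pack (dqpar j k (of_real_pair p)) LM.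
apply: (@complex_diff_real _ _ _ (qpar j k) L).
exact: is_diff_qpar.
Qed.

Lemma is_diff_u : is_diff p (fun q => u q) (fun h => re (dz h)).
Proof. exact: is_diff_fst is_diff_par. Qed.

Lemma is_diff_v : is_diff p (fun q => v q) (fun h => im (dz h)).
Proof. exact: is_diff_snd is_diff_par. Qed.

Lemma par_u_neq0 (q : RP 7) : u q != 0.
Proof. by apply: qform_re_neq0; [exact: qform_qpar|exact: qpar_neq0]. Qed.

Lemma twistor_par_differentiable : differentiable twistor_par p.
Proof.
have D1 := is_diff_dot is_diff_u is_diff_u.
have D2 := is_diff_inv D1 (etrans (congr1 negb (dot_eq0 (u p))) (par_u_neq0 p)).
have D3 := is_diff_mulmx (is_diff_clif is_diff_v) (is_diff_clif is_diff_u).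
by case: (is_diff_scale D2 D3).
Qed.

Local Notation dJ h := ('d twistor_par p h).

(** Both sides of J u = v are the same function of q, so their differentials agree by uniqueness and
    the derivative of [twistor] is never expanded. *)
Lemma twistor_par_dframe h : dJ h * cl (u p) + J * cl (re (dz h)) = cl (im (dz h)).
Proof.
have D1 := is_diff_mulmx (differentiableP twistor_par_differentiable)
  (is_diff_clif is_diff_u).
have D2 := is_diff_clif is_diff_v.
have E : (fun q => twistor_par q *m cl (u q)) = (fun q => cl (v q)).
  by apply/funext => q; have [_] := twistor_parP q.
rewrite E in D1; have := is_diff_uniq D1 D2.
by move=> /(congr1 (fun f => f h)).
Qed.

Lemma twistor_par_danti h : J * dJ h = - (dJ h * J).
Proof.
have D := differentiableP twistor_par_differentiable.
have D1 := is_diff_mulmx D D; have D2 := is_diff_cst (-1 : M) p.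
have E : (fun q => twistor_par q *m twistor_par q) = cst (-1 : M).
  by apply/funext => q; have [T1J _] := twistor_parP q; exact: T1_sqr T1J.
rewrite E in D1; have := is_diff_uniq D1 D2.
move=> /(congr1 (fun f => f h)) /eqP; rewrite addrC.
by rewrite addr_eq0 => /eqP.
Qed.

Lemma twistor_par_dcone h :
  dot (u p) (re (dz h)) = dot (v p) (im (dz h)) /\
  dot (u p) (im (dz h)) + dot (v p) (re (dz h)) = 0.
Proof.
have := bform_dqpar j k (of_real_pair p) (of_real_pair h).
by rewrite bformE => /eqP; rewrite eq_complex /= => /andP[/eqP/subr0_eq ? /eqP].
Qed.

Lemma twistor_par_tangent h : tangentT1 I J (dJ h).
Proof.
have [T1J F] := twistor_parP p.
apply/(lie_tangent _ T1J); split; last exact: twistor_par_danti.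
have [_ c2] := twistor_par_dcone h.
exact: (Lin2_frame_tangent T1J (par_u_neq0 p) F (twistor_par_dframe h) c2).
Qed.

Lemma dz_imul h : dz (imul_pair h) = of_real_pair (imul_pair (to_real_pair (dz h))).
Proof.
pose LM := GRing.isLinear.Build _ _ _ _ _ (dqpar_linear j k (of_real_pair p)).
pose L : {linear 'rV[C]_7 -> 'rV[C]_9} := HB.pack (dqpar j k (of_real_pair p)) LM.
have E n (q : RP n) : of_real_pair (imul_pair q) = @ii R *: of_real_pair q.
  apply/rowP => i; rewrite !mxE; apply/eqP; rewrite eq_complex /=.
  by rewrite !mul0r !mul1r sub0r add0r !eqxx.
by rewrite !E -[LHS]/(L _) linearZ /= to_real_pairK.
Qed.

(** Since dJ anticommutes with J, half the commutator is J dJ. Multiplying the velocity of z by i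
    gives the second hypothesis of [frame_tangent_imul]. *)
Lemma twistor_par_imul h : dJ (imul_pair h) = 2^-1 *: lie J (dJ h).
Proof.
have [T1J F] := twistor_parP p.
have JJ := T1_sqr T1J.
rewrite /lie twistor_par_danti -opprD scalerN scale_halfK -twistor_par_danti.
have r0 : dot (u p) (u p) != 0 by rewrite dot_eq0 par_u_neq0.
apply: (frame_tangent_imul r0 JJ (clif_sqr I_sqr I_anti _) (twistor_par_dframe h)).
have := twistor_par_dframe (imul_pair h).
by rewrite dz_imul of_real_pairK /= clifN mulrN.
Qed.

(** If dJ vanishes on h, the velocity dz is itself a frame of J, hence a multiple l z. As [qa] is
    constantly 1 along the parametrization, [qa] of dz is 0, so l = 0. *)
Lemma twistor_par_inj : injective ('d twistor_par p).
Proof.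
have [T1J F] := twistor_parP p.
move=> h1 h2 E; apply/eqP; rewrite -subr_eq0; apply/eqP.
have dJ0 : dJ (h1 - h2) = 0 by rewrite linearB E subrr.
set h := h1 - h2 in dJ0 *.
have := twistor_par_dframe h; rewrite dJ0 mul0r add0r => F'.
have [l lE] := zframe_unique I_sym I_sqr I_anti T1J F F' (qpar_neq0 _ _ _).
have l0 : l = 0.
  have := qa_dqpar j k (of_real_pair p) (of_real_pair h).
  by rewrite lE qaZ qa_qpar mulr1.
have hz : dz h = 0 by rewrite lE l0 scale0r.
rewrite -[h]of_real_pairK -(to_real_pair0 _ 7); congr to_real_pair.
by apply/rowP => m; rewrite -(dqpar_rest j k (of_real_pair p)) hz !mxE.
Qed.

(** The lift of [a] from [frame_tangent_lift] is a velocity z0 = u' + i v' of z; it is tangent to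
    the isotropic cone because u' and v' are orthogonal to u and v. *)
Lemma twistor_par_surj a : tangentT1 I J a -> exists h, dJ h = a.
Proof.
have [T1J F] := twistor_parP p; move=> /(lie_tangent _ T1J)[La Ja].
have JJ := T1_sqr T1J; have UJ := frame_mulr I_sym I_sqr I_anti T1J F.
have r0 : dot (u p) (u p) != 0 by rewrite dot_eq0 par_u_neq0.
have UU := clif_sqr I_sqr I_anti (u p).
have [aU UU' VV' VU' UV'] := frame_tangent_lift JJ F UJ UU Ja.
have [y2 y2E] := comm_Lin2 I_sqr I_anti La (u p).
have [y1 y1E] := comm_Lin2 I_sqr I_anti La (v p).
have u'E : - (2^-1 *: (a * cl (v p) - cl (v p) * a)) = cl (- (2^-1 *: y1)).
  by rewrite y1E clifN clifZ.
have v'E : 2^-1 *: (a * cl (u p) - cl (u p) * a) = cl (2^-1 *: y2).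
  by rewrite y2E clifZ.
rewrite u'E v'E in aU UU' VV' VU' UV'.
set u' := - (2^-1 *: y1) in aU UU' VV' VU' UV'.
set v' := 2^-1 *: y2 in aU UU' VV' VU' UV'.
have orth x y : cl x * cl y + cl y * cl x = 0 -> dot x y = 0.
  by move=> h; rewrite (@dot_of_clif _ I I_sqr I_anti x y 0) ?mul0r// scale0r.
pose z0 : 'rV[C]_9 := of_real_pair (u', v').
pose w := of_real_pair p; pose z := qpar j k w.
have bz0 : bform z z0 = 0.
  rewrite bformE of_real_pairK /= [dot (re z) _]dotC [dot (im z) _]dotC.
  rewrite [dot (re z) _]dotC [dot (im z) u']dotC !orth// subr0 addr0.
  by [].
(* z0 need not preserve [qa = 1]. Subtracting this multiple of z corrects it without changing the
   velocity of J, because a multiple of z is again a frame of J. *)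
pose z1 := z0 - qa j k z0 *: z.
have qaB (x y : 'rV[C]_9) : qa j k (x - y) = qa j k x - qa j k y.
  by rewrite /qa !mxE mulrBr opprD addrACA.
have az1 : qa j k z1 = 0 by rewrite /z1 qaB qaZ qa_qpar mulr1 subrr.
have bz1 : bform z z1 = 0.
  by rewrite /z1 -scaleNr bformDr bformZr bform_qform qform_qpar mulr0 addr0.
have [h' hE] := dqpar_surj az1 bz1; exists (to_real_pair h').
apply/eqP; rewrite -subr_eq0; apply/eqP; apply: (unit_of_sqr r0 UU).
have := twistor_par_dframe (to_real_pair h'); rewrite to_real_pairK -/w hE.
have Fz : zframe I J (qa j k z0 *: z) by exact: zframe_scale T1J F.
have tz1 : to_real_pair z1 = (u', v') - to_real_pair (qa j k z0 *: z).
  by rewrite to_real_pairB of_real_pairK.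
have re1 : re z1 = u' - re (qa j k z0 *: z) by rewrite tz1.
have im1 : im z1 = v' - im (qa j k z0 *: z) by rewrite tz1.
rewrite re1 im1 !clifB mulrBr Fz -aU => Eh.
rewrite mulrBl; apply/eqP; rewrite subr_eq0; apply/eqP.
apply: (addIr (J * cl u' - cl (im (qa j k z0 *: z)))).
by rewrite Eh addrA.
Qed.

End AtPoint.

End TwistorDifferential.

(** * Transport of charts and the biholomorphism with the quadric *)

Section Transport.
Context (R : realType) (X Y : topologicalType) (n : nat).
Context (f : X -> Y) (g : Y -> X).
Hypotheses (fc : continuous f) (gc : continuous g) (fK : cancel f g) (gK : cancel g f).

Definition transport_chart (c : chart R Y n) : chart R X n :=
  Chart (f @^-1` cdom c) (cmap c \o f) (g \o cinv c).

Lemma transport_cimg c : cimg (transport_chart c) = cimg c.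
Proof.
apply/seteqP; split=> w [x cx <-]; first by exists (f x).
by exists (g x); rewrite /= gK.
Qed.

Lemma transport_is_chart c : is_chart c -> is_chart (transport_chart c).
Proof.
move=> Hc; have [od oi K _ _] := Hc; split.
- by have /continuousP := fc; apply.
- by rewrite transport_cimg.
- by move=> x cx /=; rewrite K.
- apply: within_open_continuous => x cx.
  by apply: continuous_comp; [exact: fc|exact: chart_cmap_continuous].
- rewrite transport_cimg; apply: within_open_continuous => w cw.
  by apply: continuous_comp; [exact: chart_cinv_continuous|exact: gc].
Qed.

End Transport.

Section Biholomorphism.
Context (R : realType) (X Y : topologicalType) (n : nat).
Context (f : X -> Y) (g : Y -> X) (A : set (chart R X n)) (B B0 : set (chart R Y n)).
Hypotheses (fc : continuous f) (gc : continuous g) (fK : cancel f g) (gK : cancel g f).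
Hypotheses (A_chart : forall c, A c -> is_chart c)
  (A_change : forall c d, A c -> A d -> holomorphic_change c d).
Hypotheses (B_chart : forall c, B c -> is_chart c)
  (B_change : forall c d, B c -> B d -> holomorphic_change c d).
Hypotheses (B0B : B0 `<=` B) (B0_cover : forall y, exists2 c, B0 c & cdom c y)
  (AB : forall c, B0 c -> A (transport_chart f g c)).

(** Against a reference chart and its transport, f is the identity in coordinates; any other charts
    differ from these by holomorphic changes. *)
Lemma biholomorphic_transport : biholomorphic A B f.
Proof.
have [fP gP] : holomorphic A B f /\ holomorphic B A g.
  split; split=> // c d x Ac Bd cx dx.
  - have [b B0b bx] := B0_cover (f x); have At := AB B0b.
    have Bb := B0B B0b; have [_ _ Kb _ _] := B_chart Bb.
    have [odt _ _ _ _] := A_chart At.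
    have D1 := A_change Ac At cx bx.
    have D2 := B_change Bb Bd bx dx.
    apply: (@differentiable_near _ _ _
      ((cmap d \o cinv b) \o (cmap (transport_chart f g b) \o cinv c))).
      have := near_cinv (A_chart Ac) cx odt bx; apply: filterS => w [_ bw].
      by rewrite /= Kb.
    apply: (differentiable_comp D1).
    have -> : (cmap (transport_chart f g b) \o cinv c) (cmap c x) = cmap b (f x).
      by have [_ _ Kc _ _] := A_chart Ac; congr (cmap b (f _)); exact: Kc.
    exact: D2.
  - have [b B0b bx] := B0_cover x; have At := AB B0b.
    have Bb := B0B B0b; have [odb _ Kb _ _] := B_chart Bb.
    have tx : cdom (transport_chart f g b) (g x) by rewrite /= gK.
    have D1 := B_change Ac Bb cx bx.
    have D2 := A_change At Bd tx dx.
    apply: (@differentiable_near _ _ _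
      ((cmap d \o cinv (transport_chart f g b)) \o (cmap b \o cinv c))).
      have := near_cinv (B_chart Ac) cx odb bx; apply: filterS => w [_ bw].
      by rewrite /= Kb.
    apply: (differentiable_comp D1).
    have -> : (cmap b \o cinv c) (cmap c x) = cmap (transport_chart f g b) (g x).
      have [_ _ Kc _ _] := B_chart Ac.
      have -> : cmap (transport_chart f g b) (g x) = cmap b x by rewrite /= gK.
      by congr (cmap b _); exact: Kc.
    exact: D2.
by split=> //; exists g.
Qed.

End Biholomorphism.

Section TwistorQuadric.
Context (R : realType) (I : 'I_9 -> 'M[R]_16).
Hypothesis I_sym : forall a, (I a)^T = I a.
Hypothesis I_sqr : forall a, I a * I a = 1.
Hypothesis I_anti : forall a b, a != b -> I a * I b = - (I b * I a).
Local Notation C := (Cplx R).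
Local Notation Q := (quadric R 8).
Local Notation A1 := (T1_atlas I).
Local Notation AQ := (submanifold_atlas 7 1 (proj_atlas R 8) Q).
Local Notation toQ := (to_quadric I_sym I_sqr I_anti).
Local Notation ofQ := (of_quadric I_sqr I_anti).

Lemma quadric_complex_atlas : complex_atlas AQ.
Proof.
apply: submanifold_complex_atlas; first exact: proj_atlas_chart.
  exact: proj_atlas_cover.
exact: quadric_submanifold.
Qed.

(** Submanifold charts whose inverse is prescribed on all of C^7. With this, the parametrization of
    the transported chart equals [twistor_par] as a function, not merely near a point. *)
Definition quadric_ref : set (chart R Q 7) :=
  [set c | AQ c /\ exists j k, [/\ cdom c = set_val @^-1` cdom (quadric_chart R j k),
     forall w, cimg c w & forall w, set_val (cinv c w) = proj_pt (qpar j k w)]].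

Lemma quadric_ref_cover y : exists2 c, quadric_ref c & cdom c y.
Proof.
have [j [k jk]] := quadric_chart_cover (set_val y).
have Ad := quadric_adapted R j k.
pose d := quadric_chart R j k.
have Sq w : Q (proj_pt (qpar j k w)).
  by apply/quadric_pt; [exact: qpar_neq0|exact: qform_qpar].
pose c : chart R Q 7 := Chart (set_val @^-1` cdom d)
  (fun x : Q => lsubmx (cmap d (set_val x) : 'rV[C]_(7 + 1)))
  (fun w => SigSub (mem_set (Sq w))).
have cK x : cdom c x -> cinv c (cmap c x) = x.
  move=> cx; apply: val_inj; rewrite /= /qpar.
  have E : row_mx (lsubmx (cmap d (set_val x) : 'rV[C]_(7 + 1))) 0 = cmap d (set_val x).
    by rewrite -((Ad.2 _ cx).1 (set_valP x)) hsubmxK.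
  rewrite E; have [_ _ K _ _] := proj_chart_is_chart (quadric_proj_chart R j k).
  exact: K.
have AQc : AQ c by exists d.
exists c => //; split=> //; exists j, k; split=> // w.
have dw : cdom c (cinv c w).
  apply/(proj_chart_dom (quadric_proj_chart R j k) (qpar_neq0 _ _ _)) => /=.
  by rewrite qa_qpar oner_neq0.
exists (cinv c w) => //.
transitivity (lsubmx (cmap d (proj_pt (qpar j k w)) : 'rV[C]_(7 + 1))); first by [].
rewrite (proj_chart_map (quadric_proj_chart R j k) (qpar_neq0 _ _ _)).
by rewrite /qpar qmap_vec row_mxKl.
Qed.

Lemma ofQ_continuous : continuous ofQ.
Proof.
move=> y; have [c [AQc [j [k [dc ic gc]]]] cy] := quadric_ref_cover y.
have [Hchart _ _] := quadric_complex_atlas; have Hc := Hchart _ AQc.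
have [odc _ Kc _ _] := Hc.
apply: continuous_at_set_val.
apply: (@near_eq_continuous _ _
  ((twistor_par I j k \o @to_real_pair R 7) \o cmap c)).
  have N : \forall x \near y, cdom c x by exact: open_nbhs_nbhs.
  apply: filterS N => x cx; symmetry.
  rewrite /= /twistor_par to_real_pairK.
  apply: (of_quadricE I_sqr I_anti); first exact: qpar_neq0.
  by rewrite -gc Kc.
apply: continuous_comp; first exact: chart_cmap_continuous.
apply: continuous_comp; first exact: to_real_pair_continuous.
exact/differentiable_continuous/twistor_par_differentiable.
Qed.

Lemma transport_T1 c : quadric_ref c -> A1 (transport_chart toQ ofQ c).
Proof.
move=> [AQc [j [k [dc ic gc]]]].
have [Hchart _ _] := quadric_complex_atlas; have Hc := Hchart _ AQc.
split.
  apply: transport_is_chart => //.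
  - exact: to_quadric_continuous.
  - exact: ofQ_continuous.
  - exact: to_quadricK.
  - exact: of_quadricK.
have E : parametrization (transport_chart toQ ofQ c) = twistor_par I j k.
  apply/funext => p; apply: (of_quadricE I_sqr I_anti (qpar_neq0 _ _ _)).
  exact: gc.
rewrite E => p _ psi; rewrite /psi; split.
- exact: twistor_par_differentiable.
- exact: twistor_par_inj.
- apply/seteqP; split=> [a [h _ <-]|a Ta].
    exact: twistor_par_tangent.
  by have [h hE] := twistor_par_surj I_sym I_sqr I_anti Ta; exists h.
- by move=> h; apply: twistor_par_imul.
Qed.

Lemma T1_complex_atlas : complex_atlas A1.
Proof.
split.
- exact: T1_atlas_is_chart.
- move=> x; have [c Rc cx] := quadric_ref_cover (toQ x).
  by exists (transport_chart toQ ofQ c) => //; exact: transport_T1.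
- exact: T1_atlas_change.
Qed.

Lemma T1_complex_manifold : complex_manifold A1.
Proof.
split.
- apply: (@hausdorff_inj _ _ set_val); last exact: norm_hausdorff.
    exact: set_val_continuous.
  exact: val_inj.
- exact/second_countable_set/second_countable_mx.
- exact: T1_complex_atlas.
Qed.

(** The separation and countability axioms are immediate for [T1], a subspace of a matrix space, and
    pass to the quadric through the homeomorphism; projective space itself is not examined for
    them. *)
Lemma quadric_complex_manifold : complex_manifold AQ.
Proof.
have [hT sT _] := T1_complex_manifold; split.
- apply: (hausdorff_inj ofQ_continuous _ hT).
  exact: can_inj (of_quadricK I_sym I_sqr I_anti).
- apply: (@second_countable_homeo _ _ toQ ofQ) => //.
  + exact: to_quadric_continuous.
  + exact: ofQ_continuous.
  + exact: of_quadricK.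
- exact: quadric_complex_atlas.
Qed.

Lemma toQ_biholomorphic : biholomorphic A1 AQ toQ.
Proof.
have [HQ _ CQ] := quadric_complex_atlas.
apply: (@biholomorphic_transport _ _ _ _ toQ ofQ A1 AQ quadric_ref) => //.
- exact: to_quadric_continuous.
- exact: ofQ_continuous.
- exact: to_quadricK.
- exact: of_quadricK.
- exact: T1_atlas_is_chart.
- exact: T1_atlas_change.
- by move=> c [].
- exact: quadric_ref_cover.
- exact: transport_T1.
Qed.

End TwistorQuadric.

(** * The action of Spin(9) *)

Section SpinAlgebra.
Context (R : realType) (I : 'I_9 -> 'M[R]_16).
Hypothesis I_sym : forall a, (I a)^T = I a.
Hypothesis I_sqr : forall a, I a * I a = 1.
Hypothesis I_anti : forall a b, a != b -> I a * I b = - (I b * I a).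
Local Notation M := 'M[R]_16.
Local Notation V9 := ('rV[R]_9).
Local Notation cl := (clif I).
Local Notation e i := (delta_mx 0 i : V9).
Implicit Types (g h : M) (n u v w x y : V9) (s : seq V9).

Lemma clif_unit_sqr n : unit_vector n -> cl n * cl n = 1.
Proof. by rewrite unit_vectorE (clif_sqr I_sqr I_anti) => ->; rewrite scale1r. Qed.

Lemma spin_tr s : (forall v, v \in s -> unit_vector v) ->
  let g := \prod_(v <- s) cl v in g * g^T = 1 /\ g^T * g = 1.
Proof.
elim: s => [|v s IH] Us /=; first by rewrite !big_nil trmx1 mulr1.
have [] := IH _; first by move=> w ws; apply: Us; rewrite inE ws orbT.
have vv : cl v * cl v = 1 by apply: clif_unit_sqr; apply: Us; rewrite inE eqxx.
rewrite big_cons; set g := \prod_(w <- s) _ => g1 g2.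
rewrite [(cl v * g)^T]trmx_mul tr_clif// -[g^T *m cl v]/(g^T * cl v); split.
  by rewrite mulrA -(mulrA (cl v)) g1 mulr1.
by rewrite mulrA -(mulrA g^T) vv mulr1.
Qed.

Lemma Spin9_tr g : Spin9 I g -> g * g^T = 1 /\ g^T * g = 1.
Proof. by move=> [s [_ Us ->]]; exact: spin_tr. Qed.

Lemma Spin9_unit g : Spin9 I g -> g \is a GRing.unit.
Proof. by move=> /Spin9_tr[g1 g2]; apply/unitrP; exists g^T. Qed.

Lemma Spin9_inv g : Spin9 I g -> g^-1 = g^T.
Proof.
move=> Sg; have [g1 _] := Spin9_tr Sg.
by rewrite -[LHS]mulr1 -g1 mulKr// Spin9_unit.
Qed.

Lemma Spin9_1 : Spin9 I 1.
Proof. by exists [::]; split=> //; rewrite big_nil. Qed.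

Lemma Spin9_mul g h : Spin9 I g -> Spin9 I h -> Spin9 I (g * h).
Proof.
move=> [s [os Us ->]] [t [ot Ut ->]]; exists (s ++ t); split.
- by rewrite size_cat oddD (negbTE os) (negbTE ot).
- by move=> v; rewrite mem_cat => /orP[/Us|/Ut].
- by rewrite big_cat.
Qed.

Lemma Spin9_V g : Spin9 I g -> Spin9 I g^-1.
Proof.
move=> Sg; rewrite (Spin9_inv Sg); case: Sg => s [os Us ->].
exists (rev s); split; first by rewrite size_rev.
  by move=> v; rewrite mem_rev => /Us.
elim: s {os Us} => [|v s IH]; first by rewrite !big_nil trmx1.
rewrite big_cons rev_cons -cats1 big_cat big_seq1 -IH.
by rewrite [(_ * _)^T]trmx_mul tr_clif.
Qed.

Lemma Spin9_pair x y : unit_vector x -> unit_vector y -> Spin9 I (cl x * cl y).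
Proof.
move=> Ux Uy; exists [:: x; y]; split=> //; last by rewrite big_cons big_seq1.
by move=> v; rewrite !inE => /orP[] /eqP ->.
Qed.

(** Fixes n and is -1 on its orthogonal complement: the action on R^9 of conjugation by the unit
    vector n, without a grading sign. *)
Definition halfturn n : 'M[R]_9 := 2%:R *: (n^T *m n) - 1%:M.

Lemma mul_halfturn n x : x *m halfturn n = (2 * dot x n) *: n - x.
Proof.
rewrite /halfturn mulmxBr mulmx1 -scalemxAr mulmxA; congr (_ - _).
rewrite -scalerA; congr (_ *: _).
rewrite [x *m n^T]mx11_scalar mul_scalar_mx; congr (_ *: _).
by rewrite mxE; apply: eq_bigr => i _; rewrite mxE.
Qed.

Lemma clif_halfturn n x : unit_vector n -> cl n * cl x * cl n = cl (x *m halfturn n).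
Proof.
move=> Un; have nn := clif_unit_sqr Un.
rewrite mul_halfturn clifB clifZ -mulr_algl -(clifC I_sqr I_anti) mulrDl.
by rewrite -(mulrA (cl x)) nn mulr1 addrAC subrr add0r.
Qed.

Lemma halfturn_orth n : unit_vector n -> halfturn n *m (halfturn n)^T = 1%:M.
Proof.
rewrite unit_vectorE => nn.
have -> : (halfturn n)^T = halfturn n.
  by rewrite /halfturn linearB /= linearZ /= trmx_mul trmxK trmx1.
apply/row_matrixP => i; rewrite !rowE mulmxA !mul_halfturn.
rewrite dotDl dotNl dotZl nn mulr1 mulmx1 opprB.
set d := dot _ _; have -> : 2 * (2 * d - d) = 2 * d :> R by ring.
by rewrite subrr add0r || rewrite addrCA subrr addr0.
Qed.

(* In odd dimension a half-turn is a rotation; the sign comes from the matrix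
   determinant lemma. *)
Lemma det_halfturn n : unit_vector n -> \det (halfturn n) = 1.
Proof.
rewrite unit_vectorE => nn.
have n1 : n *m n^T = 1%:M.
  rewrite [LHS]mx11_scalar; congr (_%:M); rewrite mxE -[RHS]nn.
  by apply: eq_bigr => i _; rewrite mxE.
have E : \det (1%:M - 2%:R *: (n^T *m n)) = -1.
  (* The two block factorizations below compute one determinant: the first through the 1 by 1 block
     1 - 2 n n^T = -1, the second through the wanted 9 by 9 block. *)
  have := erefl (\det (block_mx (1%:M : 'M[R]_9) (2%:R *: n^T) n (1%:M : 'M[R]_1))).
  have E1 : block_mx (1%:M : 'M[R]_9) (2%:R *: n^T) n (1%:M : 'M[R]_1) =
      block_mx 1%:M 0 n 1%:M *m block_mx 1%:M (2%:R *: n^T) 0 (1%:M - 2%:R *: (n *m n^T)).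
    rewrite mulmx_block !mul1mx !mul0mx !addr0 !mulmx1.
    by congr block_mx; rewrite -scalemxAr addrC subrK.
  have E2 : block_mx (1%:M : 'M[R]_9) (2%:R *: n^T) n (1%:M : 'M[R]_1) =
      block_mx 1%:M (2%:R *: n^T) 0 1%:M *m block_mx (1%:M - 2%:R *: (n^T *m n)) 0 n 1%:M.
    rewrite mulmx_block !mul1mx !mul0mx !add0r !mulmx1.
    by congr block_mx; rewrite -scalemxAl subrK.
  rewrite {1}E1 E2 !det_mulmx !det_ublock !det_lblock !det1 !mul1r !mulr1.
  move=> <-; rewrite n1 det_mx11 !mxE eqxx /=; ring.
have -> : halfturn n = -1 *: (1%:M - 2%:R *: (n^T *m n)).
  by rewrite scaleN1r opprB.
by rewrite detZ E -signr_odd /= expr1 mulrNN mulr1.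
Qed.

Lemma Spin9_conj g : Spin9 I g -> exists A : 'M[R]_9,
  [/\ A *m A^T = 1%:M, \det A = 1 & forall x, g * cl x * g^-1 = cl (x *m A)].
Proof.
move=> Sg; rewrite (Spin9_inv Sg); case: Sg => s [_ Us ->].
elim: s Us => [|v s IH] Us.
  by exists 1%:M; rewrite trmx1 mulmx1 det1; split=> // x;
    rewrite big_nil trmx1 mul1r mulr1 mulmx1.
have [] := IH; first by move=> w ws; apply: Us; rewrite inE ws orbT.
move=> A [A1 dA HA]; have Uv : unit_vector v by apply: Us; rewrite inE eqxx.
exists (A *m halfturn v); split.
- by rewrite trmx_mul mulmxA -(mulmxA A) halfturn_orth// mulmx1.
- by rewrite det_mulmx dA det_halfturn// mulr1.
- move=> x; rewrite big_cons [(_ * _)^T]trmx_mul tr_clif// mulmxA -clif_halfturn// -HA.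
  by rewrite !mulrA.
Qed.

Lemma orth_dot (A : 'M[R]_9) x y : A *m A^T = 1%:M -> dot (x *m A) (y *m A) = dot x y.
Proof.
have dE u w : dot u w = (u *m w^T) 0 0.
  by rewrite mxE; apply: eq_bigr => i _; rewrite mxE.
by move=> A1; rewrite !dE trmx_mul mulmxA -(mulmxA x) A1 mulmx1.
Qed.

Lemma dot_ee i j : dot (e i) (e j) = (i == j)%:R.
Proof. by rewrite dot_delta mxE eqxx eq_sym. Qed.

Lemma J12E : J12 I = cl (e 0) * cl (e 1).
Proof. by rewrite !clif_delta. Qed.

Lemma orbit12E g A : Spin9 I g -> (forall x, g * cl x * g^-1 = cl (x *m A)) ->
  orbit12 I g = cl (e 0 *m A) * cl (e 1 *m A).
Proof.
move=> Sg HA; rewrite /orbit12 J12E -!HA !mulrA.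
by rewrite -[g * cl (e 0) * g^-1 * g]mulrA mulVr ?mulr1// Spin9_unit.
Qed.

Lemma orthonormal_T1 u v : unit_vector u -> unit_vector v -> dot u v = 0 ->
  T1 I (cl v * cl u) /\ frame I (cl v * cl u) u v.
Proof.
rewrite !unit_vectorE => uu vv uv.
have u0 : u != 0 by rewrite -dot_eq0 uu oner_eq0.
have := frame_T1 I_sqr I_anti u0 (etrans vv (esym uu)) uv.
by rewrite uu invr1 scale1r.
Qed.

Lemma T1_orthonormal J : T1 I J -> exists u v,
  [/\ unit_vector u, unit_vector v, dot u v = 0 & J = cl v * cl u].
Proof.
move=> T1J; have [i [u [v [_ F u0]]]] := frame_exists I_sqr I_anti T1J.
pose k := (Num.sqrt (dot u u))^-1.
have r0 := dot_gt0 u0; have kk : k * (k * dot u u) = 1.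
  rewrite /k -{3}(sqr_sqrtr (ltW r0)); field.
  by rewrite gt_eqF// sqrtr_gt0.
exists (k *: u), (k *: v).
have F' := frame_scale k F.
have uu : dot (k *: u) (k *: u) = 1 by rewrite dotZl dotZr.
rewrite !unit_vectorE; split=> //.
- by rewrite (frame_norm I_sym I_sqr I_anti T1J F').
- exact: (frame_orth I_sym I_sqr I_anti T1J F').
- by rewrite (frame_T1E I_sqr I_anti F') uu scale1r.
Qed.

(** [J12] is e_0 e_1 while a frame has J = v u, so u is the image of e_1 and v that of e_0. The last
    clause lets a further element h act on this frame. *)
Lemma orbit12_frame g : Spin9 I g -> exists u v, [/\ unit_vector u, unit_vector v,
  dot u v = 0, orbit12 I g = cl v * cl u &
  forall h, Spin9 I h -> orbit12 I (h * g) = (h * cl v * h^-1) * (h * cl u * h^-1)].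
Proof.
move=> Sg; have [A [A1 _ HA]] := Spin9_conj Sg.
exists (e 1 *m A), (e 0 *m A); rewrite !unit_vectorE !orth_dot// !dot_ee; split=> //.
  exact: orbit12E.
move=> h Sh; have [B [B1 _ HB]] := Spin9_conj Sh.
rewrite !HB -!mulmxA; apply: orbit12E; first exact: Spin9_mul.
move=> x; rewrite mulmxA -HB -HA invrM ?Spin9_unit// !mulrA.
by [].
Qed.

Lemma orbit12_T1 g : Spin9 I g -> T1 I (orbit12 I g).
Proof.
by move=> /orbit12_frame[u [v [Uu Uv uv -> _]]]; have [] := orthonormal_T1 Uu Uv uv.
Qed.

Lemma J12_frame : T1 I (J12 I) /\ frame I (J12 I) (e 1) (e 0).
Proof.
rewrite J12E; apply: orthonormal_T1; rewrite ?unit_vectorE ?dot_ee//.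
Qed.

Lemma det2E (A : 'M[R]_2) : \det A = A 0 0 * A 1 1 - A 0 1 * A 1 0.
Proof.
rewrite (expand_det_row _ 0) !big_ord_recl big_ord0 addr0 /cofactor !det_mx11 !mxE /=.
rewrite expr0 mul1r add0n expr1 mulN1r mulrN.
by congr (A _ _ * A _ _ - A _ _ * A _ _); apply: val_inj.
Qed.

Local Notation i0 := (lshift 7 (0 : 'I_2)).
Local Notation i1 := (lshift 7 (1 : 'I_2)).

Lemma e0E : e 0 = delta_mx 0 i0 :> 'rV[R]_(2 + 7).
Proof. by congr (delta_mx _ _); apply: val_inj. Qed.

Lemma e1E : e 1 = delta_mx 0 i1 :> 'rV[R]_(2 + 7).
Proof. by congr (delta_mx _ _); apply: val_inj. Qed.

Lemma ord2P (P : 'I_2 -> Prop) : P 0 -> P 1 -> forall a, P a.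
Proof.
by move=> P0 P1 [[|[|//]] h]; [move: P0|move: P1]; congr P; apply: val_inj.
Qed.

Lemma block_row (A : 'M[R]_2) (B : 'M[R]_7) (i : 'I_2) :
  (delta_mx 0 (lshift 7 i) : 'rV[R]_(2 + 7)) *m block_mx A 0 0 B =
  A i 0 *: (delta_mx 0 i0 : 'rV[R]_(2 + 7)) + A i 1 *: delta_mx 0 i1.
Proof.
rewrite !delta_mx_lshift mul_row_block !mulmx0 !mul0mx !addr0.
rewrite !scale_row_mx !scaler0 add_row_mx addr0; congr row_mx.
rewrite -rowE [LHS]row_sum_delta !big_ord_recl big_ord0 addr0 !mxE.
by congr (A _ _ *: delta_mx _ _ + A _ _ *: delta_mx _ _); apply: val_inj.
Qed.

Lemma clif2_mul (a b c d : R) :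
  (a *: I 0 + b *: I 1) * (c *: I 0 + d *: I 1) =
  (a * c + b * d)%:A + (a * d - b * c) *: J12 I.
Proof.
rewrite mulrDl !mulrDr -!scalerAl -!scalerAr !I_sqr.
rewrite (I_anti (a := 1) (b := 0))// -/(J12 I); move: (J12 I) => X.
by apply/matrixP => s t; rewrite !mxE; ring.
Qed.

(** The product of the two rotated basis vectors is the dot product of the rows of A, which is 0,
    plus det A times [J12]. *)
Lemma Spin2Spin7_fix g : Spin2Spin7 I g -> orbit12 I g = J12 I.
Proof.
move=> [Sg [A [B [[A1 dA] _ H]]]]; rewrite (orbit12E Sg H).
have := block_row A B 0; have := block_row A B 1; rewrite -e0E -e1E => -> ->.
rewrite !clifD !clifZ !clif_delta clif2_mul.
have -> : A 0 0 * A 1 0 + A 0 1 * A 1 1 = 0.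
  move/matrixP/(_ 0 1): A1; rewrite !mxE !big_ord_recl big_ord0 addr0 !mxE /=.
  by move=> H0; rewrite -[RHS]H0; congr (A _ _ * A _ _ + A _ _ * A _ _); apply: val_inj.
by rewrite -det2E dA scale0r add0r scale1r.
Qed.

(** Both (e_1, e_0) and its image are frames of [J12], so by [frame_unique] the first two rows of
    the rotation stay in that plane and form a plane rotation, of determinant p^2 + q^2 = 1.
    Orthogonality then kills the lower left block, and det B = 1 follows from the total
    determinant. *)
Lemma fix_Spin2Spin7 g : Spin9 I g -> orbit12 I g = J12 I -> Spin2Spin7 I g.
Proof.
move=> Sg fixg; split=> //; have [N [N1 dN HN]] := Spin9_conj Sg.
have ee i k : dot (e i *m N) (e k *m N) = (i == k)%:R by rewrite orth_dot// dot_ee.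
have [T1J F] := J12_frame.
have F' : frame I (J12 I) (e 1 *m N) (e 0 *m N).
  rewrite -fixg (orbit12E Sg HN).
  by have [] := @orthonormal_T1 (e 1 *m N) (e 0 *m N); rewrite ?unit_vectorE ?ee.
have e10 : e 1 != 0 by rewrite -dot_eq0 dot_ee oner_eq0.
have [p [q [E1 E0]]] := frame_unique I_sym I_sqr I_anti T1J e10 F F'.
pose N' : 'M[R]_(2 + 7) := N.
have r0 (j : 'I_9) : N 0 j = q * (1 == j)%:R + p * (0 == j)%:R.
  by have /rowP/(_ j) := E0; rewrite -rowE !mxE !eqxx /= ![j == _]eq_sym.
have r1 (j : 'I_9) : N 1 j = p * (1 == j)%:R - q * (0 == j)%:R.
  by have /rowP/(_ j) := E1; rewrite -rowE !mxE !eqxx /= ![j == _]eq_sym.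
have l0 : lshift 7 (0 : 'I_2) = 0 :> 'I_9 by apply: val_inj.
have l1 : lshift 7 (1 : 'I_2) = 1 :> 'I_9 by apply: val_inj.
have ur0 : ursubmx N' = 0.
  apply/matrixP => a b; rewrite !mxE; elim/ord2P: a.
    rewrite [lshift 7 0]l0 r0 -[1 == _]/(false) -[0 == _]/(false).
    by rewrite !mulr0 addr0.
  rewrite [lshift 7 1]l1 r1 -[1 == _]/(false) -[0 == _]/(false).
  by rewrite !mulr0 subr0.
set A := ulsubmx N'; set B := drsubmx N'; set D := dlsubmx N'.
have NE : N' = block_mx A 0 D B by rewrite -[LHS]submxK ur0.
have : N' *m N'^T = 1%:M by exact: N1.
rewrite NE tr_block_mx mulmx_block !trmx0 !mulmx0 !mul0mx !addr0 scalar_mx_block.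
move=> /eq_block_mx[A1 _ DA DB].
have D0 : D = 0.
  by rewrite -[D]mulmx1 -(mulmx1C A1) mulmxA DA mul0mx.
have B1 : B *m B^T = 1%:M by move: DB; rewrite D0 mul0mx add0r.
have dA : \det A = 1.
  have pq : p * p + q * q = 1.
    have := ee 0 0; rewrite E0 dotDl !dotZl !dotDr !dotZr !dot_ee /=.
    by rewrite !mulr1 !mulr0 addr0 add0r addrC => ->.
  rewrite det2E !mxE [lshift 7 0]l0 [lshift 7 1]l1 !r0 !r1 -[RHS]pq.
  have b10 : (1 == 0 :> 'I_9) = false by [].
  have b01 : (0 == 1 :> 'I_9) = false by [].
  by rewrite !eqxx !b10 !b01 /= !mulr0n !mulr1n; ring.
have dB : \det B = 1.
  have : \det N' = 1 by exact: dN.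
  by rewrite NE D0 det_ublock dA mul1r.
exists A, B; split=> // v; rewrite HN; congr (cl (v *m _)).
by rewrite -[LHS]/N' NE D0.
Qed.

Lemma orbit12_mul g h : Spin9 I g -> Spin9 I h ->
  orbit12 I (g * h) = g * orbit12 I h * g^-1.
Proof. by move=> Sg Sh; rewrite /orbit12 invrM ?Spin9_unit// !mulrA. Qed.

Lemma lcoset_orbit12 g h : Spin9 I g -> Spin9 I h ->
  lcoset_Spin I g = lcoset_Spin I h <-> orbit12 I g = orbit12 I h.
Proof.
have S1 : Spin2Spin7 I 1.
  by apply: (fix_Spin2Spin7 Spin9_1); rewrite /orbit12 mul1r invr1 mulr1.
have sub (x y : M) : Spin9 I x -> Spin9 I y -> orbit12 I x = orbit12 I y ->
    lcoset_Spin I x `<=` lcoset_Spin I y.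
  move=> Sx Sy xy _ [k Hk <-]; exists (y^-1 * (x * k)); last first.
    by rewrite mulrA mulrV ?mul1r// Spin9_unit.
  have Sk : Spin9 I k by case: Hk.
  have SVy := Spin9_V Sy.
  apply: fix_Spin2Spin7; first by apply: Spin9_mul => //; exact: Spin9_mul.
  rewrite orbit12_mul//; last exact: Spin9_mul.
  rewrite orbit12_mul// (Spin2Spin7_fix Hk) -/(orbit12 I x) xy /orbit12 invrK.
  by rewrite !mulrA mulVr ?Spin9_unit// mul1r -mulrA mulVr ?Spin9_unit// mulr1.
move=> Sg Sh; split=> [E|E].
  have : lcoset_Spin I h g by rewrite -E; exists 1; rewrite ?mulr1.
  move=> [k Hk <-]; rewrite orbit12_mul//; last by case: Hk.
  by rewrite (Spin2Spin7_fix Hk).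
by apply/seteqP; split; apply: sub.
Qed.

Definition normalize x := (Num.sqrt (dot x x))^-1 *: x.

Lemma normalize_unit x : x != 0 -> unit_vector (normalize x).
Proof.
move=> x0; have r0 := dot_gt0 x0; rewrite unit_vectorE dotZl dotZr.
rewrite -{3}(sqr_sqrtr (ltW r0)); field.
by rewrite gt_eqF// sqrtr_gt0.
Qed.

Lemma halfturn_perp n x : dot x n = 0 -> x *m halfturn n = - x.
Proof. by move=> xn; rewrite mul_halfturn xn mulr0 scale0r sub0r. Qed.

(** The axis is the bisector of the two unit vectors, and a half-turn about it exchanges them. *)
Lemma halfturn_sum x y : unit_vector x -> unit_vector y -> x + y != 0 ->
  x *m halfturn (normalize (x + y)) = y.
Proof.
rewrite !unit_vectorE => xx yy s0; have r0 := dot_gt0 s0.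
rewrite mul_halfturn; apply/eqP; rewrite subr_eq [y + x]addrC; apply/eqP.
rewrite /normalize dotZr scalerA -[RHS]scale1r; congr (_ *: _).
have E : dot (x + y) (x + y) = 2 * dot x (x + y).
  by rewrite !dotDl !dotDr xx yy (dotC y x); ring.
have E' : dot x (x + y) = dot (x + y) (x + y) / 2 by rewrite E; field.
rewrite E'; set r := dot (x + y) (x + y) in r0 *.
have KK := sqr_sqrtr (ltW r0); have K0 : Num.sqrt r != 0 by rewrite gt_eqF// sqrtr_gt0.
by rewrite -{2}KK; field.
Qed.

Lemma exists_perp x y : exists n, [/\ unit_vector n, dot x n = 0 & dot y n = 0].
Proof.
pose D := row_mx x^T y^T; have K0 : kermx D != 0.
  rewrite kermx_eq0; apply/negP => /eqP rD.
  by have := rank_leq_col D; rewrite rD.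
have := nz_row_sub (kermx D); set n := nz_row _ => /sub_kermxP.
have n0 : n != 0 by rewrite nz_row_eq0.
have dE u w : dot u w = (w *m u^T) 0 0.
  by rewrite mxE; apply: eq_bigr => i _; rewrite mxE mulrC.
rewrite mul_mx_row -[X in _ = X]row_mx0 => /eq_row_mx[nx ny].
exists (normalize n); split; first exact: normalize_unit.
  by rewrite dotZr (dE x) nx mxE mulr0.
by rewrite dotZr (dE y) ny mxE mulr0.
Qed.

(** The bisector degenerates when y = - x; then any axis orthogonal to x and w serves, and dimension
    9 leaves room for one. *)
Lemma halfturn_exists x y w : unit_vector x -> unit_vector y ->
  dot w x = 0 -> dot w y = 0 ->
  exists n, [/\ unit_vector n, x *m halfturn n = y & w *m halfturn n = - w].
Proof.
move=> Ux Uy wx wy; have [/eqP|s0] := eqVneq (x + y) 0.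
  rewrite addrC addr_eq0 => /eqP yE.
  have [n [Un xn wn]] := exists_perp x w.
  by exists n; split=> //; rewrite halfturn_perp.
exists (normalize (x + y)); split; [exact: normalize_unit|exact: halfturn_sum|].
by rewrite halfturn_perp// dotZr [dot w (x + y)]dotDr wx wy addr0 mulr0.
Qed.

Lemma clif_pair_conj x y w : unit_vector x -> unit_vector y ->
  (cl y * cl x) * cl w * (cl y * cl x)^-1 = cl (w *m (halfturn x *m halfturn y)).
Proof.
move=> Ux Uy; rewrite (Spin9_inv (Spin9_pair Uy Ux)).
by rewrite [(_ * _)^T]trmx_mul !tr_clif// mulmxA -!clif_halfturn// -!mulrA.
Qed.

Lemma Spin9_transitive J : T1 I J -> exists2 g, Spin9 I g & orbit12 I g = J.
Proof.
move=> /T1_orthonormal[u [v [Uu Uv uv ->]]].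
have Ue i : unit_vector (e i) by rewrite unit_vectorE dot_ee eqxx.
have UNv : unit_vector (- v).
  by rewrite unit_vectorE dotNl dotNr opprK -unit_vectorE.
have d0 x : dot 0 x = 0 by rewrite -(scale0r 0) dotZl mul0r.
(* The target is - v because the second half-turn, which carries the image w of e_1 to u, negates
   vectors orthogonal to its axis and so turns - v into v. *)
have [n1 [Un1 n1v _]] := @halfturn_exists (e 0) (- v) 0 (Ue 0) UNv (d0 _) (d0 _).
pose w := e 1 *m halfturn n1.
have H1 := halfturn_orth Un1.
have Uw : unit_vector w by rewrite unit_vectorE /w orth_dot// dot_ee.
have vw : dot v w = 0.
  by rewrite -[v]opprK dotNl -n1v /w orth_dot// dot_ee oppr0.
have [n2 [Un2 n2u n2v]] := halfturn_exists Uw Uu vw (etrans (dotC v u) uv).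
have Sg := Spin9_pair Un2 Un1; exists (cl n2 * cl n1) => //.
rewrite (orbit12E Sg (fun x => clif_pair_conj x Un1 Un2)) !mulmxA n1v.
by rewrite -/w n2u mulNmx n2v opprK.
Qed.

End SpinAlgebra.

(** * The homeomorphism of the quotient of Spin(9) with T1 *)

Section ContinuousAt.
Context (R : realType) (V : normedModType R) (T : topologicalType) (t : T).
Implicit Types (f g : T -> V) (k : T -> R).

Lemma add_continuous_at f g : {for t, continuous f} -> {for t, continuous g} ->
  {for t, continuous (fun s => f s + g s)}.
Proof. by move=> cf cg; exact: cvgD. Qed.

Lemma opp_continuous_at f : {for t, continuous f} -> {for t, continuous (fun s => - f s)}.
Proof. by move=> cf; exact: cvgN. Qed.

Lemma sub_continuous_at f g : {for t, continuous f} -> {for t, continuous g} ->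
  {for t, continuous (fun s => f s - g s)}.
Proof. by move=> cf cg; exact: cvgB. Qed.

Lemma scale_continuous_at k f : {for t, continuous k} -> {for t, continuous f} ->
  {for t, continuous (fun s => k s *: f s)}.
Proof. by move=> ck cf; exact: cvgZ. Qed.

Lemma neq0_near f : {for t, continuous f} -> f t != 0 -> \forall s \near t, f s != 0.
Proof.
move=> cf f0; apply: (cf [set v | v != 0]); apply: open_nbhs_nbhs; split=> //.
rewrite (_ : [set v | _] = ~` [set 0]); last by apply/seteqP; split=> v /= /eqP.
by rewrite openC; exact/accessible_closed_set1/hausdorff_accessible/norm_hausdorff.
Qed.

Lemma id_continuous_at : {for t, continuous (fun s : T => s)}.
Proof. exact: cvg_id. Qed.

End ContinuousAt.

Section SpinQuotientMap.
Context (R : realType) (I : 'I_9 -> 'M[R]_16).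
Hypothesis I_sym : forall a, (I a)^T = I a.
Hypothesis I_sqr : forall a, I a * I a = 1.
Hypothesis I_anti : forall a b, a != b -> I a * I b = - (I b * I a).
Local Notation M := 'M[R]_16.
Local Notation V9 := ('rV[R]_9).
Local Notation cl := (clif I).
Local Notation e i := (delta_mx 0 i : V9).
Local Notation SQ := (SpinQuotient I).
Implicit Types (g h J : M) (n u v w x y : V9).

Definition spin_quotient_T1 (q : SQ) : T1 I :=
  SigSub (mem_set (orbit12_T1 I_sym I_sqr I_anti (set_valP (repr q : Spin9 I)))).

Local Notation Phi := spin_quotient_T1.

Lemma Spin9_val (g : Spin9 I) : Spin9 I (set_val g).
Proof. exact: set_valP. Qed.

Lemma spin_quotient_T1E (g : Spin9 I) :
  set_val (Phi (\pi_SQ g)) = orbit12 I (set_val g).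
Proof.
have : \pi_SQ (repr (\pi_SQ g)) = \pi_SQ g :> SQ by rewrite reprK.
move=> /eqmodP; rewrite /= /same_lcoset => /asboolP.
move=> /(lcoset_orbit12 I_sym I_sqr I_anti (Spin9_val _) (Spin9_val _)) E.
by rewrite -E.
Qed.

Lemma spin_quotient_T1_inj : injective Phi.
Proof.
move=> q r E; rewrite -[q]reprK -[r]reprK; apply/eqmodP.
rewrite /= /same_lcoset; apply/asboolP.
apply/(lcoset_orbit12 I_sym I_sqr I_anti (Spin9_val _) (Spin9_val _)).
by rewrite -!spin_quotient_T1E !reprK E.
Qed.

Lemma spin_quotient_T1_surj (J : T1 I) : exists q, Phi q = J.
Proof.
have [g Sg gJ] := Spin9_transitive I_sym I_sqr I_anti (set_valP J).
pose gS : Spin9 I := SigSub (mem_set Sg).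
exists (\pi_SQ gS); apply: val_inj.
by rewrite -gJ; exact: (spin_quotient_T1E gS).
Qed.

(** On [Spin9] the inverse is the transpose, so upstairs the map is the restriction of a polynomial
    map of matrices. *)
Lemma spin_quotient_T1_continuous : continuous Phi.
Proof.
apply/quotient_continuous => g; apply: continuous_at_set_val.
rewrite (_ : set_val \o (Phi \o \pi_SQ) =
    (fun g : M => g *m J12 I *m g^T) \o (@set_val _ (Spin9 I))); last first.
  apply/funext => h; rewrite /= -[LHS]/(set_val (Phi (\pi_SQ h))) spin_quotient_T1E.
  by rewrite /orbit12 (Spin9_inv I_sym I_sqr I_anti (Spin9_val h)).
apply: continuous_comp; first exact: set_val_continuous.
have tl : linear (fun g : M => g^T) by move=> k a b; rewrite linearP.
pose TM := GRing.isLinear.Build _ _ _ _ _ tl.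
pose TL : {linear M -> M} := HB.pack (fun g : M => g^T) TM.
have cT : continuous TL by exact: linear_mx_continuous.
apply: differentiable_continuous.
have D1 := is_diff_mulmx (is_diff_id (set_val g)) (is_diff_cst (J12 I) (set_val g)).
by case: (is_diff_mulmx D1 (is_diff_linear (set_val g) cT)).
Qed.

Definition T1_spin_quotient (J : T1 I) : SQ := sval (cid (spin_quotient_T1_surj J)).

Lemma T1_spin_quotientK : cancel T1_spin_quotient Phi.
Proof. by move=> J; exact: svalP (cid (spin_quotient_T1_surj J)). Qed.

Lemma spin_quotient_T1K : cancel Phi T1_spin_quotient.
Proof. by move=> q; apply: spin_quotient_T1_inj; rewrite T1_spin_quotientK. Qed.

Lemma dot_continuous (T : topologicalType) (f g : T -> V9) t :
  {for t, continuous f} -> {for t, continuous g} ->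
  {for t, continuous (fun s => dot (f s) (g s))}.
Proof.
move=> cf cg; apply: (@continuous_comp _ _ _ (fun s => (f s, g s))
  (fun p : V9 * V9 => dot p.1 p.2)); first exact: continuous_at_pair.
apply: differentiable_continuous.
have D1 := is_diff_fst (is_diff_id (f t, g t)).
have D2 := is_diff_snd (is_diff_id (f t, g t)).
by case: (is_diff_dot D1 D2).
Qed.

Lemma normalize_continuous (T : topologicalType) (f : T -> V9) t :
  f t != 0 -> {for t, continuous f} -> {for t, continuous (fun s => normalize (f s))}.
Proof.
move=> f0 cf; apply: scale_continuous_at => //.
have r0 := dot_gt0 f0.
apply: (@continuous_comp _ _ _ (fun s => Num.sqrt (dot (f s) (f s))) GRing.inv).
  apply: (@continuous_comp _ _ _ (fun s => dot (f s) (f s)) Num.sqrt).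
    exact: dot_continuous.
  exact: sqrt_continuous.
by apply: inv_continuous; rewrite gt_eqF// sqrtr_gt0.
Qed.

Lemma clif_continuous (T : topologicalType) (f : T -> V9) t :
  {for t, continuous f} -> {for t, continuous (fun s => cl (f s))}.
Proof.
move=> cf; apply: (@continuous_comp _ _ _ f cl) => //.
apply: differentiable_continuous.
by case: (is_diff_clif I (is_diff_id (f t))).
Qed.

Lemma unclif_continuous (T : topologicalType) (f : T -> M) t :
  {for t, continuous f} -> {for t, continuous (fun s => unclif I (f s))}.
Proof.
move=> cf; apply: (@continuous_comp _ _ _ f (unclif I)) => //.
pose LM := GRing.isLinear.Build _ _ _ _ _ (unclif_linear I).
pose L : {linear M -> V9} := HB.pack (unclif I) LM.
exact: (@linear_mx_continuous _ _ _ _ L).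
Qed.

Lemma mulmx_continuous (T : topologicalType) (f g : T -> M) t :
  {for t, continuous f} -> {for t, continuous g} ->
  {for t, continuous (fun s => f s * g s)}.
Proof.
move=> cf cg; apply: (@continuous_comp _ _ _ (fun s => (f s, g s))
  (fun p : M * M => p.1 *m p.2)); first exact: continuous_at_pair.
apply: differentiable_continuous.
have D1 := is_diff_fst (is_diff_id (f t, g t)).
have D2 := is_diff_snd (is_diff_id (f t, g t)).
by case: (is_diff_mulmx D1 D2).
Qed.

Lemma dot_normalizeB x y z : dot x y = 0 -> dot x z = 0 -> dot x (normalize (y - z)) = 0.
Proof.
move=> xy xz; rewrite /normalize dotZr; move: _^-1 => k.
by rewrite dotDr dotNr xy xz oppr0 addr0 mulr0.
Qed.

(* The frame [(u, v)] of [J] near a frame [(u0, v0)] of [J0], and the half-turns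
   [n1 : v0 |-> v], [n2 : v |-> - v] whose product moves [J0] to [J]. *)
Section LocalSection.
Context (g0 : M) (Sg0 : Spin9 I g0) (u0 v0 : V9).
Hypotheses (Uu0 : unit_vector u0) (Uv0 : unit_vector v0) (uv0 : dot u0 v0 = 0).
Hypothesis J0E : orbit12 I g0 = cl v0 * cl u0.
Hypothesis gg0 : forall h, Spin9 I h ->
  orbit12 I (h * g0) = (h * cl v0 * h^-1) * (h * cl u0 * h^-1).

(** The sign and the factor 1/2 make the value at the base point equal to u0, since there J v0 = -
    u0. *)
Definition sec_y J := unclif I (- (2^-1 *: (J * cl v0 - cl v0 * J))).
Definition sec_u J := normalize (sec_y J).
Definition sec_v J := unclif I (J * cl (sec_u J)).
Definition sec_n1 J := normalize (v0 + sec_v J).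
Definition sec_w J := (2 * dot u0 (sec_n1 J)) *: sec_n1 J - u0.
(** The half-turn about this axis sends w to - u rather than to u: at the base point w = - u0, where
    w + u would vanish but w - u = - 2 u0 does not. It also negates v, and the two signs cancel in v
    u. *)
Definition sec_n2 J := normalize (sec_w J - sec_u J).
Definition spin_section J := cl (sec_n2 J) * cl (sec_n1 J) * g0.

Lemma spin_sectionP J : T1 I J -> sec_y J != 0 -> v0 + sec_v J != 0 ->
  sec_w J - sec_u J != 0 ->
  Spin9 I (spin_section J) /\ orbit12 I (spin_section J) = J.
Proof.
move=> T1J y0 s1 s2.
have [y [z [yE F]]] := comm_frame I_sqr I_anti T1J v0.
have ysE : sec_y J = - (2^-1 *: y).
  by rewrite /sec_y yE -clifZ -clifN (clifK I_sqr I_anti).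
have Uu : unit_vector (sec_u J) by exact: normalize_unit.
have Fu : frame I J (sec_u J) (sec_v J).
  have F1 : frame I J (sec_u J)
      ((Num.sqrt (dot (sec_y J) (sec_y J)))^-1 *: (- 2^-1 *: z)).
    have -> : sec_u J = (Num.sqrt (dot (sec_y J) (sec_y J)))^-1 *: (- 2^-1 *: y).
      by rewrite /sec_u /normalize; move: (Num.sqrt _)^-1 => k; rewrite ysE scaleNr.
    by apply: frame_scale; apply: frame_scale.
  by rewrite /sec_v F1 (clifK I_sqr I_anti).
have Uv : unit_vector (sec_v J).
  by move: Uu; rewrite !unit_vectorE (frame_norm I_sym I_sqr I_anti T1J Fu).
have uv := frame_orth I_sym I_sqr I_anti T1J Fu.
have JE : J = cl (sec_v J) * cl (sec_u J).
  rewrite (frame_T1E I_sqr I_anti Fu).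
  by move: Uu; rewrite unit_vectorE => ->; rewrite scale1r.
have Un1 : unit_vector (sec_n1 J) by exact: normalize_unit.
have Un2 : unit_vector (sec_n2 J) by exact: normalize_unit.
have v1 : v0 *m halfturn (sec_n1 J) = sec_v J by exact: halfturn_sum.
have u1 : u0 *m halfturn (sec_n1 J) = sec_w J by rewrite mul_halfturn.
have H1 := halfturn_orth Un1.
have Uw : unit_vector (sec_w J).
  by move: Uu0; rewrite !unit_vectorE -u1 orth_dot.
have vw : dot (sec_v J) (sec_w J) = 0 by rewrite -v1 -u1 orth_dot// dotC.
have UNu : unit_vector (- sec_u J).
  by move: Uu; rewrite !unit_vectorE dotNl dotNr opprK.
have u2 : sec_w J *m halfturn (sec_n2 J) = - sec_u J by exact: halfturn_sum.
have v2 : sec_v J *m halfturn (sec_n2 J) = - sec_v J.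
  by apply: halfturn_perp; apply: dot_normalizeB => //; rewrite dotC.
have Sh := Spin9_pair I Un2 Un1.
split; first exact: Spin9_mul.
rewrite gg0// !(clif_pair_conj I_sym I_sqr I_anti _ Un1 Un2) !mulmxA v1 u1 u2 v2.
by rewrite !clifN mulrNN -JE.
Qed.

Local Notation J0 := (orbit12 I g0).

Lemma base_frame : T1 I J0 /\ frame I J0 u0 v0.
Proof. by rewrite J0E; exact: orthonormal_T1. Qed.

Lemma sec_y_base : sec_y J0 = u0.
Proof.
have [T1J F] := base_frame; have F' := frame_rot T1J F.
rewrite /sec_y F' (frame_mulr I_sym I_sqr I_anti T1J F').
rewrite clifN opprK -opprD scalerN opprK scale_halfK.
exact: clifK.
Qed.

Lemma normalize_id x : unit_vector x -> normalize x = x.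
Proof. by rewrite unit_vectorE /normalize => ->; rewrite sqrtr1 invr1 scale1r. Qed.

Lemma sec_u_base : sec_u J0 = u0.
Proof. by rewrite /sec_u sec_y_base normalize_id. Qed.

Lemma sec_v_base : sec_v J0 = v0.
Proof.
by have [_ F] := base_frame; rewrite /sec_v sec_u_base F; exact: clifK.
Qed.

Lemma unit_neq0 x : unit_vector x -> x != 0.
Proof. by rewrite unit_vectorE -dot_eq0 => ->; exact: oner_neq0. Qed.

Lemma double_neq0 x : x != 0 -> x + x != 0.
Proof. by rewrite -mulr2n -scaler_nat scaler_eq0 pnatr_eq0. Qed.

Lemma normalize_double x : unit_vector x -> normalize (x + x) = x.
Proof.
move=> Ux; have xx := Ux; rewrite unit_vectorE in xx.
have -> : x + x = 2 *: x by rewrite scaler_nat mulr2n.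
rewrite /normalize dotZl dotZr xx mulr1 -expr2 sqrtr_sqr.
by rewrite ger0_norm// scalerA mulVf ?scale1r// pnatr_eq0.
Qed.

Lemma sec_w_base : sec_w J0 = - u0.
Proof.
rewrite /sec_w /sec_n1 sec_v_base normalize_double// uv0.
by rewrite mulr0 scale0r sub0r.
Qed.

Definition sec_dom J :=
  [&& sec_y J != 0, v0 + sec_v J != 0 & sec_w J - sec_u J != 0].

Lemma sec_dom_base : sec_dom J0.
Proof.
rewrite /sec_dom sec_y_base sec_w_base sec_u_base sec_v_base -opprD oppr_eq0.
by rewrite unit_neq0//= !double_neq0// unit_neq0.
Qed.

Lemma spin_section_near J : sec_dom J ->
  {for J, continuous spin_section} /\ \forall K \near J, sec_dom K.
Proof.
case/and3P => y0 s1 s2.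
have ci : {for J, continuous (fun J : M => J)} by exact: id_continuous_at.
have cc (a : M) : {for J, continuous (fun _ : M => a)} by exact: cst_continuous.
have cv (a : V9) : {for J, continuous (fun _ : M => a)} by exact: cst_continuous.
have cy : {for J, continuous sec_y}.
  apply: unclif_continuous; apply: opp_continuous_at.
  apply: scale_continuous_at; first exact: cst_continuous.
  by apply: sub_continuous_at; exact: mulmx_continuous.
have cu : {for J, continuous sec_u} by exact: normalize_continuous.
have cV : {for J, continuous sec_v}.
  exact: (unclif_continuous (mulmx_continuous ci (clif_continuous cu))).
have cvv : {for J, continuous (fun J => v0 + sec_v J)} by exact: add_continuous_at.
have c1 : {for J, continuous sec_n1} by exact: normalize_continuous.
have cw : {for J, continuous sec_w}.
  have cd : {for J, continuous (fun J => 2 * dot u0 (sec_n1 J))}.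
    apply: (@scale_continuous_at R R^o); first exact: cst_continuous.
    exact: (dot_continuous (cv u0) c1).
  exact: (sub_continuous_at (scale_continuous_at cd c1) (cv u0)).
have cwu : {for J, continuous (fun J => sec_w J - sec_u J)}.
  exact: (sub_continuous_at cw cu).
have c2 : {for J, continuous sec_n2}.
  exact: (@normalize_continuous _ (fun J => sec_w J - sec_u J) J s2 cwu).
split.
  exact: (mulmx_continuous (mulmx_continuous (clif_continuous c2) (clif_continuous c1))
    (cc g0)).
have n1 := neq0_near cy y0; have n2 := neq0_near cvv s1.
have n3 := neq0_near cwu s2.
apply: filterS2 (filterI n1 n2) n3 => K [k1 k2] k3.
exact/and3P.
Qed.

End LocalSection.

(** Near each point the chosen inverse coincides with the projection of [spin_section]. The value
    [one] only makes the local section total outside its domain. *)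
Lemma T1_spin_quotient_continuous : continuous T1_spin_quotient.
Proof.
move=> J1; have [g0 Sg0 J1E] := Spin9_transitive I_sym I_sqr I_anti (set_valP J1).
have [u [v [Uu Uv uv J0E gg0]]] := orbit12_frame I_sym I_sqr I_anti Sg0.
have Du := sec_dom_base Uu Uv uv J0E.
have [] := spin_section_near g0 Du; rewrite J1E => cs near_dom.
pose one : Spin9 I := SigSub (mem_set (Spin9_1 I)).
pose sec (J : T1 I) : Spin9 I :=
  if pselect (Spin9 I (spin_section g0 u v (set_val J))) is left Ss
  then SigSub (mem_set Ss) else one.
have near_sec : \forall J \near J1, sec_dom u v (set_val J).
  exact: (@set_val_continuous _ (T1 I) J1 _ near_dom).
have secP (J : T1 I) : sec_dom u v (set_val J) ->
    set_val (sec J) = spin_section g0 u v (set_val J) /\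
    orbit12 I (set_val (sec J)) = set_val J.
  move=> /and3P[d1 d2 d3].
  have [Ss E] := spin_sectionP Sg0 Uu Uv uv gg0 (set_valP J) d1 d2 d3.
  by rewrite /sec; case: pselect => // Ss'; rewrite /= E.
apply: (@near_eq_continuous _ _ (\pi_SQ \o sec)).
  apply: filterS near_sec => J /secP[_ E]; apply: spin_quotient_T1_inj.
  rewrite T1_spin_quotientK; apply: val_inj.
  exact: (etrans (spin_quotient_T1E (sec J)) E).
apply: continuous_comp; last exact: pi_continuous.
apply: continuous_at_set_val.
apply: (@near_eq_continuous _ _ (spin_section g0 u v \o set_val)).
  by apply: filterS near_sec => J /secP[E _]; rewrite /= E.
exact: (continuous_comp (@set_val_continuous _ (T1 I) J1) cs).
Qed.

Lemma spin_quotient_T1_homeomorphism : homeomorphism Phi.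
Proof.
split; first exact: spin_quotient_T1_continuous.
exists T1_spin_quotient; split; first exact: spin_quotient_T1K.
  exact: T1_spin_quotientK.
exact: T1_spin_quotient_continuous.
Qed.

End SpinQuotientMap.

(** * The orbit map is a submersion *)

Section Submersion.
Context (R : realType).
Local Notation V9 := ('rV[R]_9).

(* The circle through [x] with velocity [y], in its rational parametrization. *)
Lemma unit_curve (x y : V9) : unit_vector x -> dot x y = 0 ->
  exists n : R -> V9, [/\ n 0 = x, forall t, unit_vector (n t) &
    is_diff (0 : R) n (fun h => h *: y)].
Proof.
(* With 4q = |y|^2, the identity (1 - q t^2)^2 + 4q t^2 = (1 + q t^2)^2 keeps the curve on the
   sphere. *)
rewrite unit_vectorE => xx xy; pose q := dot y y / 4.
have q0 : 0 <= q by rewrite divr_ge0// dot_ge0.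
pose d (t : R) := 1 + q * (t * t).
have d0 t : d t != 0.
  have : 0 < d t by rewrite ltr_pwDl// mulr_ge0// -expr2 sqr_ge0.
  by rewrite lt_def => /andP[].
pose n t : V9 := (d t)^-1 *: ((1 + - q * (t * t)) *: x + t *: y).
exists n; split.
- by rewrite /n /d !mulr0 addr0 invr1 !scale1r scale0r addr0.
- move=> t; rewrite unit_vectorE /n dotZl dotZr.
  rewrite dotDl !dotZl !dotDr !dotZr xx (dotC y x) xy.
  have -> : dot y y = 4 * q by rewrite /q; field.
  by have := d0 t; rewrite /d => D; field.
have Di : is_diff (0 : R) (fun t : R => t) (fun h => h) by exact: is_diff_id.
have Dt := is_diff_mulf Di Di.
have Dd := is_diff_inv (is_diff_affine 1 q Dt) (d0 0).
have D1 := is_diff_scale (is_diff_affine 1 (- q) Dt) (is_diff_cst x (0 : R)).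
have D2 := is_diff_scale Di (is_diff_cst y (0 : R)).
have D3 := is_diff_scale Dd (is_diffD D1 D2).
apply: (is_diff_ext D3) => [t|h]; first by [].
rewrite !fctE; apply/rowP => i; rewrite !mxE !mulr0 !mul0r !addr0 !mulr0 invr1.
by rewrite !mul0r !add0r !mul1r.
Qed.

Context (I : 'I_9 -> 'M[R]_16).
Hypothesis I_sym : forall a, (I a)^T = I a.
Hypothesis I_sqr : forall a, I a * I a = 1.
Hypothesis I_anti : forall a b, a != b -> I a * I b = - (I b * I a).
Local Notation M := 'M[R]_16.
Local Notation cl := (clif I).

(** Differentiating J = V U gives a = V' U + V U'. Multiplying b by V U on either side produces
    these two terms up to sign, and the commutator adds them up twice. *)
Lemma spin_velocity_comm (U V U' V' a : M) : U * U = 1 -> V * V = 1 ->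
  V * U = - (U * V) -> U' * U + U * U' = 0 -> V' * V + V * V' = 0 ->
  V' * U + U * V' = 0 -> U' * V + V * U' = 0 -> a * U + V * U * U' = V' ->
  let b := V' * V + U' * U in b * (V * U) - V * U * b = 2 *: a.
Proof.
move=> UU VV VU /eqP; rewrite addr_eq0 => /eqP e1 /eqP; rewrite addr_eq0 => /eqP e2.
move=> /eqP; rewrite addr_eq0 => /eqP e3 /eqP; rewrite addr_eq0 => /eqP e4 aU b.
have aE : a = V' * U + V * U'.
  rewrite -[a]mulr1 -UU mulrA -[a * U](addrK (V * U * U')) aU mulrBl.
  by rewrite -!mulrA e1 mulrN mulrN opprK (mulrA U) UU mul1r.
have f1 : V' * V * (V * U) = V' * U by rewrite -mulrA (mulrA V) VV mul1r.
have f2 : V * U * (V' * V) = - (V' * U).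
  rewrite -mulrA (mulrA U) -[U * V']opprK -e3 mulNr mulrN -!mulrA -[U * V]opprK -VU.
  by rewrite !mulrN opprK mulrA -[V * V']opprK -e2 mulNr -mulrA (mulrA V) VV mul1r.
have f3 : U' * U * (V * U) = V * U'.
  rewrite -mulrA (mulrA U) -[U * V]opprK -VU mulNr -mulrA UU mulr1 mulrN.
  by rewrite e4 opprK.
have f4 : V * U * (U' * U) = - (V * U').
  by rewrite -mulrA (mulrA U) -[U * U']opprK -e1 mulNr mulrN -!mulrA UU mulr1.
rewrite /b mulrDl mulrDr f1 f2 f3 f4 aE scaler_nat mulr2n -opprD opprK.
by [].
Qed.

(** The curve is P(t) g, where P(t) = nv(t) v nu(t) u is a product of four unit vectors, hence stays
    in [Spin9], and P(0) = 1. Its velocity b is found from the lift of [a] to frames, and the orbit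
    moves with velocity [b, J] = a. *)
Lemma orbit12_submersionP : orbit12_submersion I.
Proof.
move=> g a Sg; have [u [v [Uu Uv uv JE _]]] := orbit12_frame I_sym I_sqr I_anti Sg.
rewrite JE; have [T1J F] := orthonormal_T1 I_sqr I_anti Uu Uv uv.
move=> /(lie_tangent _ T1J)[La Ja].
have JJ := T1_sqr T1J; have UJ := frame_mulr I_sym I_sqr I_anti T1J F.
have [aU UU' VV' VU' UV'] := frame_tangent_lift JJ F UJ (clif_sqr I_sqr I_anti u) Ja.
have [y2 y2E] := comm_Lin2 I_sqr I_anti La u.
have [y1 y1E] := comm_Lin2 I_sqr I_anti La v.
have [u' u'E] : exists u', - (2^-1 *: (a * cl v - cl v * a)) = cl u'.
  by exists (- (2^-1 *: y1)); rewrite y1E clifN clifZ.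
have [v' v'E] : exists v', 2^-1 *: (a * cl u - cl u * a) = cl v'.
  by exists (2^-1 *: y2); rewrite y2E clifZ.
rewrite u'E v'E in aU UU' VV' VU' UV'.
have orth (x y : V9) : cl x * cl y + cl y * cl x = 0 -> dot x y = 0.
  by move=> h; rewrite (@dot_of_clif _ I I_sqr I_anti x y 0) ?mul0r// scale0r.
(* Conjugation by nu(t) u turns through twice the angle between u and nu(t), so the curves of unit
   vectors are given half the velocities u' and v'. *)
have half0 (x y : V9) : dot y x = 0 -> dot x (2^-1 *: y) = 0.
  by move=> h; rewrite dotZr dotC h mulr0.
have [nu [nu0 Unu Dnu]] := unit_curve Uu (half0 _ _ (orth _ _ UU')).
have [nv [nv0 Unv Dnv]] := unit_curve Uv (half0 _ _ (orth _ _ VV')).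
have uu1 := clif_unit_sqr I_sqr I_anti Uu; have vv1 := clif_unit_sqr I_sqr I_anti Uv.
pose P t : M := (cl (nv t) *m cl v) *m (cl (nu t) *m cl u).
have SP t : Spin9 I (P t) by apply: Spin9_mul; exact: Spin9_pair.
have P0 : P 0 = 1 by rewrite /P nu0 nv0 -[cl v *m _]/(cl v * _) -[cl u *m _]/(cl u * _) uu1 vv1 mulmx1.
pose b : M := 2^-1 *: (cl v' * cl v + cl u' * cl u).
have DP : is_diff (0 : R) P (fun h => h *: b).
  have D1 := is_diff_mulmx (is_diff_clif I Dnv) (is_diff_cst (cl v) (0 : R)).
  have D2 := is_diff_mulmx (is_diff_clif I Dnu) (is_diff_cst (cl u) (0 : R)).
  apply: (is_diff_ext (is_diff_mulmx D1 D2)) => [t|h]; first by [].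
  rewrite nu0 nv0 -[cl v *m cl v]/(cl v * cl v) -[cl u *m cl u]/(cl u * cl u) uu1 vv1.
  rewrite mulmx1 mul1mx !mulmx0 !addr0 !clifZ -!scalemxAl /b.
  by rewrite -!scalerDr.
have DPT : is_diff (0 : R) (fun t => (P t)^T) (fun h => - (h *: b)).
  have tl : linear (fun g : M => g^T) by move=> k x y; rewrite linearP.
  pose TM := GRing.isLinear.Build _ _ _ _ _ tl.
  pose TL : {linear M -> M} := HB.pack (fun g : M => g^T) TM.
  have cT : continuous TL by exact: linear_mx_continuous.
  apply: (is_diff_ext (is_diff_comp DP (is_diff_linear (P 0) cT))) => [t|h]; first by [].
  rewrite /= linearZ /= -scalerN; congr (_ *: _); rewrite /b linearZ /= -scalerN.
  congr (_ *: _); rewrite linearD /= opprD; congr (_ + _).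
    rewrite [LHS]trmx_mul !tr_clif//; apply/eqP.
    by rewrite -addr_eq0 addrC; apply/eqP.
  rewrite [LHS]trmx_mul !tr_clif//; apply/eqP.
  by rewrite -addr_eq0 addrC; apply/eqP.
pose c t : M := P t *m g.
have Dc : is_diff (0 : R) c (fun h => h *: (b *m g)).
  apply: (is_diff_ext (is_diff_mulmx DP (is_diff_cst g (0 : R)))) => [t|h]; first by [].
  by rewrite mulmx0 addr0 scalemxAl.
pose J : M := cl v * cl u.
have orbE t : orbit12 I (c t) = P t *m J *m (P t)^T.
  rewrite /c -[P t *m g]/(P t * g) orbit12_mul// JE.
  by rewrite (Spin9_inv I_sym I_sqr I_anti (SP t)).
have Do : is_diff (0 : R) (orbit12 I \o c) (fun h => h *: a).
  have D1 := is_diff_mulmx DP (is_diff_cst J (0 : R)).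
  apply: (is_diff_ext (is_diff_mulmx D1 DPT)) => [t|h]; first by rewrite /= orbE.
  rewrite P0 trmx1 !mulmx1 !mul1mx -[X in (_ + X) + _]/(0 : M) addr0 /cst.
  rewrite mulmxN -scalemxAl -scalemxAr -scalerBr.
  congr (_ *: _); rewrite /b -!scalemxAl -!scalemxAr -scalerBr.
  have VU0 : cl v * cl u = - (cl u * cl v).
    by apply/eqP; rewrite -addr_eq0 (clifC I_sqr I_anti) dotC uv mulr0 scale0r.
  have := spin_velocity_comm uu1 vv1 VU0 UU' VV' VU' UV' aU.
  by rewrite /= => ->; rewrite scalerA mulVf ?scale1r// pnatr_eq0.
exists c; split.
- by rewrite /c P0 mul1mx.
- by move=> t; exact: (Spin9_mul (SP t) Sg).
- by apply: diff_derivable; case: Dc.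
- case: Do => Do dE; apply: DeriveDef; first exact: diff_derivable.
  by rewrite deriveE// dE scale1r.
Qed.

End Submersion.

Theorem mainTheorem8 (R : realType) (I : 'I_9 -> 'M[R]_16)
  (I_sym : forall a, (I a)^T = I a)
  (I_sqr : forall a, I a * I a = 1)
  (I_anti : forall a b, a != b -> I a * I b = - (I b * I a)) :
  (exists Phi : SpinQuotient I -> T1 I,
     [/\ homeomorphism Phi,
         forall g : Spin9 I,
           set_val (Phi (\pi_(SpinQuotient I) g)) = orbit12 I (set_val g) &
         orbit12_submersion I]) /\
  [/\ complex_manifold (T1_atlas I),
      complex_submanifold 7 1 (proj_atlas R 8) (quadric R 8),
      complex_manifold
        (submanifold_atlas 7 1 (proj_atlas R 8) (quadric R 8)) &
      exists F : T1 I -> quadric R 8,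
        biholomorphic (T1_atlas I)
          (submanifold_atlas 7 1 (proj_atlas R 8) (quadric R 8)) F].
Proof.
split.
  exists (spin_quotient_T1 I_sym I_sqr I_anti); split.
  - exact: spin_quotient_T1_homeomorphism.
  - exact: spin_quotient_T1E.
  - exact: orbit12_submersionP.
split.
- exact: T1_complex_manifold.
- exact: quadric_submanifold.
- exact: quadric_complex_manifold.
- by exists (to_quadric I_sym I_sqr I_anti); exact: toQ_biholomorphic.
Qed.
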